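(* Let $\tau\in\mathbb H$ satisfy $A+B\tau+C\tau^2=0$ with integers $A,B,C$, $\gcd(A,B,C)=1$, $C>0$; let $D=B^2-4AC$ and $\sqrt D:=2C\tau+B$. Let $\eta\in\mathbb C$ be any number with $1728\,\eta^{24}=E_4(\tau)^3-E_6(\tau)^2$. Then the numbers $$\sqrt D\cdot\frac{E_2^*(\tau)}{\eta^4}\cdot(AC)^2,\qquad \frac{E_4(\tau)}{\eta^8},\qquad \frac{E_6(\tau)}{\eta^{12}}$$ are algebraic integers.
   Context: $q=e^{2\pi i\tau}$, $E_2(\tau)=1-24\sum_{n\ge1}n\frac{q^n}{1-q^n}$, $E_4(\tau)=1+240\sum_{n\ge1}n^3\frac{q^n}{1-q^n}$, $E_6(\tau)=1-504\sum_{n\ge1}n^5\frac{q^n}{1-q^n}$, $E_2^*(\tau)=E_2(\tau)-\frac{3}{\pi\operatorname{Im}\tau}$. *)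

(* Defs.v *)
From Stdlib Require Import Reals ZArith.
Open Scope R_scope.

Record Cx := mkC { Re : R ; Im : R }.

Definition C0 : Cx := mkC 0 0.
Definition C1 : Cx := mkC 1 0.
Definition RtoC (r : R) : Cx := mkC r 0.
Definition ZtoC (z : Z) : Cx := RtoC (IZR z).
Definition Cadd (z w : Cx) : Cx := mkC (Re z + Re w) (Im z + Im w).
Definition Copp (z : Cx) : Cx := mkC (- Re z) (- Im z).
Definition Csub (z w : Cx) : Cx := Cadd z (Copp w).
Definition Cmul (z w : Cx) : Cx :=
  mkC (Re z * Re w - Im z * Im w) (Re z * Im w + Im z * Re w).
(* multiplicative inverse; Cinv C0 = C0 by the convention of Stdlib's Rinv *)
Definition Cinv (z : Cx) : Cx :=
  let d := Re z * Re z + Im z * Im z in mkC (Re z / d) (- Im z / d).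
Definition Cdiv (z w : Cx) : Cx := Cmul z (Cinv w).
Fixpoint Cpow (z : Cx) (n : nat) : Cx :=
  match n with O => C1 | S m => Cmul z (Cpow z m) end.
Definition Cexp (z : Cx) : Cx := mkC (exp (Re z) * cos (Im z)) (exp (Re z) * sin (Im z)).

Fixpoint Csum (f : nat -> Cx) (n : nat) : Cx :=
  match n with O => C0 | S m => Cadd (Csum f m) (f m) end.

Definition Cseries_cv (f : nat -> Cx) (l : Cx) : Prop :=
  Un_cv (fun N => Re (Csum f N)) (Re l) /\ Un_cv (fun N => Im (Csum f N)) (Im l).

(* q = e^{2 pi i tau} *)
Definition qpar (tau : Cx) : Cx := Cexp (mkC (- 2 * PI * Im tau) (2 * PI * Re tau)).

Definition lambert_term (k : nat) (tau : Cx) (m : nat) : Cx :=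
  let n := S m in
  Cmul (RtoC (INR n ^ k))
       (Cdiv (Cpow (qpar tau) n) (Csub C1 (Cpow (qpar tau) n))).

Definition is_Eisenstein (k : nat) (c : R) (tau : Cx) (E : Cx) : Prop :=
  exists S, Cseries_cv (lambert_term k tau) S /\ E = Cadd C1 (Cmul (RtoC c) S).

Definition is_E2 (tau E : Cx) : Prop := is_Eisenstein 1 (-24) tau E.
Definition is_E4 (tau E : Cx) : Prop := is_Eisenstein 3 240 tau E.
Definition is_E6 (tau E : Cx) : Prop := is_Eisenstein 5 (-504) tau E.

Definition E2star_of (tau E2 : Cx) : Cx := Csub E2 (RtoC (3 / (PI * Im tau))).

Definition is_alg_int (z : Cx) : Prop :=
  exists (n : nat) (c : nat -> Z),
    Cadd (Cpow z n) (Csum (fun i => Cmul (ZtoC (c i)) (Cpow z i)) n) = C0.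

(* Main.v *)
From Stdlib Require Reals ZArith.
From HB Require Import structures.
From mathcomp Require Import all_boot all_order all_algebra finmap.
From mathcomp Require Import mathcomp_extra boolp classical_sets reals.
From mathcomp Require Import interval_inference filter topology normedtype landau sequences derive realfun exp trigo.
From mathcomp Require Import complex.
From mathcomp Require Import ring lra zify.
From mathcomp Require Rstruct Rstruct_topology.
Require Defs.
Set Implicit Arguments. Unset Strict Implicit. Unset Printing Implicit Defensive.
Import Order.TTheory GRing.Theory Num.Theory numFieldNormedType.Exports.
Local Open Scope ring_scope.
Local Open Scope complex_scope.

(** Everything rests on modular forms of level one with algebraic-integer q-coefficients. Such a
    form of weight 12m equals Delta^m P(j), where P has algebraic-integer coefficients
    ([level_one]): the coefficients of P are peeled off the q-expansion with powers of E4^3, and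
    what remains at weight 0 vanishes at the cusp, hence is zero ([weight0_zero]). This needs the
    transformation laws of the q-series and the fact that Delta = (E4^3 - E6^2)/1728 has no zero
    ([Delta_neq0]). The laws come from lattice sums. Partial fractions of the cotangent ([cK_diff])
    yield the Lipschitz formula ([lipschitz]), which turns the rows of a lattice sum into q-series;
    this gives [E4_S] and [E6_S]. In weight 2 the sum must be regularised, and the resulting anomaly
    ([E2_quasi]) is exactly what the nonholomorphic term of the completed series [E2s] absorbs
    ([E2s_S]).

    Integer matrices M of determinant n act by the slash operator. Modulo SL2(Z) on the left there
    are finitely many, represented by upper triangular [reps], whose slashed forms expand in q^(1/n)
    with algebraic-integer coefficients up to an explicit constant. Right multiplication by SL2(Z)
    permutes the resulting finite family of functions, so its symmetric functions have level one and
    [level_one] applies to them. Two families are used.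

    The first is [fG], equal to E4^3 (Delta|M) - (E4^3|M) Delta, which vanishes at tau when M fixes
    tau. If n is not a square, each member of the family has, up to a constant, a lowest coefficient
    that is a unit among the algebraic integers. The product of the family is then Delta^(2N) P(j)
    up to a constant, P has a unit as leading coefficient, and P(j(tau)) = 0; so j(tau) is an
    algebraic integer ([j_integral]). A matrix of nonsquare determinant fixing a quadratic tau is
    found in [tau_j_integral].

    The second is [phi], equal to n E2s - n^2 (E2s|M), of weight 2. For the representatives the
    nonholomorphic parts cancel and leave n E2(t) - a^2 E2((a t + b)/d). The sixth power has weight
    12 and is a root of a monic polynomial whose coefficients are of the form Delta^(N-i) P_i(j), so
    phi(tau)^6 / Delta(tau) is an algebraic integer ([phi_integral]).

    Now eta^24 = Delta(tau). The cube of E4/eta^8 is j(tau) and the square of E6/eta^12 is j(tau) -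
    1728, so both are integral. For E2, the matrix with rows (-B, -A) and (C, 0) has determinant AC
    and fixes tau, and the quadratic equation turns AC (C tau) phi(tau) into sqrt(D) (AC)^2 times
    the completed E2 ([sqrtD_alg]). Here C tau is integral, and so is phi(tau)/eta^4, its sixth
    power being integral. *)

Section Modulus.
Variable R : realType.
Implicit Types x y z : R[i].

(** * The modulus of a complex number *)

Definition nm (z : R[i]) : R := Normc.normc z.

Lemma nm0 : nm 0 = 0. Proof. exact: Normc.normc0. Qed.
Lemma nm1 : nm 1 = 1. Proof. exact: Normc.normc1. Qed.
Lemma nmM x y : nm (x * y) = nm x * nm y. Proof. exact: Normc.normcM. Qed.
Lemma nmV x : nm x^-1 = (nm x)^-1. Proof. exact: Normc.normcV. Qed.
Lemma nmD x y : nm (x + y) <= nm x + nm y. Proof. exact: le_normcD. Qed.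
Lemma nmN x : nm (- x) = nm x. Proof. exact: normcN. Qed.
Lemma nm_ge0 x : 0 <= nm x. Proof. by case: x => a b; exact: sqrtr_ge0. Qed.
Lemma nm_eq0 x : (nm x == 0) = (x == 0).
Proof.
apply/eqP/eqP => [|->]; [exact: Normc.eq0_normc|exact: nm0].
Qed.
Lemma nm_gt0 x : (0 < nm x) = (x != 0).
Proof. by rewrite lt_def nm_eq0 nm_ge0 andbT. Qed.
Lemma nmB x y : nm (x - y) = nm (y - x). Proof. by rewrite -nmN opprB. Qed.
Lemma nm_distD z x y : nm (x - y) <= nm (x - z) + nm (z - y).
Proof. by rewrite (_ : x - y = (x - z) + (z - y)); [exact: nmD|ring]. Qed.
Lemma nmX x n : nm (x ^+ n) = nm x ^+ n.
Proof. by elim: n => [|n IH]; rewrite ?expr0 ?nm1 // !exprS nmM IH. Qed.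
Lemma nm_real (a : R) : nm a%:C = `|a|.
Proof. by rewrite /nm /= expr0n /= addr0 sqrtr_sqr. Qed.
Lemma nm_nat n : nm n%:R = n%:R.
Proof. by rewrite -(rmorph_nat (real_complex R)) nm_real ger0_norm. Qed.
Lemma nm_sum (I : Type) (r : seq I) (P : pred I) (f : I -> R[i]) :
  nm (\sum_(i <- r | P i) f i) <= \sum_(i <- r | P i) nm (f i).
Proof.
elim/big_rec2: _ => [|i u v _ h]; first by rewrite nm0.
exact: le_trans (nmD _ _) (lerD _ _).
Qed.
Lemma nm_dist_le x y : nm x - nm y <= nm (x - y).
Proof. by rewrite lerBlDr {1}(_ : x = (x - y) + y) ?nmD //; ring. Qed.
Lemma nm_sq x : nm x ^+ 2 = (complex.Re x) ^+ 2 + (complex.Im x) ^+ 2.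
Proof. by case: x => a b; rewrite /nm /= sqr_sqrtr ?addr_ge0 ?sqr_ge0. Qed.
Lemma Re_le_nm x : `|complex.Re x| <= nm x.
Proof.
rewrite -ler_sqr ?nnegrE ?nm_ge0 ?normr_ge0 // nm_sq real_normK ?num_real //.
by rewrite lerDl sqr_ge0.
Qed.
Lemma Im_le_nm x : `|complex.Im x| <= nm x.
Proof.
rewrite -ler_sqr ?nnegrE ?nm_ge0 ?normr_ge0 // nm_sq real_normK ?num_real //.
by rewrite lerDr sqr_ge0.
Qed.
Lemma nm_le_ReIm x : nm x <= `|complex.Re x| + `|complex.Im x|.
Proof.
rewrite -ler_sqr ?nnegrE ?nm_ge0 ?addr_ge0 ?normr_ge0 // nm_sq.
rewrite -(real_normK (num_real (complex.Re x))) -(real_normK (num_real (complex.Im x))).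
rewrite sqrrD lerD2r lerDl mulrn_wge0 // mulr_ge0 ?normr_ge0 //.
Qed.
Lemma nm_small0 x : (forall e, 0 < e -> nm x <= e) -> x = 0.
Proof.
move=> h; apply/eqP; rewrite -nm_eq0 eq_le nm_ge0 andbT.
by apply/ler_addgt0Pl => e e0; rewrite addr0 h.
Qed.

End Modulus.

(** * Unordered summation of complex families *)

Section Sums.
Variable R : realType.
Local Notation C := R[i].

Definition summable (I : choiceType) (f : I -> C) :=
  exists B : R, forall F : {fset I}, \sum_(i <- F) nm (f i) <= B.

(** Convergence of the net of finite partial sums. The index type carries no order, so sums can be
    transported along bijections, products and fibres. *)
Definition has_sum (I : choiceType) (f : I -> C) (s : C) :=
  forall e : R, 0 < e -> exists F0 : {fset I}, forall F : {fset I},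
    (F0 `<=` F)%fset -> nm (\sum_(i <- F) f i - s) <= e.

(** The chosen sum, with default value 0 when the family has none. *)
Definition tsum (I : choiceType) (f : I -> C) : C := xget 0 [set s | has_sum f s]%classic.

Section OneIndex.
Variable I : choiceType.
Implicit Types f g : I -> C.

Lemma has_sum_uniq f s t : has_sum f s -> has_sum f t -> s = t.
Proof.
move=> hs ht; apply/eqP; rewrite -subr_eq0; apply/eqP; apply: nm_small0 => e e0.
have e2 : 0 < e / 2 by lra.
have [F0 h0] := hs _ e2; have [F1 h1] := ht _ e2.
have := h0 (F0 `|` F1)%fset (fsubsetUl _ _); have := h1 (F0 `|` F1)%fset (fsubsetUr _ _).
set S := \sum_(i <- _) _ => a b.
by have := nm_distD S s t; rewrite (nmB s S); lra.
Qed.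

Lemma tsum_eq f s : has_sum f s -> tsum f = s.
Proof.
move=> h; apply: (has_sum_uniq _ h).
by have := xgetPex 0 (ex_intro [set s | has_sum f s]%classic s h).
Qed.

Lemma eq_tsum f g : f =1 g -> tsum f = tsum g.
Proof. by move=> /funext ->. Qed.

Lemma has_sum_finite (F0 : {fset I}) f : (forall i, i \notin F0 -> f i = 0) ->
  has_sum f (\sum_(i <- F0) f i).
Proof.
move=> h e e0; exists F0 => F sF; rewrite -(big_fset_incl _ sF); last by move=> x _; exact: h.
by rewrite subrr nm0 ltW.
Qed.

Lemma has_sum0 : has_sum (fun _ : I => 0) 0.
Proof.
have := @has_sum_finite fset0 (fun _ => 0) (fun _ _ => erefl).
by rewrite big_seq_fset0.
Qed.

Lemma has_sumD f g s t : has_sum f s -> has_sum g t ->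
  has_sum (fun i => f i + g i) (s + t).
Proof.
move=> hs ht e e0; have e2 : 0 < e / 2 by lra.
have [F0 h0] := hs _ e2; have [F1 h1] := ht _ e2.
exists (F0 `|` F1)%fset => F sF.
have a := h0 F (fsubset_trans (fsubsetUl _ _) sF).
have b := h1 F (fsubset_trans (fsubsetUr _ _) sF).
rewrite big_split /= (_ : _ - _ = (\sum_(i <- F) f i - s) + (\sum_(i <- F) g i - t)); last by ring.
by apply: le_trans (nmD _ _) _; lra.
Qed.

Lemma has_sumZ (c : C) f s : has_sum f s -> has_sum (fun i => c * f i) (c * s).
Proof.
move=> hs e e0; have c0 : 0 < nm c + 1 by rewrite ltr_wpDl ?nm_ge0.
have [F0 h0] := hs _ (divr_gt0 e0 c0); exists F0 => F sF.
rewrite -mulr_sumr -mulrBr nmM.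
apply: le_trans (ler_wpM2l (nm_ge0 _) (h0 _ sF)) _.
by rewrite mulrA ler_pdivrMr // mulrDr mulr1 [nm c * e]mulrC lerDl ltW.
Qed.

Lemma has_sumN f s : has_sum f s -> has_sum (fun i => - f i) (- s).
Proof.
move=> h; rewrite -mulN1r (_ : (fun i => - f i) = (fun i => -1 * f i)); first exact: has_sumZ.
by apply: funext => i; rewrite mulN1r.
Qed.

Lemma has_sumB f g s t : has_sum f s -> has_sum g t ->
  has_sum (fun i => f i - g i) (s - t).
Proof. by move=> hf hg; apply: has_sumD => //; exact: has_sumN. Qed.

Lemma summable_le f g : (forall i, nm (f i) <= nm (g i)) -> summable g -> summable f.
Proof.
move=> h [B hB]; exists B => F; apply: le_trans (hB F); exact: ler_sum.
Qed.

Lemma summable0 : summable (fun _ : I => 0).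
Proof. by exists 0 => F; rewrite big1 // => i _; exact: nm0. Qed.

Lemma summableD f g : summable f -> summable g -> summable (fun i => f i + g i).
Proof.
move=> [B hB] [D hD]; exists (B + D) => F.
apply: le_trans (lerD (hB F) (hD F)); rewrite -big_split /=.
by apply: ler_sum => i _; exact: nmD.
Qed.

Lemma summableZ c f : summable f -> summable (fun i => c * f i).
Proof.
move=> [B hB]; exists (nm c * B) => F.
under eq_bigr do rewrite nmM.
by rewrite -mulr_sumr ler_wpM2l ?nm_ge0.
Qed.

Lemma summableN f : summable f -> summable (fun i => - f i).
Proof. by apply: summable_le => i; rewrite nmN. Qed.

Lemma summableB f g : summable f -> summable g -> summable (fun i => f i - g i).
Proof. by move=> hf hg; apply: summableD => //; exact: summableN. Qed.

Lemma summable_leZ (c : R) f g : (forall i, nm (f i) <= c * nm (g i)) -> summable g -> summable f.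
Proof.
move=> h hg; apply: (@summable_le _ (fun i => c%:C * g i)); last exact: summableZ.
move=> i; apply: le_trans (h i) _; rewrite nmM nm_real ler_wpM2r ?nm_ge0 //.
exact: ler_norm.
Qed.

Lemma summable_finite (F0 : {fset I}) f : (forall i, i \notin F0 -> f i = 0) -> summable f.
Proof.
move=> h; exists (\sum_(i <- F0) nm (f i)) => F.
rewrite (big_fsetID _ (fun i => i \in F0)) /= [X in _ + X]big1_fset ?addr0; last first.
  by move=> i; rewrite !inE => /andP[_ /h ->] _; rewrite nm0.
rewrite [leRHS](big_fsetID _ (fun i => i \in F)) /=.
rewrite (_ : [fset x in F | x \in F0]%fset = [fset x in F0 | x \in F]%fset); last first.
  by apply/fsetP => i; rewrite !inE andbC.
by rewrite lerDl sumr_ge0 // => i _; exact: nm_ge0.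
Qed.

(** The sum is the supremum of the finite partial sums. *)
Let has_sum_nneg (f : I -> R) B : (forall i, 0 <= f i) ->
  (forall F : {fset I}, \sum_(i <- F) f i <= B) -> exists s, has_sum (fun i => (f i)%:C) s.
Proof.
move=> f0 fB; pose E : set R := [set x | exists F : {fset I}, x = \sum_(i <- F) f i]%classic.
have nE : (E !=set0)%classic by exists 0; exists fset0; rewrite big_seq_fset0.
have bE : has_ubound E by exists B => x [F ->].
exists (sup E)%:C => e e0.
have [x [F0 ->] hx] := sup_adherent e0 (conj nE bE).
exists F0 => F sF.
have l1 : \sum_(i <- F0) f i <= \sum_(i <- F) f i.
  rewrite [leRHS](big_fsetID _ (fun i => i \in F0)) /=.
  rewrite (_ : [fset x in F | x \in F0]%fset = F0); last first.
    by apply/fsetP => i; rewrite !inE andbC; case h: (i \in F0) => //=; rewrite (fsubsetP sF).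
  by rewrite lerDl sumr_ge0.
have l2 : \sum_(i <- F) f i <= sup E by apply: ub_le_sup => //; exists F.
rewrite -rmorph_sum -rmorphB nm_real ler_norml; apply/andP; split; lra.
Qed.

(** Real and imaginary parts are treated separately. A real g dominated by |f| is the difference of
    the nonnegative families |f| + g and |f|. *)
Lemma summable_has_sum f : summable f -> exists s, has_sum f s.
Proof.
move=> [B hB].
have real (g : I -> R) : (forall i, `|g i| <= nm (f i)) -> exists s, has_sum (fun i => (g i)%:C) s.
  move=> h.
  have [s hs] : exists s, has_sum (fun i => (nm (f i))%:C) s.
    by apply: (@has_sum_nneg _ B) => // i; exact: nm_ge0.
  have [t ht] : exists s, has_sum (fun i => (nm (f i) + g i)%:C) s.
    apply: (@has_sum_nneg _ (B + B)).
      by move=> i; have := h i; rewrite ler_norml => /andP[]; lra.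
    move=> F; rewrite big_split /=; apply: lerD => //; apply: le_trans (hB F).
    by apply: ler_sum => i _; apply: le_trans (h i); exact: ler_norm.
  exists (t - s); have := has_sumB ht hs; congr has_sum; apply: funext => i.
  by rewrite -rmorphB; congr _%:C; ring.
have [s hs] := real _ (fun i => Re_le_nm (f i)).
have [t ht] := real _ (fun i => Im_le_nm (f i)).
exists (s + 'i * t); have := has_sumD hs (has_sumZ 'i ht); congr has_sum.
by apply: funext => i; rewrite [RHS]complexE.
Qed.

Lemma tsumP f : summable f -> has_sum f (tsum f).
Proof. by move=> /summable_has_sum [s h]; rewrite (tsum_eq h). Qed.

Lemma tsumD f g : summable f -> summable g -> tsum (fun i => f i + g i) = tsum f + tsum g.
Proof. by move=> hf hg; apply: tsum_eq; apply: has_sumD; exact: tsumP. Qed.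
Lemma tsumB f g : summable f -> summable g -> tsum (fun i => f i - g i) = tsum f - tsum g.
Proof. by move=> hf hg; apply: tsum_eq; apply: has_sumB; exact: tsumP. Qed.
Lemma tsumZ c f : summable f -> tsum (fun i => c * f i) = c * tsum f.
Proof. by move=> hf; apply: tsum_eq; apply: has_sumZ; exact: tsumP. Qed.
Lemma tsum_finite (F0 : {fset I}) f : (forall i, i \notin F0 -> f i = 0) ->
  tsum f = \sum_(i <- F0) f i.
Proof. by move=> h; apply: tsum_eq; exact: has_sum_finite. Qed.
Lemma tsum0 f : f =1 (fun _ => 0) -> tsum f = 0.
Proof. by move=> /funext ->; apply: tsum_eq; exact: has_sum0. Qed.

Lemma has_sum_le f s B : has_sum f s -> (forall F : {fset I}, \sum_(i <- F) nm (f i) <= B) -> nm s <= B.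
Proof.
move=> hs hB; apply/ler_addgt0Pr => e e0; have [F0 h0] := hs _ e0.
have := h0 F0 (fsubset_refl _); have := nm_sum (enum_fset F0) xpredT f; have := hB F0.
have := nm_dist_le s (\sum_(i <- F0) f i); rewrite nmB; lra.
Qed.

Lemma has_sum_summable_nm f s : summable f -> has_sum f s ->
  exists2 t : R, has_sum (fun i => (nm (f i))%:C) t%:C & nm s <= t.
Proof.
move=> [B hB] hs.
have [t ht] : exists t, has_sum (fun i => (nm (f i))%:C) t.
  by apply: has_sum_nneg (hB) => i; exact: nm_ge0.
(* The sum t of the moduli is obtained as a complex number; its imaginary part is at most the
   distance to any real partial sum, hence 0. *)
have tE : t = (complex.Re t)%:C.
  apply/eqP; rewrite -subr_eq0; apply/eqP; apply: nm_small0 => e e0.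
  have [F0 h0] := ht _ e0; have := h0 F0 (fsubset_refl _).
  rewrite -rmorph_sum; apply: le_trans.
  rewrite (_ : t - _ = 'i * (complex.Im t)%:C); last by rewrite {1}[t]complexE addrC addKr.
  rewrite nmM nm_real [nm 'i](_ : _ = 1); last by rewrite /nm /= expr0n expr1n add0r sqrtr1.
  rewrite mul1r; apply: le_trans (Im_le_nm _).
  by case: (t) => a b /=; rewrite sub0r normrN.
rewrite tE in ht; exists (complex.Re t) => //; apply: has_sum_le hs _ => F.
apply/ler_addgt0Pr => e e0; have [F0 h0] := ht _ e0.
have := h0 (F0 `|` F)%fset (fsubsetUl _ _); rewrite -rmorph_sum -rmorphB nm_real ler_norml => /andP[_ h1].
rewrite -lerBlDl; apply: le_trans h1; rewrite lerD2r.
rewrite [leRHS](big_fsetID _ (fun i => i \in F)) /=.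
rewrite (_ : [fset x in (F0 `|` F) | x \in F]%fset = F); last first.
  by apply/fsetP => i; rewrite !inE andbC; case: (i \in F); rewrite ?orbT.
by rewrite lerDl sumr_ge0 // => i _; exact: nm_ge0.
Qed.

End OneIndex.
End Sums.

(** * Reindexing, Fubini, fibres and dominated convergence *)

Section Fubini.
Variable R : realType.
Local Notation C := R[i].

Lemma big_fsetM (V : nmodType) (I J : choiceType) (A : {fset I}) (B : {fset J}) (f : I * J -> V) :
  \sum_(p <- (A `*` B)%fset) f p = \sum_(i <- A) \sum_(j <- B) f (i, j).
Proof.
rewrite -big_allpairs; apply: perm_big; apply: uniq_perm.
- exact: fset_uniq.
- by rewrite allpairs_uniq ?fset_uniq // => -[a b] [c d] _ _ /=.
- move=> [i j]; rewrite in_fsetM /=; apply/idP/allpairsP => /= [/andP[h1 h2]|[[a b] /= [h1 h2 [-> ->]]]].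
    by exists (i, j).
  by rewrite h1.
Qed.

Lemma ler_sum_fsub (I : choiceType) (A B : {fset I}) (f : I -> R) :
  (A `<=` B)%fset -> (forall i, 0 <= f i) -> \sum_(i <- A) f i <= \sum_(i <- B) f i.
Proof.
move=> sAB f0; rewrite [leRHS](big_fsetID _ (fun i => i \in A)) /=.
rewrite (_ : [fset x in B | x \in A]%fset = A); last first.
  by apply/fsetP => i; rewrite !inE andbC; case h: (i \in A) => //=; rewrite (fsubsetP sAB).
by rewrite lerDl sumr_ge0.
Qed.

Lemma preimage_fset (I J : choiceType) (h : I -> J) (F : {fset J}) : injective h ->
  exists G : {fset I}, forall i, (i \in G) = (h i \in F).
Proof.
move=> hi; pose g j := match pselect (exists i, h i = j) with
  left e => Some (projT1 (cid e)) | right _ => None end.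
have gP i j : g j = Some i <-> h i = j.
  rewrite /g; case: pselect => [e|e].
    case: cid => k hk /=; split => [[<-] //|hij].
    by congr Some; apply: hi; rewrite hij.
  by split => // hij; case: e; exists i.
exists [fset i in pmap g F]%fset => i; rewrite !inE mem_pmap.
apply/mapP/idP => [[j jF /esym/gP ->]//|hF]; exists (h i) => //.
by apply/esym/gP.
Qed.

Lemma sum_imfset (V : nmodType) (I J : choiceType) (h : I -> J) (G : {fset I}) (f : J -> V) :
  injective h -> \sum_(j <- [fset h i | i in G]%fset) f j = \sum_(i <- G) f (h i).
Proof. by move=> hi; rewrite big_imfset //= => x y _ _; exact: hi. Qed.

Lemma has_sum_inj (I J : choiceType) (h : I -> J) (f : J -> C) s :
  injective h -> (forall j, f j != 0 -> exists i, h i = j) ->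
  has_sum (f \o h) s -> has_sum f s.
Proof.
move=> hi hs H e e0; have [F0 h0] := H e e0; exists [fset h i | i in F0]%fset => F sF.
have [G GP] := preimage_fset F hi.
have -> : \sum_(j <- F) f j = \sum_(i <- G) (f \o h) i; last first.
  by apply: h0; apply/fsubsetP => i iF; rewrite GP (fsubsetP sF) // in_imfset.
rewrite -(sum_imfset G f hi).
apply/esym/big_fset_incl.
  by apply/fsubsetP => j /imfsetP[i /=]; rewrite GP => hF ->.
move=> j jF jG; apply/eqP; apply/negPn/negP => /hs [i hij].
by move: jG; rewrite -hij in_imfset //= GP hij jF.
Qed.

Lemma summable_comp (I J : choiceType) (h : I -> J) (f : J -> C) :
  injective h -> summable f -> summable (f \o h).
Proof.
move=> hi [B hB]; exists B => F.
by rewrite -(sum_imfset F (fun j => nm (f j)) hi).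
Qed.

Lemma tsum_reindex_inj (I J : choiceType) (h : I -> J) (f : J -> C) :
  injective h -> (forall j, f j != 0 -> exists i, h i = j) -> summable f ->
  tsum (f \o h) = tsum f.
Proof.
move=> hi hs sf; apply/esym/tsum_eq/(has_sum_inj hi hs)/tsumP.
exact: summable_comp.
Qed.

Lemma summable_inj (I J : choiceType) (h : I -> J) (f : J -> C) :
  injective h -> (forall j, f j != 0 -> exists i, h i = j) ->
  summable (f \o h) -> summable f.
Proof.
move=> hi hs [B hB]; exists B => F.
have [G GP] := preimage_fset F hi; apply: le_trans (hB G).
rewrite -(sum_imfset G (fun j => nm (f j)) hi).
rewrite le_eqVlt; apply/orP; left; apply/eqP/esym/big_fset_incl.
  by apply/fsubsetP => j /imfsetP[i /=]; rewrite GP => hF ->.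
move=> j jF jG; apply/eqP; rewrite nm_eq0; apply/negPn/negP => /hs [i hij].
by move: jG; rewrite -hij in_imfset //= GP hij jF.
Qed.

Lemma tsum_bij (I J : choiceType) (h : I -> J) (k : J -> I) (f : J -> C) :
  cancel h k -> cancel k h -> summable f -> tsum (f \o h) = tsum f.
Proof.
move=> hk kh; apply: tsum_reindex_inj; first exact: can_inj hk.
by move=> j _; exists (k j).
Qed.

Section Prod.
Variables I J : choiceType.
Variable f : I * J -> C.
Hypothesis sf : summable f.

Lemma summable_row i : summable (fun j => f (i, j)).
Proof. by apply: (@summable_comp _ _ (fun j => (i, j))) sf => x y []. Qed.

Lemma summable_col j : summable (fun i => f (i, j)).
Proof. by apply: (@summable_comp _ _ (fun i => (i, j))) sf => x y []. Qed.

Let r i := tsum (fun j => f (i, j)).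

(** A single finite set of columns approximates finitely many row sums at once, by induction on the
    rows with half the error each time. This is what lets finite rectangles stand in for iterated
    sums below. *)
Lemma rows_approx (s : seq I) (e : R) : 0 < e -> exists J0 : {fset J}, forall J1 : {fset J},
  (J0 `<=` J1)%fset -> \sum_(i <- s) nm (\sum_(j <- J1) f (i, j) - r i) <= e.
Proof.
elim: s e => [|i s IH] e e0; first by exists fset0 => J1 _; rewrite big_nil ltW.
have e2 : 0 < e / 2 by lra.
have [J0 h0] := IH _ e2; have [J1 h1] := tsumP (summable_row i) e2.
exists (J0 `|` J1)%fset => K sK; rewrite big_cons.
have := h0 K (fsubset_trans (fsubsetUl _ _) sK).
by have := h1 K (fsubset_trans (fsubsetUr _ _) sK); rewrite /r; lra.
Qed.

Lemma summable_rows : summable r.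
Proof.
have [B hB] := sf; exists B => F; apply/ler_addgt0Pr => e e0.
have [J0 h0] := rows_approx F e0; have := h0 J0 (fsubset_refl _).
have := hB (F `*` J0)%fset; rewrite big_fsetM => h1 h2.
have : \sum_(i <- F) nm (r i) <= \sum_(i <- F) \sum_(j <- J0) nm (f (i, j)) +
   \sum_(i <- F) nm (\sum_(j <- J0) f (i, j) - r i); last by lra.
rewrite -big_split /=; apply: ler_sum => i _.
have := nm_sum (enum_fset J0) xpredT (fun j => f (i, j)).
have := nm_dist_le (r i) (\sum_(j <- J0) f (i, j)); rewrite nmB; lra.
Qed.

Lemma has_sum_rows : has_sum r (tsum f).
Proof.
move=> e e0; have e2 : 0 < e / 2 by lra.
have [F0 h0] := tsumP sf e2.
exists [fset p.1 | p in F0]%fset => F sF.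
have [J0 hJ] := rows_approx F e2.
pose J1 := (J0 `|` [fset p.2 | p in F0])%fset.
have := h0 (F `*` J1)%fset; have := hJ J1 (fsubsetUl _ _).
rewrite big_fsetM => h1 h2.
have {}h2 : nm (\sum_(i <- F) \sum_(j <- J1) f (i, j) - tsum f) <= e / 2.
  apply: h2; apply/fsubsetP => -[i j] ijF; rewrite in_fsetM /= inE; apply/andP; split.
    by apply: (fsubsetP sF); apply/imfsetP; exists (i, j).
  by apply/orP; right; apply/imfsetP; exists (i, j).
have := nm_distD (\sum_(i <- F) \sum_(j <- J1) f (i, j)) (\sum_(i <- F) r i) (tsum f).
have : nm (\sum_(i <- F) r i - \sum_(i <- F) \sum_(j <- J1) f (i, j)) <= e / 2; last by lra.
rewrite nmB -sumrB; exact: le_trans (nm_sum _ _ _) h1.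
Qed.

Lemma tsum_rows : tsum f = tsum (fun i => tsum (fun j => f (i, j))).
Proof. by rewrite (tsum_eq has_sum_rows). Qed.

End Prod.

Lemma summable_swap (I J : choiceType) (f : I * J -> C) : summable f ->
  summable (fun p : J * I => f (p.2, p.1)).
Proof. by apply: (@summable_comp _ _ (fun p : J * I => (p.2, p.1))) => -[a b] [c d] [-> ->]. Qed.

Lemma tsum_cols (I J : choiceType) (f : I * J -> C) : summable f ->
  tsum f = tsum (fun j => tsum (fun i => f (i, j))).
Proof.
move=> sf; rewrite -(tsum_rows (summable_swap sf)); apply/esym.
by apply: (@tsum_bij _ _ (fun p : J * I => (p.2, p.1)) (fun p => (p.2, p.1))) sf => -[].
Qed.

Lemma summable_cols (I J : choiceType) (f : I * J -> C) : summable f ->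
  summable (fun j => tsum (fun i => f (i, j))).
Proof. by move=> sf; exact: (summable_rows (summable_swap sf)). Qed.

(** Tonelli's criterion: a finite set of pairs is enclosed in a rectangle, and the rectangle is
    bounded row by row. *)
Lemma summable_rows_nm (I J : choiceType) (f : I * J -> C) (b : I -> C) :
  (forall i (F : {fset J}), \sum_(j <- F) nm (f (i, j)) <= nm (b i)) -> summable b -> summable f.
Proof.
move=> hb [B hB]; exists B => F; apply: le_trans (hB [fset p.1 | p in F]%fset).
pose F1 := [fset p.1 | p in F]%fset; pose F2 := [fset p.2 | p in F]%fset.
apply: le_trans (_ : \sum_(p <- (F1 `*` F2)%fset) nm (f p) <= _).
  apply: ler_sum_fsub => [|i]; last exact: nm_ge0.
  apply/fsubsetP => -[i j] ijF; rewrite in_fsetM /=; apply/andP; split;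
  by apply/imfsetP; exists (i, j).
by rewrite big_fsetM; apply: ler_sum => i _; exact: hb.
Qed.

Lemma summable_prod (I J : choiceType) (f : I -> C) (g : J -> C) : summable f -> summable g ->
  summable (fun p : I * J => f p.1 * g p.2).
Proof.
move=> sf [B hB]; apply: (@summable_rows_nm _ _ _ (fun i => `|B|%:C * f i)); last exact: summableZ.
move=> i F /=; under eq_bigr do rewrite nmM.
rewrite -mulr_sumr nmM nm_real normr_id mulrC ler_wpM2r ?nm_ge0 //.
exact: le_trans (hB F) (ler_norm _).
Qed.

Lemma tsum_prod (I J : choiceType) (f : I -> C) (g : J -> C) : summable f -> summable g ->
  tsum (fun p : I * J => f p.1 * g p.2) = tsum f * tsum g.
Proof.
move=> sf sg; rewrite (tsum_rows (summable_prod sf sg)) /=.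
under eq_tsum do rewrite (tsumZ _ sg) mulrC.
by rewrite tsumZ // mulrC.
Qed.

(* Summation by fibres of an arbitrary map p. *)
Lemma summable_fiber (I J : choiceType) (p : I -> J) (f : I -> C) : summable f ->
  summable (fun q : I * J => if p q.1 == q.2 then f q.1 else 0).
Proof.
move=> sf; apply: (summable_rows_nm (b := f)) sf => i F /=.
rewrite (eq_bigr (fun j => if j == p i then nm (f i) else 0)); last first.
  by move=> j _; rewrite eq_sym; case: eqP => // _; rewrite nm0.
apply: le_trans (ler_sum_fsub (fsubsetUr [fset p i]%fset F) _) _.
  by move=> j; case: ifP => // _; exact: nm_ge0.
rewrite (big_fsetD1 (p i)) ?inE ?eqxx //= big1_fset ?addr0 // => j.
by rewrite !inE => /andP[/negPf ->].
Qed.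

Lemma tsum_fiber (I J : choiceType) (p : I -> J) (f : I -> C) : summable f ->
  tsum f = tsum (fun j => tsum (fun i => if p i == j then f i else 0)).
Proof.
move=> sf; rewrite -(tsum_cols (summable_fiber p sf)) (tsum_rows (summable_fiber p sf)) /=.
apply: eq_tsum => i; rewrite (@tsum_finite _ _ [fset p i]%fset) ?big_seq_fset1 ?eqxx // => j.
by rewrite inE eq_sym => /negPf ->.
Qed.

Lemma summable_fibers (I J : choiceType) (p : I -> J) (f : I -> C) : summable f ->
  summable (fun j => tsum (fun i => if p i == j then f i else 0)).
Proof. by move=> sf; exact: (summable_cols (summable_fiber p sf)). Qed.

(* Dominated convergence along finite sets exhausting the index type. *)
Lemma tannery (I : choiceType) (f : nat -> I -> C) (g : I -> C) (b : I -> C) (S : nat -> {fset I})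
   (s : nat -> C) (l : C) :
  summable b -> (forall i, nm (g i) <= nm (b i)) ->
  (exists N0, forall N i, (N0 <= N)%N -> i \in S N -> nm (f N i) <= nm (b i)) ->
  (forall i, exists N0, forall N, (N0 <= N)%N -> i \in S N) ->
  (forall i e, 0 < e -> exists N0, forall N, (N0 <= N)%N -> nm (f N i - g i) <= e) ->
  (forall N, s N = \sum_(i <- S N) f N i) ->
  (forall e, 0 < e -> exists N0, forall N, (N0 <= N)%N -> nm (s N - l) <= e) ->
  tsum g = l.
Proof.
move=> sb hg [M0 hf] hS hfg hs hl.
have sg : summable g := summable_le hg sb.
apply/eqP; rewrite -subr_eq0; apply/eqP; apply: nm_small0 => e e0.
have e5 : 0 < e / 5 by lra.
have [bB [F1 hF1]] : exists bB : R, exists F1 : {fset I}, forall F : {fset I}, (F1 `<=` F)%fset ->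
    \sum_(i <- F) nm (b i) <= bB + e / 5 /\ bB - e / 5 <= \sum_(i <- F) nm (b i).
  have [t ht _] := has_sum_summable_nm sb (tsumP sb).
  have [F1 h1] := ht _ e5; exists t, F1 => F sF.
  have := h1 F sF; rewrite -rmorph_sum -rmorphB nm_real ler_norml => /andP[]; lra.
have [F2 hF2] := tsumP sg e5.
pose F0 := (F1 `|` F2)%fset.
have [N1 hN1] : exists N1, forall N, (N1 <= N)%N -> (F0 `<=` S N)%fset.
  have : exists N1, forall N, (N1 <= N)%N -> all (fun i => i \in S N) F0.
    elim: (enum_fset F0) => [|i r [N1 h1]]; first by exists 0%N.
    have [N2 h2] := hS i; exists (maxn N1 N2) => N; rewrite geq_max => /andP[n1 n2] /=.
    by rewrite h1 // h2.
  by move=> [N1 h1]; exists N1 => N /h1 /allP h; apply/fsubsetP.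
have [N2 hN2] : exists N2, forall N, (N2 <= N)%N -> \sum_(i <- F0) nm (f N i - g i) <= e / 5.
  elim: (enum_fset F0) (e / 5) e5 => [|i r IH] d d0; first by exists 0%N => N _; rewrite big_nil ltW.
  have d2 : 0 < d / 2 by lra.
  have [N1' h1] := IH _ d2; have [N2 h2] := hfg i _ d2.
  exists (maxn N1' N2) => N; rewrite geq_max => /andP[n1 n2]; rewrite big_cons.
  by have := h1 N n1; have := h2 N n2; lra.
have [N3 hN3] := hl _ e5.
pose N := maxn (maxn M0 N1) (maxn N2 N3).
have n0 : (M0 <= N)%N by rewrite /N !leq_max leqnn.
have n1 : (N1 <= N)%N by rewrite /N !leq_max leqnn !orbT.
have n2 : (N2 <= N)%N by rewrite /N !leq_max leqnn !orbT.
have n3 : (N3 <= N)%N by rewrite /N !leq_max leqnn !orbT.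
have sub := hN1 _ n1.
have a1 : nm (\sum_(i <- F0) g i - tsum g) <= e / 5 by apply: hF2; exact: fsubsetUr.
have a2 : nm (\sum_(i <- F0) f N i - \sum_(i <- F0) g i) <= e / 5.
  by rewrite -sumrB; exact: le_trans (nm_sum _ _ _) (hN2 _ n2).
(* Outside [F0] the terms are dominated by [b], whose finite sums over [S N] and over [F0] both lie
   within e/5 of its total. *)
have a3 : nm (s N - \sum_(i <- F0) f N i) <= 2 * (e / 5).
  rewrite hs (big_fsetID _ (fun i => i \in F0) (S N)) /=.
  rewrite (_ : [fset x in S N | x \in F0]%fset = F0); last first.
    by apply/fsetP => i; rewrite !inE /= andbC; case h: (_ || _) => //=; rewrite (fsubsetP sub) // inE.
  rewrite addrAC subrr add0r; apply: le_trans (nm_sum _ _ _) _.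
  apply: le_trans (_ : \sum_(i <- [fset x in S N | x \notin F0]%fset) nm (b i) <= _).
    rewrite big_seq [leRHS]big_seq; apply: ler_sum => i; rewrite !inE => /andP[iS _].
    exact: hf.
  have [u1 _] := hF1 (S N) (fsubset_trans (fsubsetUl _ _) sub).
  have [_ u2] := hF1 F0 (fsubsetUl _ _).
  move: u1; rewrite (big_fsetID _ (fun i => i \in F0) (S N)) /=.
  rewrite (_ : [fset x in S N | x \in F0]%fset = F0); last first.
    by apply/fsetP => i; rewrite !inE /= andbC; case h: (_ || _) => //=; rewrite (fsubsetP sub) // inE.
  lra.
have a4 := hN3 _ n3.
have := nm_distD (\sum_(i <- F0) g i) (tsum g) l.
have := nm_distD (\sum_(i <- F0) f N i) (\sum_(i <- F0) g i) l.
have := nm_distD (s N) (\sum_(i <- F0) f N i) l.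
rewrite (nmB (tsum g) (\sum_(i <- F0) g i)) (nmB (\sum_(i <- F0) g i) (\sum_(i <- F0) f N i)) (nmB (\sum_(i <- F0) f N i) (s N)); lra.
Qed.

End Fubini.

(** * Power series *)

Section PowerSeries.
Variable R : realType.
Local Notation C := R[i].
Implicit Types c d : nat -> C.

Definition iotaF (N : nat) : {fset nat} := seq_fset tt (iota 0 N).

Lemma in_iotaF N i : (i \in iotaF N) = (i < N)%N.
Proof. by rewrite seq_fsetE mem_iota. Qed.

Lemma sum_iotaF (V : nmodType) N (f : nat -> V) : \sum_(i <- iotaF N) f i = \sum_(i < N) f i.
Proof.
rewrite -(big_mkord xpredT f) /index_iota subn0; apply: perm_big; apply: uniq_perm => [||i].
- exact: fset_uniq.
- exact: iota_uniq.
- by rewrite in_iotaF mem_iota.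
Qed.

Lemma ltn_fset_max (F : {fset nat}) i : i \in F -> (i < (\max_(i <- F) i).+1)%N.
Proof. by move=> iF; rewrite ltnS; apply: (@leq_bigmax_seq _ (enum_fset F) xpredT id i). Qed.

Lemma summable_nat (f : nat -> C) (B : R) : (forall n, \sum_(i < n) nm (f i) <= B) -> summable f.
Proof.
move=> hB; exists B => F; apply: le_trans (hB (\max_(i <- F) i).+1).
rewrite -(sum_iotaF _ (fun i => nm (f i))).
apply: ler_sum_fsub => [|i]; last exact: nm_ge0.
by apply/fsubsetP => i iF; rewrite in_iotaF ltn_fset_max.
Qed.

Lemma has_sum_partial (f : nat -> C) s : has_sum f s -> forall e, 0 < e -> exists N0 : nat,
  forall N, (N0 <= N)%N -> nm (\sum_(i < N) f i - s) <= e.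
Proof.
move=> h e e0; have [F hF] := h e e0; exists (\max_(i <- F) i).+1 => N hN.
rewrite -sum_iotaF; apply: hF; apply/fsubsetP => i iF.
by rewrite in_iotaF (leq_trans (ltn_fset_max iF) hN).
Qed.

Lemma tsum_partial (f : nat -> C) s : summable f ->
  (forall e, 0 < e -> exists N0 : nat, forall N, (N0 <= N)%N -> nm (\sum_(i < N) f i - s) <= e) ->
  tsum f = s.
Proof.
move=> sf h; apply/eqP; rewrite -subr_eq0; apply/eqP; apply: nm_small0 => e e0.
have e2 : 0 < e / 2 by lra.
have [N1 h1] := h _ e2; have [N2 h2] := has_sum_partial (tsumP sf) e2.
have := h1 (maxn N1 N2) (leq_maxl _ _); have := h2 (maxn N1 N2) (leq_maxr _ _).
set S := \sum_(i < _) _; have := nm_distD S (tsum f) s; rewrite (nmB (tsum f) S); lra.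
Qed.

Lemma summable_partial_bound (f : nat -> C) : summable f -> exists B : R, forall n, \sum_(i < n) nm (f i) <= B.
Proof. by move=> [B hB]; exists B => n; rewrite -(sum_iotaF n (fun i => nm (f i))). Qed.

Lemma tail_small (f : nat -> C) : summable f -> forall e, 0 < e -> exists N : nat,
  forall F : {fset nat}, (forall i, i \in F -> (N <= i)%N) -> \sum_(i <- F) nm (f i) <= e.
Proof.
move=> sf e e0; have [t ht _] := has_sum_summable_nm sf (tsumP sf).
have e2 : 0 < e / 2 by lra.
have [N hN] := has_sum_partial ht e2.
have [F0 h0] := ht _ e2.
exists (maxn N (\max_(i <- F0) i).+1) => F hF.
have dis : [disjoint F0 & F]%fset.
  rewrite fdisjoint_sym; apply/fdisjointP => i /hF; rewrite geq_max => /andP[_ h]; apply/negP => iF0.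
  by have := leq_trans (ltn_fset_max iF0) h; rewrite ltnn.
have := h0 (F0 `|` F)%fset (fsubsetUl _ _); have := h0 F0 (fsubset_refl _).
rewrite -!rmorph_sum -!rmorphB !nm_real !ler_norml => /andP[a b] /andP[].
rewrite [X in X - _](_ : _ = \sum_(i <- F0) nm (f i) + \sum_(i <- F) nm (f i)); first by lra.
rewrite (big_fsetID _ (fun i => i \in F0)) /=.
rewrite (_ : [fset x in F0 `|` F | x \in F0]%fset = F0); last first.
  by apply/fsetP => i; rewrite !inE andbC; case: (i \in F0).
rewrite (_ : [fset x in F0 `|` F | x \notin F0]%fset = F) //.
apply/fsetP => i; rewrite !inE; have := fdisjointP dis i; case: (i \in F0) => [/(_ isT) /negPf -> //|_].
by rewrite andbT.
Qed.

Lemma nm_tsum_le (f : nat -> C) (B : R) : summable f -> (forall n, \sum_(i < n) nm (f i) <= B) -> nm (tsum f) <= B.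
Proof.
move=> sf hB; apply/ler_addgt0Pr => e e0.
have [N h] := has_sum_partial (tsumP sf) e0; have := h N (leqnn _); have := hB N.
have := nm_sum (index_enum 'I_N) xpredT (fun i => f i).
by have := nm_dist_le (tsum f) (\sum_(i < N) f i); rewrite nmB; lra.
Qed.

Lemma bernoulli (x : R) n : 0 <= x -> 1 + n%:R * x <= (1 + x) ^+ n.
Proof.
move=> x0; elim: n => [|n IH]; first by rewrite mul0r addr0 expr0.
have h1 : (1 + x) * (1 + n%:R * x) <= (1 + x) ^+ n.+1 by rewrite exprS ler_wpM2l //; lra.
apply: le_trans h1; rewrite -natr1.
have : 0 <= n%:R * x * x by rewrite !mulr_ge0.
by move: (n%:R : R) => m; lra.
Qed.

Lemma expr_small (r e : R) : 0 <= r < 1 -> 0 < e -> exists N0 : nat, forall N, (N0 <= N)%N -> r ^+ N <= e.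
Proof.
move=> /andP[r0 r1] e0; have [->|rn0] := eqVneq r 0.
  by exists 1%N => N N0; rewrite expr0n; case: N N0 => //= N _; exact: ltW.
have rp : 0 < r by rewrite lt_def rn0.
pose x := r^-1 - 1; have x0 : 0 < x by rewrite subr_gt0 invf_gt1.
have [m hm] : exists m : nat, e^-1 <= m%:R * x.
  exists (Num.bound (e^-1 / x)); rewrite -ler_pdivrMr //.
  by apply/ltW/archi_boundP; rewrite divr_ge0 ?invr_ge0 // ltW.
exists m => N mN; rewrite -[r]invrK exprVn -[e]invrK lef_pV2 ?posrE ?exprn_gt0 ?invr_gt0 //.
have := bernoulli N (ltW x0); rewrite [1 + x](_ : _ = r^-1); last by rewrite /x; ring.
move=> h; apply: le_trans h.
apply: le_trans hm _; apply: le_trans (_ : N%:R * x <= _); last by lra.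
by rewrite ler_wpM2r ?ler_nat // ltW.
Qed.

Lemma geom_sum_le (r : R) n : 0 <= r < 1 -> \sum_(i < n) r ^+ i <= (1 - r)^-1.
Proof.
move=> /andP[r0 r1]; have h : (1 - r) * \sum_(i < n) r ^+ i = 1 - r ^+ n.
  by rewrite -[1 - r]opprB mulNr -subrX1 opprB.
have r1' : 0 < 1 - r by rewrite subr_gt0.
rewrite -(ler_pM2l r1') h mulfV ?gt_eqF // gerBl exprn_ge0 //.
Qed.

(** Radius of convergence at least [rho], in Abel's form: bounded terms at every smaller radius. *)
Definition conv (rho : R) c := forall r, 0 <= r -> r < rho -> exists B : R, forall i, nm (c i) * r ^+ i <= B.

Definition ev c (x : C) : C := tsum (fun i : nat => c i * x ^+ i).

Definition convol c d : nat -> C := fun n => \sum_(i < n.+1) c i * d (n - i)%N.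

Lemma conv_abs rho c r : conv rho c -> 0 <= r -> r < rho ->
  exists B : R, forall n, \sum_(i < n) nm (c i) * r ^+ i <= B.
Proof.
move=> hc r0 rr; pose r' := (r + rho) / 2.
have r'0 : 0 < r' by rewrite /r'; lra.
have [|B hB] := hc r' (ltW r'0); first by rewrite /r'; lra.
have B0 : 0 <= B by have := hB 0%N; apply: le_trans; rewrite mulr_ge0 ?nm_ge0 ?exprn_ge0 ?ltW.
pose t := r / r'; have t0 : 0 <= t by rewrite divr_ge0 // ltW.
have t1 : t < 1 by rewrite ltr_pdivrMr // mul1r /r'; lra.
exists (B * (1 - t)^-1) => n; apply: le_trans (_ : B * \sum_(i < n) t ^+ i <= _); last first.
  by rewrite ler_wpM2l // geom_sum_le // t0 t1.
rewrite mulr_sumr; apply: ler_sum => i _.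
have -> : r ^+ i = r' ^+ i * t ^+ i.
  by rewrite -exprMn /t mulrCA mulfV ?mulr1 // gt_eqF.
by rewrite mulrA ler_wpM2r ?exprn_ge0.
Qed.

Lemma conv_summable rho c x : conv rho c -> nm x < rho -> summable (fun i : nat => c i * x ^+ i).
Proof.
move=> hc hx; have [B hB] := conv_abs hc (nm_ge0 x) hx.
by apply: (@summable_nat _ B) => n; under eq_bigr do rewrite nmM nmX.
Qed.

Lemma ev_bound rho c r : conv rho c -> 0 <= r -> r < rho ->
  exists2 K : R, 0 <= K & forall x, nm x <= r -> nm (ev c x) <= K.
Proof.
move=> hc r0 hr; have [B hB] := conv_abs hc r0 hr; exists B.
  by have := hB 0%N; rewrite big_ord0.
move=> x hx; apply: nm_tsum_le => [|n]; first by apply: conv_summable hc _; exact: le_lt_trans hr.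
apply: le_trans (hB n); apply: ler_sum => i _; rewrite nmM nmX ler_wpM2l ?nm_ge0 //.
by rewrite lerXn2r ?nnegrE ?nm_ge0.
Qed.

Lemma conv_le rho rho' c : rho' <= rho -> conv rho c -> conv rho' c.
Proof. by move=> h hc r r0 hr; apply: hc => //; exact: lt_le_trans h. Qed.

Lemma convD rho c d : conv rho c -> conv rho d -> conv rho (fun i => c i + d i).
Proof.
move=> hc hd r r0 hr; have [B hB] := hc r r0 hr; have [D hD] := hd r r0 hr.
exists (B + D) => i; apply: le_trans (lerD (hB i) (hD i)).
by rewrite -mulrDl ler_wpM2r ?exprn_ge0 // nmD.
Qed.

Lemma convZ rho (a : C) c : conv rho c -> conv rho (fun i => a * c i).
Proof.
move=> hc r r0 hr; have [B hB] := hc r r0 hr.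
by exists (nm a * B) => i; rewrite nmM -mulrA ler_wpM2l ?nm_ge0.
Qed.

Lemma convB rho c d : conv rho c -> conv rho d -> conv rho (fun i => c i - d i).
Proof.
move=> hc hd; have := convD hc (convZ (-1) hd); congr conv; apply: funext => i.
by rewrite mulN1r.
Qed.

Lemma evD rho c d x : conv rho c -> conv rho d -> nm x < rho ->
  ev (fun i => c i + d i) x = ev c x + ev d x.
Proof.
move=> hc hd hx; rewrite /ev -tsumD; try exact: conv_summable hx.
by apply: eq_tsum => i; rewrite mulrDl.
Qed.

Lemma evB rho c d x : conv rho c -> conv rho d -> nm x < rho ->
  ev (fun i => c i - d i) x = ev c x - ev d x.
Proof.
move=> hc hd hx; rewrite /ev -tsumB; try exact: conv_summable hx.
by apply: eq_tsum => i; rewrite mulrBl.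
Qed.

Lemma evZ rho a c x : conv rho c -> nm x < rho -> ev (fun i => a * c i) x = a * ev c x.
Proof.
move=> hc hx; rewrite /ev -tsumZ; last exact: conv_summable hx.
by apply: eq_tsum => i; rewrite mulrA.
Qed.

Lemma conv_finite rho c N : (forall i, (N <= i)%N -> c i = 0) -> conv rho c.
Proof.
move=> h r r0 hr; exists (\sum_(i < N) nm (c i) * r ^+ i) => i.
case: (ltnP i N) => [iN|/h ->]; last first.
  by rewrite nm0 mul0r sumr_ge0 // => j _; rewrite mulr_ge0 ?nm_ge0 ?exprn_ge0.
rewrite (bigD1 (Ordinal iN)) //= lerDl sumr_ge0 // => j _.
by rewrite mulr_ge0 ?nm_ge0 ?exprn_ge0.
Qed.

Lemma ev_finite c N x : (forall i, (N <= i)%N -> c i = 0) -> ev c x = \sum_(i < N) c i * x ^+ i.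
Proof.
move=> h; rewrite /ev (@tsum_finite _ _ (iotaF N)) ?sum_iotaF // => i.
by rewrite in_iotaF -leqNgt => /h ->; rewrite mul0r.
Qed.

Definition cst (a : C) : nat -> C := fun i => if i == 0%N then a else 0.

Lemma conv_cst rho a : conv rho (cst a).
Proof. by apply: (@conv_finite _ _ 1) => -[]. Qed.

Lemma ev_cst a x : ev (cst a) x = a.
Proof. by rewrite (@ev_finite _ 1) => [|[]//]; rewrite big_ord1 /= expr0 mulr1. Qed.

Lemma conv_convol rho c d : conv rho c -> conv rho d -> conv rho (convol c d).
Proof.
move=> hc hd r r0 hr; have [B hB] := conv_abs hc r0 hr; have [D hD] := hd r r0 hr.
exists (B * D) => n; rewrite /convol.
have D0 : 0 <= D by have := hD 0%N; apply: le_trans; rewrite mulr_ge0 ?nm_ge0 ?exprn_ge0.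
apply: le_trans (_ : (\sum_(i < n.+1) nm (c i) * r ^+ i) * D <= _); last by rewrite ler_wpM2r.
apply: le_trans (ler_wpM2r (exprn_ge0 _ r0) (nm_sum _ _ _)) _.
rewrite !mulr_suml; apply: ler_sum => i _; rewrite nmM.
have -> : r ^+ n = r ^+ i * r ^+ (n - i) by rewrite -exprD subnKC // -ltnS.
by rewrite mulrACA ler_wpM2l // mulr_ge0 ?nm_ge0 ?exprn_ge0.
Qed.

(** Cauchy product: the product of the two sums is a sum over pairs, regrouped along the fibres of
    the addition of exponents. *)
Lemma ev_convol rho c d x : conv rho c -> conv rho d -> nm x < rho ->
  ev (convol c d) x = ev c x * ev d x.
Proof.
move=> hc hd hx; have sc := conv_summable hc hx; have sd := conv_summable hd hx.
rewrite /ev -(tsum_prod sc sd) (tsum_fiber (fun p : nat * nat => (p.1 + p.2)%N) (summable_prod sc sd)).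
apply: eq_tsum => n; apply/esym.
rewrite (@tsum_finite _ _ [fset (val i, (n - val i)%N) | i : 'I_n.+1]%fset); last first.
  move=> [i j] /= h; case: eqP => // ijn; case/negP: h.
  have iln : (i < n.+1)%N by rewrite -ijn ltnS leq_addr.
  by apply/imfsetP; exists (Ordinal iln) => //=; rewrite -ijn addKn.
rewrite big_imfset /=; last by move=> i j _ _ [] /val_inj.
rewrite /convol mulr_suml big_enum_cond /= ; apply: eq_bigr => i _.
have le_in : (i <= n)%N by rewrite -ltnS.
rewrite subnKC // eqxx (_ : x ^+ n = x ^+ i * x ^+ (n - i)); last by rewrite -exprD subnKC.
ring.
Qed.

Definition shift n c : nat -> C := fun i => c (n + i)%N.

Lemma conv_shift rho n c : 0 < rho -> conv rho c -> conv rho (shift n c).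
Proof.
move=> rho0 hc r r0 hr; pose r' := (r + rho) / 2.
have r'0 : 0 < r' by rewrite /r'; lra.
have [|B hB] := hc r' (ltW r'0); first by rewrite /r'; lra.
exists (B / r' ^+ n) => i; rewrite ler_pdivlMr ?exprn_gt0 //; apply: le_trans (hB (n + i)%N).
rewrite /shift -mulrA ler_wpM2l ?nm_ge0 // exprD mulrC ler_wpM2l ?exprn_ge0 ?(ltW r'0) //.
by rewrite lerXn2r ?nnegrE ?(ltW r'0) // /r'; lra.
Qed.

Lemma ev_shift rho n c x : conv rho c -> nm x < rho ->
  ev c x = \sum_(i < n) c i * x ^+ i + x ^+ n * ev (shift n c) x.
Proof.
move=> hc hx; have rho0 : 0 < rho by apply: le_lt_trans hx; exact: nm_ge0.
have sc := conv_summable hc hx.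
pose lo i := if (i < n)%N then c i * x ^+ i else 0.
pose hi i := if (i < n)%N then 0 else c i * x ^+ i.
have slo : summable lo.
  by apply: summable_le sc => i; rewrite /lo; case: ifP; rewrite ?nm0 ?nm_ge0.
have shi : summable hi.
  by apply: summable_le sc => i; rewrite /hi; case: ifP; rewrite ?nm0 ?nm_ge0.
have -> : ev c x = tsum lo + tsum hi.
  rewrite -tsumD //; apply: eq_tsum => i; rewrite /lo /hi; case: ifP; by rewrite ?addr0 ?add0r.
congr (_ + _).
  rewrite (@tsum_finite _ _ (iotaF n)) => [|i]; last by rewrite in_iotaF /lo => /negPf ->.
  by rewrite sum_iotaF; apply: eq_bigr => i _; rewrite /lo ltn_ord.
rewrite /ev -tsumZ; last exact: conv_summable (conv_shift n rho0 hc) hx.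
rewrite -(@tsum_reindex_inj _ _ _ (fun i => (n + i)%N) hi) //; last 2 first.
- by move=> i j /addnI.
- by move=> j; rewrite /hi; case: (ltnP j n) => [|h _]; rewrite ?eqxx //; exists (j - n)%N; rewrite subnKC.
apply: eq_tsum => i /=; rewrite /hi /shift ltnNge leq_addr /= exprD; ring.
Qed.

Lemma ev_at0 c : ev c 0 = c 0%N.
Proof.
rewrite /ev (@tsum_finite _ _ (iotaF 1)).
  by rewrite sum_iotaF big_ord1 expr0 mulr1.
by case=> [|i]; rewrite in_iotaF // expr0n mulr0.
Qed.

(** Identity theorem at 0. Once the lower coefficients vanish, a zero x satisfies c n = - x * ev
    (shift n.+1 c) x, which is O(|x|), and x may be taken arbitrarily small. *)
Lemma ev_eq0 rho c : 0 < rho -> conv rho c ->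
  (forall e, 0 < e -> exists x, [/\ x != 0, nm x <= e & ev c x = 0]) -> forall n, c n = 0.
Proof.
move=> rho0 hc h n; elim/ltn_ind: n => n IH.
apply: nm_small0 => e e0.
have [K K0 hK] : exists2 K : R, 0 <= K & forall x, nm x <= rho / 2 -> nm (ev (shift n.+1 c) x) <= K.
  by apply: ev_bound (conv_shift _ rho0 hc) _ _; lra.
have m0 : 0 < Num.min (rho / 2) (e / (K + 1)).
  by rewrite lt_min divr_gt0 //= divr_gt0 // ltr_wpDl.
have [x [x0 + ex]] := h _ m0; rewrite le_min => /andP[x1 x2].
have hx : nm x < rho by lra.
move: ex; rewrite (ev_shift n.+1 hc hx) big_ord_recr /= big1 ?add0r; last first.
  by move=> i _; rewrite IH ?mul0r.
rewrite exprSr => ex.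
have -> : c n = - (x * ev (shift n.+1 c) x).
  apply/eqP; rewrite -addr_eq0 -(mulrI_eq0 _ (mulfI (expf_neq0 n x0))); apply/eqP.
  by rewrite -ex; ring.
rewrite nmN nmM; apply: le_trans (ler_pM (nm_ge0 _) (nm_ge0 _) x2 (hK _ x1)) _.
by rewrite mulrAC ler_pdivrMr ?ltr_wpDl // ler_wpM2l ?(ltW e0) // lerDl.
Qed.

Lemma ev_inj rho c d : 0 < rho -> conv rho c -> conv rho d ->
  (forall e, 0 < e -> exists x, [/\ x != 0, nm x <= e & ev c x = ev d x]) -> c =1 d.
Proof.
move=> rho0 hc hd h n; apply/eqP; rewrite -subr_eq0; apply/eqP.
apply: (ev_eq0 rho0 (convB hc hd)) => e e0.
have m0 : 0 < Num.min (rho / 2) e by rewrite lt_min e0 divr_gt0.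
have [x [x0 + exy]] := h _ m0; rewrite le_min => /andP[x1 x2]; exists x; split => //.
by rewrite (evB hc hd) ?exy ?subrr //; lra.
Qed.

Lemma geom_conv : conv 1 (fun _ => 1).
Proof. by move=> r r0 r1; exists 1 => i; rewrite nm1 mul1r exprn_ile1 // ltW. Qed.

Lemma ev_geom x : nm x < 1 -> ev (fun _ => 1) x = (1 - x)^-1.
Proof.
move=> hx; have h := ev_shift 1 geom_conv hx.
have x1 : 1 - x != 0.
  by rewrite subr_eq0; apply/eqP => e; move: hx; rewrite -e nm1 ltxx.
apply: (mulfI x1); rewrite mulfV //.
move: h; rewrite big_ord1 expr0 mulr1 expr1 -/(shift 1 _) (_ : shift 1 _ = (fun _ => 1)) //.
by move=> h; rewrite mulrBl mul1r {1}h; ring.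
Qed.

End PowerSeries.

(** * The complex exponential and its lower bounds near integers *)

Section ComplexExp.
Variable R : realType.
Local Notation C := R[i].

Definition expc (n : nat) : C := (n`!%:R)^-1.
Definition cexp (z : C) : C := ev expc z.

Lemma conv_expc rho : conv rho expc.
Proof.
move=> r r0 _; exists (expR r) => n; rewrite /expc nmV nm_nat mulrC.
case: n => [|n]; first by rewrite expr0 divr1 -(expR0 R) ler_expR.
by apply: le_trans (expR_ge1Dxn n r0); rewrite lerDr.
Qed.

Lemma summable_cexp (z : C) : summable (fun n : nat => expc n * z ^+ n).
Proof. by apply: (@conv_summable _ (nm z + 1)); [exact: conv_expc|rewrite ltrDl]. Qed.

(** The exponents are moved into the coefficients: the series with coefficients u^n/n! is evaluated
    at 1, and the Cauchy product is then the binomial theorem. *)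
Lemma cexpD z w : cexp (z + w) = cexp z * cexp w.
Proof.
have cv u : conv 2 (fun n => expc n * u ^+ n).
  move=> r r0 r2; have [B hB] := @conv_expc (nm u * 2 + 1) (nm u * r) (mulr_ge0 (nm_ge0 _) r0)
     (le_lt_trans (ler_wpM2l (nm_ge0 u) (ltW r2)) (ltr_pwDr ltr01 (lexx _))).
  by exists B => i; have := hB i; rewrite nmM nmX exprMn mulrA.
have e1 u : cexp u = ev (fun n => expc n * u ^+ n) 1.
  by apply: eq_tsum => i; rewrite expr1n mulr1.
rewrite !e1 -(ev_convol (cv z) (cv w)) ?nm1; last by lra.
congr ev; apply: funext => n; rewrite /convol addrC exprDn mulr_sumr.
apply: eq_bigr => i _; have le_in : (i <= n)%N by rewrite -ltnS.
rewrite -mulr_natr /expc -(bin_fact le_in) !natrM.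
have f0 m : (m`!%:R : C) != 0 by rewrite pnatr_eq0 -lt0n fact_gt0.
have b0 : ('C(n, i)%:R : C) != 0 by rewrite pnatr_eq0 -lt0n bin_gt0.
by field; rewrite !f0 b0.
Qed.

Lemma cexp0 : cexp 0 = 1.
Proof. by rewrite /cexp ev_at0 /expc fact0 invr1. Qed.

Lemma cexp_neq0 z : cexp z != 0.
Proof.
apply/eqP => h; have := cexpD z (- z); rewrite subrr cexp0 h mul0r => /eqP.
by rewrite oner_eq0.
Qed.

Lemma cexpN z : cexp (- z) = (cexp z)^-1.
Proof. by apply: (mulfI (cexp_neq0 z)); rewrite -cexpD subrr cexp0 mulfV // cexp_neq0. Qed.

Lemma cexpMn z n : cexp (z *+ n) = cexp z ^+ n.
Proof. by elim: n => [|n IH]; rewrite ?cexp0 // mulrS cexpD IH exprS. Qed.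

Lemma tsum_series (a : nat -> R) (l : R) : summable (fun n => (a n)%:C) -> (series a @ \oo --> l)%classic ->
  tsum (fun n => (a n)%:C) = l%:C.
Proof.
move=> sa h; apply: tsum_partial => // e e0.
move: h => /cvgrPdist_le /(_ e e0) [N _ hN].
exists N => n /hN /=; rewrite -rmorph_sum -rmorphB nm_real distrC /series /=.
by rewrite big_mkord.
Qed.

Lemma cexp_real x : cexp x%:C = (expR x)%:C.
Proof.
rewrite -(@tsum_series (exp_coeff x) (expR x)).
- by apply: eq_tsum => n; rewrite /exp_coeff /expc -rmorphXn -(rmorph_nat (real_complex R)) -fmorphV -rmorphM mulrC.
- apply: summable_le (summable_cexp x%:C) => n.
  by rewrite /exp_coeff /expc -rmorphXn -(rmorph_nat (real_complex R)) -fmorphV -rmorphM mulrC.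
- exact: is_cvg_series_exp_coeff.
Qed.

Lemma ReI (a b : R) : complex.Re (a%:C + 'i * b%:C) = a.
Proof. rewrite /=; ring. Qed.
Lemma ImI (a b : R) : complex.Im (a%:C + 'i * b%:C) = b.
Proof. rewrite /=; ring. Qed.

Lemma cexp_imag (y : R) : cexp ('i * y%:C) = cos y +i* sin y.
Proof.
have E n : expc n * ('i * y%:C) ^+ n = (cos_coeff y n)%:C + 'i * (sin_coeff y n)%:C.
  rewrite exprMn -rmorphXn /= /expc /cos_coeff /sin_coeff /=.
  have -> : 'i ^+ n = (((~~ odd n)%:R * (-1) ^+ n./2)%:C + 'i * ((odd n)%:R * (-1) ^+ n.-1./2)%:C) :> C.
    have sq m : 'i ^+ (m.*2) = ((-1) ^+ m)%:C :> C.
      by rewrite -mul2n exprM sqr_i rmorphXn rmorphN rmorph1.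
    rewrite -{1}(odd_double_half n); case: (boolP (odd n)) => on /=.
      rewrite add1n exprS sq !mul0r mul1r add0r.
      have -> // : n.-1./2 = n./2.
      by rewrite -{1}(odd_double_half n) on add1n /= doubleK.
    by rewrite add0n sq mul1r mul0r mulr0 addr0.
  rewrite -(rmorph_nat (real_complex R)) -fmorphV !mulrDl !mulrDr; congr (_ + _).
    by rewrite -!rmorphM; congr _%:C; rewrite -?exprnP; ring.
  by rewrite !(rmorphM (real_complex R)); ring.
have bc n : nm (cos_coeff y n)%:C <= nm (expc n * ('i * y%:C) ^+ n).
  by rewrite E nm_real; apply: le_trans (Re_le_nm _); rewrite ReI.
have bs n : nm (sin_coeff y n)%:C <= nm (expc n * ('i * y%:C) ^+ n).
  by rewrite E nm_real; apply: le_trans (Im_le_nm _); rewrite ImI.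
have sc := summable_le bc (summable_cexp _); have ss := summable_le bs (summable_cexp _).
rewrite /cexp /ev (eq_tsum E) tsumD //; last exact: summableZ.
rewrite tsumZ // (@tsum_series (cos_coeff y) (cos y)) // ?(@tsum_series (sin_coeff y) (sin y)) //.
- by apply/eqP; rewrite eq_complex ReI ImI !eqxx.
- by rewrite sin.unlock; exact: is_cvg_series_sin_coeff.
- by rewrite cos.unlock; exact: is_cvg_series_cos_coeff.
Qed.

Lemma cexpE (x y : R) : cexp (x +i* y) = (expR x * cos y) +i* (expR x * sin y).
Proof.
rewrite [x +i* y]complexE /= cexpD cexp_real cexp_imag.
by apply/eqP; rewrite eq_complex /= !mul0r subr0 addr0 !eqxx.
Qed.

Lemma nm_cexp z : nm (cexp z) = expR (complex.Re z).
Proof.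
case: z => x y; rewrite cexpE; apply/eqP; rewrite -(eqrXn2 (n := 2)) ?nm_ge0 ?expR_ge0 //.
by rewrite nm_sq /= !exprMn -mulrDr cos2Dsin2 mulr1.
Qed.

(** Locked, so that simplification treats 2 pi i as an atom. *)
Definition twopii : C := locked ((pi *+ 2)%:C * 'i).

Lemma twopiiE : twopii = (pi *+ 2)%:C * 'i. Proof. by rewrite /twopii -lock. Qed.

(** The exponential exp(2 pi i z), so that q is [ee] of the point. *)
Definition ee (z : C) : C := cexp (twopii * z).

Lemma eeD z w : ee (z + w) = ee z * ee w. Proof. by rewrite /ee mulrDr cexpD. Qed.
Lemma ee0 : ee 0 = 1. Proof. by rewrite /ee mulr0 cexp0. Qed.
Lemma eeN z : ee (- z) = (ee z)^-1. Proof. by rewrite /ee mulrN cexpN. Qed.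
Lemma ee_neq0 z : ee z != 0. Proof. exact: cexp_neq0. Qed.
Lemma eeMn z n : ee (z *+ n) = ee z ^+ n. Proof. by rewrite /ee mulrnAr cexpMn. Qed.
Lemma ee1 : ee 1 = 1.
Proof. by rewrite /ee mulr1 twopiiE mulrC cexp_imag cos2pi sin2pi. Qed.
Lemma ee_nat n : ee n%:R = 1. Proof. by rewrite eeMn ee1 expr1n. Qed.
Lemma ee_int (m : int) : ee m%:~R = 1.
Proof. by case: m => n; rewrite ?NegzE ?mulrNz ?eeN -pmulrn ee_nat ?invr1. Qed.
Lemma eeDint z (m : int) : ee (z + m%:~R) = ee z. Proof. by rewrite eeD ee_int mulr1. Qed.

Lemma nm_ee z : nm (ee z) = expR (- (pi *+ 2 * complex.Im z)).
Proof.
rewrite /ee nm_cexp; congr expR; case: z => x y.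
by rewrite twopiiE /= !mul0r !mulr0 !mulr1 !subr0 mul0r sub0r ?addr0 ?add0r.
Qed.

Lemma nm_ee_lt1 z : 0 < complex.Im z -> nm (ee z) < 1.
Proof. by move=> h; rewrite nm_ee -(expR0 R) ltr_expR oppr_lt0 mulr_gt0 // pmulrn_lgt0 ?pi_gt0. Qed.

Lemma twopii_neq0 : twopii != 0.
Proof.
rewrite -nm_gt0 twopiiE nmM nm_real [nm 'i](_ : _ = 1); last by rewrite /nm /= expr0n expr1n add0r sqrtr1.
by rewrite mulr1 normr_gt0 mulrn_eq0 /= gt_eqF // pi_gt0.
Qed.

Lemma ee_approx : exists2 K : R, 0 < K & forall z, nm z <= 1 -> nm (ee z - 1 - twopii * z) <= K * nm z ^+ 2.
Proof.
pose M := nm twopii; have M0 : 0 <= M := nm_ge0 _.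
have lM : M < M + 1 by rewrite ltrDl.
have [K K0 hK] := ev_bound (conv_shift 2 (le_lt_trans M0 lM) (@conv_expc (M + 1))) M0 lM.
exists (M ^+ 2 * K + 1); first by rewrite ltr_wpDl // mulr_ge0 // exprn_ge0.
move=> z z1; rewrite /ee /cexp.
have nt : nm (twopii * z) <= M by rewrite nmM ler_piMr.
rewrite (@ev_shift _ (M + 1) 2); [|exact: conv_expc|by apply: le_lt_trans nt _; rewrite ltrDl].
rewrite !big_ord_recr big_ord0 /= expr0 expr1 /expc fact0 factS fact0 muln1 invr1 !mul1r add0r.
rewrite (_ : 1 + twopii * z + ?[a] - 1 - twopii * z = ?a); last by ring.
rewrite nmM nmX; apply: le_trans (ler_wpM2l (exprn_ge0 2 (nm_ge0 _)) (hK _ nt)) _.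
by rewrite nmM exprMn mulrDl mul1r mulrAC lerDl exprn_ge0 ?nm_ge0.
Qed.

Lemma sin_le x : 0 <= x -> sin x <= x :> R.
Proof.
rewrite le_eqVlt => /orP[/eqP <-|x0]; first by rewrite sin0.
have [c _] := @MVT R sin cos 0 x x0 (fun x _ => is_derive_sin x)
   (continuous_subspaceT (@continuous_sin R)).
by rewrite sin0 !subr0 => ->; rewrite ler_piMl ?cos_le1 // ltW.
Qed.

(** With s = sin(pi/6), the triple angle formula reads 3 s - 4 s^3 = 1, that is (s + 1)(2 s - 1)^2 =
    0. So s = 1/2, and sin t <= t gives the bound. *)
Lemma pi_ge3 : 3 <= pi :> R.
Proof.
pose t : R := pi / 6; have p0 := @pi_gt0 R.
have t0 : 0 < t by rewrite divr_gt0.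
have s1 : sin (t *+ 3) = 1 by rewrite -(@sin_pihalf R); congr sin; rewrite /t; field.
have s0 : 0 < sin t by apply: sin_gt0_pihalf; rewrite /t; lra.
have e3 : 3 * sin t - 4 * sin t ^+ 3 = 1.
  rewrite -[RHS]s1 mulrS sinD sin_mulr2n cos_mulr2n; have := cos2Dsin2 t.
  move: (cos t) (sin t) => c s h.
  have -> : s * (c ^+ 2 *+ 2 - 1) + c * ((c * s) *+ 2) = s * (4 * c ^+ 2 - 1) by ring.
  have -> : c ^+ 2 = 1 - s ^+ 2 by rewrite -h; ring.
  ring.
have : (sin t + 1) * (2 * sin t - 1) ^+ 2 = 0.
  have -> : (sin t + 1) * (2 * sin t - 1) ^+ 2 = 1 - (3 * sin t - 4 * sin t ^+ 3) by move: (sin t) => s; ring.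
  by rewrite e3 subrr.
move/eqP; rewrite mulf_eq0 gt_eqF ?ltr_wpDl ?(ltW s0) //= expf_eq0 /= subr_eq0 => /eqP s2.
have := sin_le (ltW t0); rewrite /t; move: s2; rewrite /t; lra.
Qed.

(** The range 3/4 stays away from the next zero at u = 1. The mean value theorem serves up to 1/4,
    monotonicity of the sine up to 1/2, and the reflection u -> 1 - u beyond. *)
Lemma sin_lower : exists2 c : R, 0 < c & forall u : R, `|u| <= 3/4 -> c * `|u| <= `|sin (pi * u)|.
Proof.
have p0 := @pi_gt0 R.
have c1 : 0 < cos (pi / 4) :> R by apply: cos_gt0_pihalf; lra.
have s1 : 0 < sin (pi / 4) :> R by apply: sin_gt0_pihalf; lra.
pose c : R := Num.min (cos (pi / 4) * pi) (sin (pi / 4)).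
exists c; first by rewrite lt_min mulr_gt0 //= s1.
suff H u : 0 <= u -> u <= 3/4 -> c * u <= sin (pi * u).
  move=> u; case: (lerP 0 u) => [u0|/ltW u0] hu.
    rewrite ger0_norm //; apply: le_trans (H _ u0 _) (ler_norm _); by rewrite -(ger0_norm u0).
  rewrite ler0_norm // -normrN -sinN -mulrN; apply: le_trans (H (- u) _ _) (ler_norm _).
    by rewrite oppr_ge0.
  by rewrite -(ler0_norm u0).
move=> u0 u1; case: (lerP u (1/4)) => [u4|/ltW u4].
  move: u0; rewrite le_eqVlt => /orP[/eqP <-|u0]; first by rewrite !mulr0 sin0.
  have pu0 : 0 < pi * u by rewrite mulr_gt0.
  have [d] := @MVT R sin cos 0 (pi * u) pu0 (fun x _ => is_derive_sin x)
     (continuous_subspaceT (@continuous_sin R)).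
  rewrite in_itv /= => /andP[d0 d1].
  rewrite sin0 !subr0 => ->; rewrite mulrA ler_wpM2r ?(ltW u0) //.
  apply: le_trans (_ : cos (pi / 4) * pi <= _); first by rewrite ge_min lexx.
  rewrite ler_wpM2r ?(ltW p0) //.
  have d2 : d <= pi / 4.
    by apply: le_trans (ltW d1) _; rewrite ler_pM2l //; move: u4; lra.
  move: d2; rewrite le_eqVlt => /orP[/eqP -> //|d2].
  rewrite ltW // ltr_cos ?in_itv /= ?d2 //; apply/andP; split; move: d0; rewrite ?bnd_simp; lra.
apply: le_trans (_ : sin (pi / 4) <= _).
  apply: le_trans (_ : sin (pi / 4) * u <= _); first by rewrite ler_wpM2r // ge_min lexx orbT.
  by rewrite ler_piMr ?ltW //; lra.
have mono t : pi / 4 <= t -> t <= pi / 2 -> sin (pi / 4) <= sin t :> R.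
  rewrite le_eqVlt => /orP[/eqP <- //|t1 t2].
  by rewrite ltW // ltr_sin ?in_itv //=; apply/andP; split; lra.
case: (lerP u (1/2)) => [u2|/ltW u2].
  apply: mono; first by rewrite ler_pM2l //; move: u4; lra.
  by rewrite ler_pM2l //; move: u2; lra.
have -> : pi * u = pi - pi * (1 - u) by ring.
rewrite sinB sinpi cospi mul0r sub0r mulN1r opprK; apply: mono.
  by rewrite ler_pM2l //; move: u1; lra.
by rewrite ler_pM2l //; move: u2; lra.
Qed.

Lemma nm_sub1_sq (x y : R) : nm (ee (x +i* y) - 1) ^+ 2 =
  (expR (- (pi *+ 2 * y)) - 1) ^+ 2 + 4 * expR (- (pi *+ 2 * y)) * sin (pi * x) ^+ 2.
Proof.
rewrite /ee (_ : twopii * (x +i* y) = (- (pi *+ 2 * y)) +i* ((pi * x) *+ 2)); last first.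
  by rewrite twopiiE; apply/eqP; rewrite eq_complex /=; apply/andP; split; apply/eqP; ring.
rewrite cexpE nm_sq /= subr0 cos_mulr2n sin_mulr2n.
have := cos2Dsin2 (pi * x); move: (expR _) (cos _) (sin _) => E c s h.
have -> : c ^+ 2 = 1 - s ^+ 2 by rewrite -h; ring.
have -> : (E * ((c * s) *+ 2)) ^+ 2 = 4 * E ^+ 2 * (1 - s ^+ 2) * s ^+ 2.
  by rewrite (_ : 1 - s ^+ 2 = c ^+ 2); [ring|rewrite -h; ring].
ring.
Qed.

(** By [nm_sub1_sq] the square of the modulus splits into a radial part, which controls Im z, and a
    multiple of sin^2(pi Re z), which controls Re z. This is the uniform bound that makes dominated
    convergence work in [cK_diff]. *)
Lemma ee_lower : exists2 c : R, 0 < c & forall z, `|complex.Re z| <= 3/4 -> `|complex.Im z| <= 1 ->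
  c * nm z <= nm (ee z - 1).
Proof.
have [c c0 hc] := sin_lower.
have p0 := @pi_gt0 R.
pose m : R := Num.min (expR (- (pi *+ 2))) (Num.min (c ^+ 2 * expR (- (pi *+ 2))) 1).
have m0 : 0 < m by rewrite !lt_min expR_gt0 ltr01 mulr_gt0 ?expR_gt0 ?exprn_gt0.
have m1 : m <= 1 by rewrite !ge_min lexx !orbT.
exists m => // -[x y] hx hy.
rewrite -ler_sqr ?nnegrE ?nm_ge0 ?mulr_ge0 ?nm_ge0 ?(ltW m0) // exprMn nm_sub1_sq nm_sq.
rewrite ![complex.Re _]/= ![complex.Im _]/= in hx hy *.
have p2 : 0 <= pi *+ 2 :> R by rewrite mulrn_wge0 // ltW.
set t := pi *+ 2 * y.
have tb : `|t| <= pi *+ 2.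
  by rewrite /t normrM (ger0_norm p2) ler_piMr.
have Eb : expR (- (pi *+ 2)) <= expR (- t) by rewrite ler_expR lerN2; apply: le_trans tb; exact: ler_norm.
have E0 := expR_gt0 (- t).
(* (expR(-t) - 1)^2 >= m^2 y^2 *)
have h1 : m ^+ 2 * y ^+ 2 <= (expR (- t) - 1) ^+ 2.
  have ty : `|y| <= `|t|.
    rewrite /t normrM (ger0_norm p2) ler_peMl //.
    have := pi_ge3; lra.
  have : m * `|y| <= `|expR (- t) - 1|.
    apply: le_trans (ler_wpM2l (ltW m0) ty) _.
    case: (lerP t 0) => t0.
      rewrite ler0_norm //; have := expR_ge1Dx (- t) => h.
      apply: le_trans (ler_norm _); apply: le_trans (_ : - t <= _); last by lra.
      by rewrite ler_piMl // oppr_ge0.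
    rewrite gtr0_norm // -normrN opprB; apply: le_trans (ler_norm _).
    have h := expR_ge1Dx t.
    have e1 : expR (- t) * expR t = 1 by rewrite -expRD addrC subrr expR0.
    apply: le_trans (_ : expR (- t) * t <= _); last first.
      have -> : 1 - expR (- t) = expR (- t) * (expR t - 1) by rewrite mulrBr e1 mulr1.
      by rewrite ler_wpM2l ?(ltW E0) //; lra.
    rewrite ler_wpM2r ?(ltW t0) //; apply: le_trans Eb; by rewrite ge_min lexx.
  rewrite -ler_sqr ?nnegrE ?mulr_ge0 ?normr_ge0 ?(ltW m0) // exprMn !real_normK ?num_real //.
have h2 : m ^+ 2 * x ^+ 2 <= 4 * expR (- t) * sin (pi * x) ^+ 2.
  apply: le_trans (_ : m * x ^+ 2 <= _).
    by rewrite ler_wpM2r ?sqr_ge0 // expr2 ler_piMl // ltW.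
  apply: le_trans (_ : (c ^+ 2 * expR (- (pi *+ 2))) * x ^+ 2 <= _).
    by rewrite ler_wpM2r ?sqr_ge0 // !ge_min lexx orbT.
  have hs : c ^+ 2 * x ^+ 2 <= sin (pi * x) ^+ 2.
    have := hc x hx; rewrite -ler_sqr ?nnegrE ?mulr_ge0 ?normr_ge0 ?(ltW c0) //.
    by rewrite exprMn !real_normK ?num_real.
  have e0 := expR_ge0 (- (pi *+ 2) : R).
  apply: le_trans (_ : expR (- t) * sin (pi * x) ^+ 2 <= _).
    rewrite [leLHS](_ : _ = expR (- (pi *+ 2)) * (c ^+ 2 * x ^+ 2)); last by ring.
    apply: ler_pM => //; by rewrite mulr_ge0 ?sqr_ge0.
  rewrite -mulrA; apply: ler_peMl; last by lra.
  by rewrite mulr_ge0 ?sqr_ge0 ?(ltW E0).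
by rewrite mulrDr addrC lerD.
Qed.

Lemma ee_eq1 z : `|complex.Re z| <= 3/4 -> `|complex.Im z| <= 1 -> ee z = 1 -> z = 0.
Proof.
have [c c0 hc] := ee_lower; move=> h1 h2 h; have := hc z h1 h2; rewrite h subrr nm0.
by rewrite pmulr_rle0 // => h3; apply/eqP; rewrite -nm_eq0 eq_le h3 nm_ge0.
Qed.

End ComplexExp.

(** * Limits of sequences and sums over the integers *)

Section Limits.
Variable R : realType.
Local Notation C := R[i].

Definition cvgs (u : nat -> C) (l : C) := forall e : R, 0 < e -> exists N0 : nat,
  forall N, (N0 <= N)%N -> nm (u N - l) <= e.

Lemma cvgs_cst l : cvgs (fun _ => l) l.
Proof. by move=> e e0; exists 0%N => N _; rewrite subrr nm0 ltW. Qed.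

Lemma cvgsM u v l m : cvgs u l -> cvgs v m -> cvgs (fun n => u n * v n) (l * m).
Proof.
move=> hu hv e e0.
pose d := Num.min 1 (e / (nm l + nm m + 1)).
have den : 0 < nm l + nm m + 1 by rewrite ltr_wpDl ?addr_ge0 ?nm_ge0.
have d0 : 0 < d by rewrite lt_min ltr01 divr_gt0.
have [N1 h1] := hu d d0; have [N2 h2] := hv d d0.
exists (maxn N1 N2) => N; rewrite geq_max => /andP[/h1 a /h2 b].
have -> : u N * v N - l * m = (u N - l) * (v N - m) + l * (v N - m) + (u N - l) * m by ring.
apply: le_trans (nmD _ _) _; apply: le_trans (lerD (nmD _ _) (lexx _)) _; rewrite !nmM.
have l0 := nm_ge0 l; have m0 := nm_ge0 m.
have h3 : nm (u N - l) * nm (v N - m) <= d.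
  apply: le_trans (ler_pM (nm_ge0 _) (nm_ge0 _) a b) _.
  by rewrite ler_piMl ?(ltW d0) // /d ge_min lexx.
have h4 : nm l * nm (v N - m) <= nm l * d by rewrite ler_wpM2l.
have h5 : nm (u N - l) * nm m <= d * nm m by rewrite ler_wpM2r.
have h6 : d * (nm l + nm m + 1) <= e by rewrite -ler_pdivlMr // /d ge_min lexx orbT.
apply: le_trans h6; rewrite mulrDr mulrDr mulr1 (mulrC d (nm l)); lra.
Qed.

Lemma cvgsV u l : l != 0 -> cvgs u l -> cvgs (fun n => (u n)^-1) (l^-1).
Proof.
move=> l0 hu e e0; have nl : 0 < nm l by rewrite nm_gt0.
pose d := Num.min (nm l / 2) (e * nm l ^+ 2 / 2).
have d0 : 0 < d by rewrite lt_min !divr_gt0 ?mulr_gt0 ?exprn_gt0.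
have [N1 h1] := hu d d0; exists N1 => N /h1 a.
have a1 : nm (u N - l) <= nm l / 2 by apply: le_trans a _; rewrite /d ge_min lexx.
have a2 : nm (u N - l) <= e * nm l ^+ 2 / 2 by apply: le_trans a _; rewrite /d ge_min lexx orbT.
have un : nm l / 2 <= nm (u N) by have := nm_dist_le l (u N); rewrite nmB; lra.
have un0 : 0 < nm (u N) by lra.
have u0 : u N != 0 by rewrite -nm_gt0.
have -> : (u N)^-1 - l^-1 = (l - u N) / (u N * l) by field; rewrite u0 l0.
rewrite nmM nmV nmM nmB ler_pdivrMr ?mulr_gt0 //; apply: le_trans a2 _.
have -> : e * nm l ^+ 2 / 2 = e * (nm l / 2 * nm l) by ring.
by rewrite ler_wpM2l ?(ltW e0) // ler_wpM2r // ltW.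
Qed.

Lemma cvgsD u v l m : cvgs u l -> cvgs v m -> cvgs (fun n => u n + v n) (l + m).
Proof.
move=> hu hv e e0; have e2 : 0 < e / 2 by lra.
have [N1 h1] := hu _ e2; have [N2 h2] := hv _ e2.
exists (maxn N1 N2) => N; rewrite geq_max => /andP[/h1 a /h2 b].
rewrite (_ : _ - _ = (u N - l) + (v N - m)); last by ring.
by apply: le_trans (nmD _ _) _; lra.
Qed.

Lemma cvgs_uniq u l m : cvgs u l -> cvgs u m -> l = m.
Proof.
move=> hu hv; apply/eqP; rewrite -subr_eq0; apply/eqP; apply: nm_small0 => e e0.
have e2 : 0 < e / 2 by lra.
have [N1 h1] := hu _ e2; have [N2 h2] := hv _ e2.
have := h1 _ (leq_maxl N1 N2); have := h2 _ (leq_maxr N1 N2).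
by have := nm_distD (u (maxn N1 N2)) l m; rewrite (nmB l (u _)); lra.
Qed.

Lemma inv_nat_small (A e : R) : 0 < e -> exists N0 : nat, forall N, (N0 <= N)%N -> A / N.+1%:R <= e.
Proof.
move=> e0; exists (Num.bound (`|A| / e)) => N hN.
rewrite ler_pdivrMr ?ltr0n // mulrC -ler_pdivrMr //.
apply: le_trans (_ : `|A| / e <= _); first by rewrite ler_wpM2r ?invr_ge0 ?(ltW e0) // ler_norm.
apply: le_trans (ltW (archi_boundP _)) _; first by rewrite divr_ge0 // ltW.
by rewrite ler_nat (leq_trans hN).
Qed.

End Limits.

Section IntSums.
Variable R : realType.
Local Notation C := R[i].

Lemma summable_int (f : int -> C) : summable (f \o Posz) -> summable (f \o Negz) -> summable f.
Proof.
move=> hp hn; rewrite (_ : f = fun j => (if j is Posz _ then f j else 0) + (if j is Negz _ then f j else 0)); last first.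
  by apply: funext => -[j|j]; rewrite ?addr0 ?add0r.
apply: summableD.
  apply: (@summable_inj _ _ _ Posz) => //; first by move=> a b [].
  by move=> [j|j]; [exists j|rewrite eqxx].
apply: (@summable_inj _ _ _ Negz) => //; first by move=> a b [].
by move=> [j|j]; [rewrite eqxx|exists j].
Qed.

Lemma tsum_int (f : int -> C) : summable f -> tsum f = tsum (f \o Posz) + tsum (f \o Negz).
Proof.
move=> sf; pose p j := if j is Posz _ then f j else 0; pose n j := if j is Negz _ then f j else 0.
have sp : summable p by apply: summable_le sf => -[j|j] ; rewrite /p ?nm0 ?nm_ge0.
have sn : summable n by apply: summable_le sf => -[j|j] ; rewrite /n ?nm0 ?nm_ge0.
rewrite (_ : f = fun j => p j + n j); last by apply: funext => -[j|j] ; rewrite /p /n ?addr0 ?add0r.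
rewrite tsumD // -(@tsum_reindex_inj _ _ _ Posz p) -?(@tsum_reindex_inj _ _ _ Negz n) //.
- by congr (_ + _); apply: eq_tsum => j /=; rewrite ?addr0 ?add0r.
- by move=> a b [].
- by move=> [j|j] /=; [rewrite eqxx|exists j].
- by move=> a b [].
- by move=> [j|j] /=; [exists j|rewrite eqxx].
Qed.

Lemma inv_sq_sum n : \sum_(i < n.+1) (1 + i%:R : R) ^- 2 <= 2 - (1 + n%:R)^-1.
Proof.
elim: n => [|n IH]; first by rewrite big_ord1 addr0 expr1n invr1; lra.
rewrite big_ord_recr /=; apply: le_trans (lerD IH (lexx _)) _.
rewrite -!natr1; move: (n%:R : R) (ler0n R n) => x x0.
have y1 : 1 + x != 0 by rewrite gt_eqF; lra.
have y2 : 1 + (x + 1) != 0 by rewrite gt_eqF; lra.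
rewrite -subr_ge0 (_ : _ - _ = (1 + x)^-1 * (1 + (x + 1)) ^- 2).
  by rewrite mulr_ge0 ?invr_ge0 ?exprn_ge0 //; lra.
by field; rewrite y1 y2.
Qed.

Definition w2 (j : int) : C := ((1 + `|j|%:~R : R) ^- 2)%:C.

Lemma nm_w2 j : nm (w2 j) = (1 + `|j|%:~R) ^- 2.
Proof. by rewrite nm_real ger0_norm // invr_ge0 exprn_ge0 // addr_ge0 // ler0z. Qed.

Lemma summable_w2 : summable w2.
Proof.
have H : summable (fun n : nat => ((1 + n%:R : R) ^- 2)%:C).
  apply: (@summable_nat _ _ 2) => -[|n]; first by rewrite big_ord0.
  under eq_bigr do rewrite nm_real ger0_norm ?invr_ge0 ?exprn_ge0 ?addr_ge0 ?ler0n //.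
  apply: le_trans (inv_sq_sum n) _; have : 0 <= (1 + n%:R : R)^-1 by rewrite invr_ge0 addr_ge0.
  lra.
apply: summable_int; first exact: H.
apply: summable_le H => n; rewrite -[(w2 \o Negz) n]/(w2 (Negz n)) nm_w2 nm_real.
rewrite (@ger0_norm _ ((1 + n%:R) ^- 2)) ?invr_ge0 ?exprn_ge0 ?addr_ge0 ?ler0n //.
rewrite lef_pV2 ?posrE ?exprn_gt0 ?ltr_wpDr ?ler0n // ?ler0z //.
rewrite lerXn2r ?nnegrE ?addr_ge0 ?ler0n ?ler0z // lerD2l.
by rewrite NegzE normrN /= -pmulrn ler_nat.
Qed.

Lemma pos_lower (f : int -> R) (s : seq int) : (forall j, 0 < f j) ->
  exists2 c : R, 0 < c & forall j, j \in s -> c <= f j.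
Proof.
move=> f0; elim: s => [|a s [c c0 hc]]; first by exists 1.
exists (Num.min c (f a)); first by rewrite lt_min c0 f0.
move=> j; rewrite inE => /orP[/eqP ->|/hc]; first by rewrite ge_min lexx orbT.
by rewrite ge_min => ->.
Qed.

(** Beyond a finite range the linear growth suffices; on the finite range the positive function has
    a positive minimum. *)
Lemma lin_lower (f : int -> R) (M : R) : (forall j, 0 < f j) -> (forall j, `|j|%:~R - M <= f j) ->
  exists2 c : R, 0 < c & forall j, c * (1 + `|j|%:~R) <= f j.
Proof.
move=> f0 fM; have [n hn] : exists n : nat, 2 * `|M| + 1 < n%:R.
  by exists (Num.bound (2 * `|M| + 1 : R)); apply: archi_boundP; rewrite addr_ge0 // mulr_ge0.
have [c c0 hc] := pos_lower (map (fun i : nat => i%:Z - n%:Z) (iota 0 (n.*2.+1))) f0.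
have n0 : 0 < 1 + n%:R :> R by rewrite ltr_wpDr.
exists (Num.min (1/4) (c / (1 + n%:R))); first by rewrite lt_min divr_gt0 ?divr_gt0.
move=> j; case: (lerP `|j|%:~R (n%:R : R)) => hj.
  apply: le_trans (_ : c / (1 + n%:R) * (1 + n%:R) <= _).
    apply: ler_pM; rewrite ?ge_min ?lexx ?orbT //; last by rewrite lerD2l.
      by rewrite le_min !divr_ge0 // ltW.
  rewrite divfK ?gt_eqF //; apply: hc; apply/mapP; exists (absz (j + n%:Z)).
    rewrite mem_iota /=; move: hj; rewrite -[n%:R]/(n%:~R) ler_int; lia.
  by move: hj; rewrite -[n%:R]/(n%:~R) ler_int; lia.
apply: le_trans (fM j); apply: le_trans (_ : 1/4 * (1 + `|j|%:~R) <= _).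
  by rewrite ler_wpM2r ?addr_ge0 ?ler0z // ge_min lexx.
have := ler_norm M; have := normr_ge0 M; lra.
Qed.

End IntSums.

(** * Partial fractions of the cotangent *)

Section FieldIdentities.
Variable F : fieldType.

Lemma scale_frac (o t x y d : F) : y = x * d -> x - 1 != 0 -> y - 1 != 0 -> o != 0 ->
  o^-1 * (t / (x - 1)) - o^-1 * (t / (y - 1)) =
  t * x * (o * (d - 1)) * ((o * (x - 1))^-1 * (o * (y - 1))^-1).
Proof.
move=> -> a0 b0 o0; have -> : x * d - 1 = x * (d - 1) + (x - 1) by ring.
have b1 : x * (d - 1) + (x - 1) != 0 by rewrite (_ : _ + _ = x * d - 1) //; ring.
by field; rewrite o0 b1 a0.
Qed.

Lemma limit_frac (t d a b : F) : t != 0 -> a != 0 -> b != 0 ->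
  d * (a^-1 * b^-1) = t * 1 * (t * d) * ((t * a)^-1 * (t * b)^-1).
Proof. by move=> t0 a0 b0; field; rewrite t0 a0 b0. Qed.

Lemma scaled_err (o x t w : F) : o != 0 -> o * (x - 1) - t * w = o * (x - 1 - t * (w / o)).
Proof. by move=> o0; field. Qed.

Lemma scaled_sq (o K w : F) : o != 0 -> o * (K * (w / o) ^+ 2) = K * w ^+ 2 / o.
Proof. by move=> o0; field. Qed.

Lemma scaled_lin (o L w : F) : o != 0 -> o * (L * (w / o)) = L * w.
Proof. by move=> o0; field. Qed.

Lemma bound_frac (m E L c a b : F) : c != 0 -> a != 0 -> b != 0 ->
  m * E * L * c ^- 2 * (a * b)^-1 = m * E * L * ((c * a)^-1 * (c * b)^-1).
Proof. by move=> c0 a0 b0; field; rewrite c0 a0 b0. Qed.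

End FieldIdentities.

Section Cotangent.
Variable R : realType.
Local Notation C := R[i].

Lemma nm_int (j : int) : nm (j%:~R : C) = `|j|%:~R.
Proof. by rewrite -(rmorph_int (real_complex R)) nm_real intr_norm. Qed.

Definition nonint (z : C) := forall j : int, z + j%:~R != 0.

Lemma Re_addint (z : C) (j : int) : complex.Re (z + j%:~R) = complex.Re z + j%:~R.
Proof. by rewrite raddfD -(rmorph_int (real_complex R)). Qed.
Lemma Im_addint (z : C) (j : int) : complex.Im (z + j%:~R) = complex.Im z.
Proof. by rewrite raddfD -(rmorph_int (real_complex R)) /= addr0. Qed.

Lemma Re_divnat (w : C) n : complex.Re (w / n%:R) = complex.Re w / n%:R.
Proof.
rewrite -(rmorph_nat (real_complex R)) -fmorphV; case: w => p q /=; ring.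
Qed.
Lemma Im_divnat (w : C) n : complex.Im (w / n%:R) = complex.Im w / n%:R.
Proof.
rewrite -(rmorph_nat (real_complex R)) -fmorphV; case: w => p q /=; ring.
Qed.

Lemma ee_eq1_int (z : C) : ee z = 1 -> exists j : int, z = j%:~R.
Proof.
move=> h; pose j := Num.floor (complex.Re z + 1/2).
have im0 : complex.Im z = 0.
  have : expR (- (pi *+ 2 * complex.Im z)) = expR 0 by rewrite -nm_ee h nm1 expR0.
  move/expR_inj/eqP; rewrite oppr_eq0 mulf_eq0 mulrn_eq0 /= gt_eqF ?pi_gt0 //=.
  by move/eqP.
exists j; apply/eqP; rewrite -subr_eq0; apply/eqP.
rewrite -mulrNz; apply: ee_eq1; last by rewrite eeDint.
  rewrite Re_addint mulrNz.
  have h1 : j%:~R <= complex.Re z + 1/2 by exact: floor_le.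
  have h2 : complex.Re z + 1/2 < (j + 1)%:~R by exact: floorD1_gt.
  move: h2; rewrite rmorphD /= => h2; rewrite ler_norml; apply/andP; split; lra.
by rewrite Im_addint im0 normr0.
Qed.

Lemma ee_neq1 z : nonint z -> ee z != 1.
Proof. by move=> h; apply/eqP => /ee_eq1_int [j zj]; have := h (- j); rewrite zj -rmorphD subrr eqxx. Qed.

Lemma nonint_lower z : nonint z -> exists2 c : R, 0 < c & forall j : int, c * (1 + `|j|%:~R) <= nm (z + j%:~R).
Proof.
move=> hz; apply: (@lin_lower R (fun j : int => nm (z + j%:~R)) (nm z)) => j.
  by rewrite nm_gt0.
have := nm_distD (- z) (j%:~R) 0; rewrite !subr0 opprK nmN nm_int [j%:~R + z]addrC; lra.
Qed.

Lemma nonint_Im z : complex.Im z != 0 -> nonint z.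
Proof.
by move=> h j; apply/eqP => /(congr1 (@complex.Im R)) /eqP; rewrite Im_addint /= (negPf h).
Qed.

Lemma summable_inv2 z z' : nonint z -> nonint z' ->
  summable (fun j : int => (z + j%:~R)^-1 * (z' + j%:~R)^-1).
Proof.
move=> hz hz'; have [c c0 hc] := nonint_lower hz; have [d d0 hd] := nonint_lower hz'.
apply: (@summable_leZ _ _ (c * d)^-1 _ (@w2 R)); last exact: summable_w2.
move=> j; rewrite nm_w2 nmM !nmV -!invfM.
have p : 0 < 1 + `|j|%:~R :> R by rewrite ltr_wpDr ?ler0z.
rewrite lef_pV2 ?posrE ?mulr_gt0 ?nm_gt0 // expr2 mulrACA.
by apply: ler_pM; rewrite ?mulr_ge0 ?(ltW c0) ?(ltW d0) ?(ltW p).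
Qed.

Lemma ee_invXn (N : nat) : (0 < N)%N -> ee (N%:R^-1 : C) ^+ N = 1.
Proof.
by move=> N0; rewrite -eeMn -[X in ee X]mulr_natr mulVf ?ee1 // pnatr_eq0 -lt0n.
Qed.

Lemma root_sum (N k : nat) : (0 < k < N)%N ->
  \sum_(j < N) (ee (N%:R^-1 : C) ^+ j) ^+ k = 0.
Proof.
move=> /andP[k0 kN]; have N0 : (0 < N)%N by exact: leq_trans kN.
pose zt : C := ee (N%:R^-1) ^+ k.
have zN : zt ^+ N = 1 by rewrite /zt exprAC ee_invXn ?expr1n.
have z1 : zt != 1.
  rewrite /zt -eeMn -[X in ee X]mulr_natl; apply/eqP => /ee_eq1_int [j].
  move=> /(congr1 (fun z => z * N%:R)); rewrite divfK ?pnatr_eq0 -?lt0n //.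
  rewrite -[k%:R]/(k%:~R) -[N%:R]/(N%:~R) -rmorphM /= => /eqP; rewrite eqr_int => /eqP.
  have nn (m : nat) : 0 <= m%:Z * N%:Z by [].
  case: j => [[|m]|m]; rewrite ?NegzE; [lia|have := nn m; nia|have := nn m; nia].
under eq_bigr do rewrite exprAC -/zt.
apply: (mulfI (_ : zt - 1 != 0)); first by rewrite subr_eq0.
by rewrite -subrX1 zN subrr mulr0.
Qed.

(** Each 1/(w - 1) with w^N = y^N is the geometric sum of the w^k for k < N, divided by y^N - 1.
    Summed over the roots of unity, only k = 0 survives ([root_sum]). *)
Lemma distribution (N : nat) (y : C) : (0 < N)%N -> y ^+ N != 1 ->
  \sum_(j < N) (ee (N%:R^-1) ^+ j * y - 1)^-1 = N%:R / (y ^+ N - 1).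
Proof.
move=> N0 yN; have yN1 : y ^+ N - 1 != 0 by rewrite subr_eq0.
have E (j : 'I_N) : (ee (N%:R^-1) ^+ j * y - 1)^-1 =
    (\sum_(k < N) (ee (N%:R^-1) ^+ j * y) ^+ k) / (y ^+ N - 1).
  have wN : (ee (N%:R^-1) ^+ j * y) ^+ N = y ^+ N.
    by rewrite exprMn exprAC ee_invXn ?expr1n ?mul1r.
  have w1 : ee (N%:R^-1) ^+ j * y - 1 != 0.
    by rewrite subr_eq0; apply: contra yN => /eqP w1; rewrite -wN w1 expr1n.
  have := subrX1 (ee (N%:R^-1) ^+ j * y) N; rewrite wN => h.
  by apply: (mulfI w1); rewrite mulfV // mulrA -h mulfV.
rewrite (eq_bigr _ (fun j _ => E j)) -mulr_suml exchange_big /=; congr (_ / _).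
under eq_bigr => k _ do (under eq_bigr do rewrite exprMn; rewrite -mulr_suml).
case: N N0 {yN yN1 E} => // N _.
rewrite big_ord_recl /= [X in _ + X]big1 ?addr0 => [|k _]; last first.
  by rewrite root_sum ?mul0r // /bump /= add1n ltnS ltn_ord.
by under eq_bigr do rewrite expr0; rewrite sumr_const card_ord expr0 mulr1.
Qed.

Lemma nm_main_bound (t x d a b : C) (E D p q : R) : nm x <= E -> nm d <= D -> 0 < p -> 0 < q ->
  p <= nm a -> q <= nm b -> nm (t * x * d * (a^-1 * b^-1)) <= nm t * E * D * (p^-1 * q^-1).
Proof.
move=> hx hd p0 q0 ha hb; rewrite !nmM !nmV.
have a0 := lt_le_trans p0 ha; have b0 := lt_le_trans q0 hb.
apply: ler_pM; rewrite ?mulr_ge0 ?invr_ge0 ?nm_ge0 //.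
  apply: ler_pM; rewrite ?mulr_ge0 ?nm_ge0 //.
  by apply: ler_pM; rewrite ?nm_ge0.
by apply: ler_pM; rewrite ?invr_ge0 ?nm_ge0 // lef_pV2.
Qed.

(** This is pi cot(pi z) - pi i; the constant disappears from all the differences in which it is
    used. *)
Definition cK (z : C) : C := @twopii R / (ee z - 1).

Definition symS (h : nat) : {fset int} := [fset (i%:Z - h%:Z) | i in iotaF (h.*2.+1)]%fset.

Lemma in_symS h j : (j \in symS h) = (`|j| <= h%:Z).
Proof.
apply/imfsetP/idP => [[i /=]|hj]; first by rewrite in_iotaF => hi ->; lia.
exists (absz (j + h%:Z)); last by lia.
by rewrite /= in_iotaF; lia.
Qed.

Lemma sum_symS h (f : int -> C) : \sum_(j <- symS h) f j = \sum_(i < h.*2.+1) f (i%:Z - h%:Z).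
Proof. by rewrite sum_imfset ?sum_iotaF // => a b; lia. Qed.

(** The distribution relation for the odd number N = 2h + 1, with residues taken in [-h, h] so that
    the index set exhausts the integers symmetrically as h grows. *)
Lemma cK_distr z h : nonint z ->
  cK z = \sum_(j <- symS h) (h.*2.+1)%:R^-1 * cK ((z + j%:~R) / (h.*2.+1)%:R).
Proof.
move=> hz; rewrite sum_symS; set N := h.*2.+1; have N0 : (N%:R : C) != 0 by rewrite pnatr_eq0.
pose y := ee ((z - h%:R) / N%:R).
have yN : y ^+ N = ee z.
  have e : (z - h%:R) / N%:R *+ N = z + (- h%:Z)%:~R by rewrite -[LHS]mulr_natr divfK // mulrNz.
  by rewrite /y -eeMn e eeDint.
have E i : ee ((z + (i%:Z - h%:Z)%:~R) / N%:R) = ee (N%:R^-1) ^+ i * y.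
  rewrite -eeMn -eeD; congr ee; rewrite rmorphB /= -!pmulrn -mulr_natl; ring.
under eq_bigr do rewrite /cK E mulrCA.
have e1 : ee z - 1 != 0 by rewrite subr_eq0 ee_neq1.
rewrite -mulr_sumr -mulr_sumr distribution // yN ?ee_neq1 // /cK.
by rewrite [N%:R^-1 * _]mulrA mulVf ?mul1r.
Qed.

Lemma ee_lin : exists2 L : R, 0 < L & forall z : C, nm z <= 1 -> nm (ee z - 1) <= L * nm z.
Proof.
have [K K0 hK] := ee_approx R; exists (nm (@twopii R) + K); first by rewrite ltr_wpDl ?nm_ge0.
move=> z z1; have := hK z z1 => h.
rewrite (_ : ee z - 1 = (ee z - 1 - twopii R * z) + twopii R * z); last by ring.
apply: le_trans (nmD _ _) _; rewrite nmM mulrDl addrC lerD2l; apply: le_trans h _.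
by rewrite ler_wpM2l ?(ltW K0) // expr2 ler_piMl ?nm_ge0.
Qed.

Definition oddR (h : nat) : C := locked (h.*2.+1)%:R.

Lemma oddRE h : oddR h = (h.*2.+1)%:R. Proof. by rewrite /oddR -lock. Qed.

Lemma oddR_neq0 h : oddR h != 0. Proof. by rewrite oddRE pnatr_eq0. Qed.
Lemma nm_oddR h : nm (oddR h) = (h.*2.+1)%:R. Proof. by rewrite oddRE nm_nat. Qed.

Lemma odd_small (A e : R) : 0 < e -> exists N0 : nat, forall h, (N0 <= h)%N -> A / (h.*2.+1)%:R <= e.
Proof.
by move=> e0; have [N0 hN] := inv_nat_small A e0; exists N0 => h hh; apply: hN; lia.
Qed.

Lemma cvgs_scaled w : cvgs (fun h => oddR h * (ee (w / oddR h) - 1)) (twopii R * w).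
Proof.
have [K K0 hK] := ee_approx R; move=> e e0.
have [N1 h1] := odd_small (nm w) ltr01; have [N2 h2] := odd_small (K * nm w ^+ 2) e0.
exists (maxn N1 N2) => h; rewrite geq_max => /andP[/h1 a /h2 b].
have nw : nm (w / oddR h) = nm w / (h.*2.+1)%:R by rewrite nmM nmV nm_oddR.
have -> : oddR h * (ee (w / oddR h) - 1) - twopii R * w =
    oddR h * (ee (w / oddR h) - 1 - twopii R * (w / oddR h)).
  by apply: scaled_err; exact: oddR_neq0.
rewrite nmM nm_oddR; apply: le_trans (ler_wpM2l (ler0n _ _) (hK _ _)) _; first by rewrite nw.
rewrite nw; apply: le_trans b; rewrite le_eqVlt; apply/orP; left; apply/eqP.
by apply: scaled_sq; rewrite pnatr_eq0.
Qed.

Lemma cvgs_ee1 w : cvgs (fun h => ee (w / oddR h)) 1.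
Proof.
have [L L0 hL] := ee_lin; move=> e e0.
have [N1 h1] := odd_small (nm w) ltr01; have [N2 h2] := odd_small (L * nm w) e0.
exists (maxn N1 N2) => h; rewrite geq_max => /andP[/h1 a /h2 b].
have nw : nm (w / oddR h) = nm w / (h.*2.+1)%:R by rewrite nmM nmV nm_oddR.
apply: le_trans (hL _ _) _; first by rewrite nw.
by rewrite nw mulrA.
Qed.

(** The partial fraction expansion of the cotangent, in difference form so that it converges
    absolutely. Subtracting the distribution relations at z and z' gives a finite identity for each
    h. Its j-th term tends to (z' - z)/((z + j)(z' + j)) and is majorised uniformly through
    [ee_lower], so [tannery] passes to the limit. *)
Lemma cK_diff z z' : nonint z -> nonint z' ->
  tsum (fun j : int => (z' - z) * ((z + j%:~R)^-1 * (z' + j%:~R)^-1)) = cK z - cK z'.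
Proof.
move=> hz hz'.
have T0 := twopii_neq0 R.
have zj j : z + j%:~R != 0 := hz j.
have zj' j : z' + j%:~R != 0 := hz' j.
have nonN h (u : C) j : nonint u -> ee ((u + j%:~R) / oddR h) - 1 != 0.
  move=> hu; rewrite subr_eq0; apply/eqP => /ee_eq1_int [k hk].
  have := hu (j - k * (h.*2.+1)%:Z); rewrite rmorphB rmorphM /= addrA -hk oddRE divfK ?pnatr_eq0 //.
  by rewrite subrr eqxx.
pose f h (j : int) := (oddR h)^-1 * cK ((z + j%:~R) / oddR h) - (oddR h)^-1 * cK ((z' + j%:~R) / oddR h).
have fE h j : f h j = twopii R * ee ((z + j%:~R) / oddR h) * (oddR h * (ee ((z' - z) / oddR h) - 1)) *
   ((oddR h * (ee ((z + j%:~R) / oddR h) - 1))^-1 * (oddR h * (ee ((z' + j%:~R) / oddR h) - 1))^-1).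
  rewrite /f /cK.
  have e' : ee ((z' + j%:~R) / oddR h) = ee ((z + j%:~R) / oddR h) * ee ((z' - z) / oddR h).
    by rewrite -eeD; congr ee; rewrite -mulrDl; congr (_ / _); ring.
  have a1 := nonN h z j hz; have a2 := nonN h z' j hz'; have a3 := oddR_neq0 h.
  exact: (scale_frac _ e' a1 a2 a3).
have [L L0 hL] := ee_lin.
have [c c0 hc] := ee_lower R.
pose A := nm (twopii R) * expR (pi *+ 2 * `|complex.Im z|) * (L * nm (z' - z)) * (c ^- 2).
have A0 : 0 <= A.
  by rewrite !mulr_ge0 ?nm_ge0 ?expR_ge0 ?invr_ge0 ?exprn_ge0 ?(ltW L0) ?(ltW c0).
pose b j : C := (A + nm (z' - z))%:C * ((z + j%:~R)^-1 * (z' + j%:~R)^-1).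
have nmb j : nm (b j) = (A + nm (z' - z)) * (nm (z + j%:~R) * nm (z' + j%:~R))^-1.
  by rewrite /b !nmM nm_real !nmV ger0_norm ?addr_ge0 ?nm_ge0 // invfM.
have sb : summable b by apply: summableZ; exact: summable_inv2.
apply: (@tannery _ _ f _ b symS (fun _ => cK z - cK z')) => //.
- move=> j; rewrite nmb nmM nmM !nmV -invfM ler_wpM2r ?invr_ge0 ?mulr_ge0 ?nm_ge0 //.
  by rewrite lerDr.
(* For large N = 2h + 1 and |j| <= h, the real part of (u + j)/N is at most 1/2 + 1/4, inside the
   strip where [ee_lower] applies. *)
- pose M := nm z + nm z' + nm (z' - z) + 1.
  have q4 : 0 < 1/4 :> R by lra.
  have [N0 hN0] := odd_small M q4; exists N0 => h j hh; rewrite in_symS => hj.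
  have hM : M <= 1/4 * (h.*2.+1)%:R by rewrite -ler_pdivrMr ?ltr0n //; exact: hN0.
  have hp : 0 < (h.*2.+1)%:R :> R by rewrite ltr0n.
  have jh : `|j|%:~R <= 1/2 * (h.*2.+1)%:R :> R.
    have : `|j|%:~R <= h%:R :> R by rewrite -[h%:R]/(h%:~R) ler_int.
    have -> : (h.*2.+1)%:R = 2 * h%:R + 1 :> R by rewrite -addn1 natrD -mul2n natrM.
    clear; move: (h%:R : R) (`|j|%:~R : R) => o a; lra.
  have Mz := nm_ge0 z; have Mz' := nm_ge0 z'; have Mzz := nm_ge0 (z' - z).
  have [m1 m2 m3] : [/\ nm z <= 1/4 * (h.*2.+1)%:R, nm z' <= 1/4 * (h.*2.+1)%:R &
      nm (z' - z) <= (h.*2.+1)%:R].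
    move: hM hp Mz Mz' Mzz; rewrite /M; clear.
    by move: ((h.*2.+1)%:R : R) (nm z) (nm z') (nm (z' - z)) => o a b d h1 h2 h3 h4 h5; split; lra.
  have ReIm (u : C) : nm u <= 1/4 * (h.*2.+1)%:R ->
      c * nm (u + j%:~R) <= nm (oddR h * (ee ((u + j%:~R) / oddR h) - 1)).
    move=> hu; rewrite nmM nm_oddR.
    have -> : nm (u + j%:~R) = (h.*2.+1)%:R * nm ((u + j%:~R) / oddR h).
      by rewrite nmM nmV nm_oddR mulrCA mulfV ?mulr1 ?gt_eqF.
    rewrite mulrCA ler_wpM2l ?(ltW hp) //; apply: hc.
      rewrite oddRE Re_divnat Re_addint normrM [X in _ * X]ger0_norm ?invr_ge0 ?ler0n // ler_pdivrMr //.
      apply: le_trans (ler_normD _ _) _; rewrite -intr_norm.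
      have := Re_le_nm u; move: hu jh; clear.
      move: ((h.*2.+1)%:R : R) (`|j|%:~R : R) (nm u) `|complex.Re u| => o a b d; lra.
    rewrite oddRE Im_divnat Im_addint normrM [X in _ * X]ger0_norm ?invr_ge0 ?ler0n // ler_pdivrMr // mul1r.
    have := Im_le_nm u; move: hu hp; clear.
    move: ((h.*2.+1)%:R : R) (nm u) `|complex.Im u| => o b d; lra.
  have h1 : c * nm (z + j%:~R) <= nm (oddR h * (ee ((z + j%:~R) / oddR h) - 1)).
    by apply: ReIm.
  have h2 : c * nm (z' + j%:~R) <= nm (oddR h * (ee ((z' + j%:~R) / oddR h) - 1)).
    by apply: ReIm.
  have h3 : nm (oddR h * (ee ((z' - z) / oddR h) - 1)) <= L * nm (z' - z).
    have nw : nm ((z' - z) / oddR h) = nm (z' - z) / (h.*2.+1)%:R by rewrite nmM nmV nm_oddR.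
    rewrite nmM nm_oddR; apply: le_trans (ler_wpM2l (ltW hp) (hL _ _)) _.
      by rewrite nw ler_pdivrMr // mul1r.
    by rewrite nw scaled_lin // gt_eqF.
  have h4 : nm (ee ((z + j%:~R) / oddR h)) <= expR (pi *+ 2 * `|complex.Im z|).
    have p2 : 0 <= pi *+ 2 :> R by rewrite mulrn_wge0 // pi_ge0.
    rewrite nm_ee ler_expR -mulrN ler_wpM2l //.
    rewrite oddRE Im_divnat Im_addint; apply: le_trans (ler_norm _) _.
    rewrite normrN normrM [X in _ * X]ger0_norm ?invr_ge0 ?ler0n //.
    by rewrite ler_piMr // invf_le1 // ler1n.
  rewrite fE nmb.
  apply: le_trans (_ : A * (nm (z + j%:~R) * nm (z' + j%:~R))^-1 <= _); last first.
    by rewrite ler_wpM2r ?invr_ge0 ?mulr_ge0 ?nm_ge0 // lerDl.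
  have p1 : 0 < c * nm (z + j%:~R) by rewrite mulr_gt0 // nm_gt0.
  have p2 : 0 < c * nm (z' + j%:~R) by rewrite mulr_gt0 // nm_gt0.
  have c1 : c != 0 by rewrite gt_eqF.
  rewrite /A bound_frac ?nm_eq0 //.
  exact: nm_main_bound h4 h3 p1 p2 h1 h2.
- move=> j; exists (absz j) => h hh; rewrite in_symS; lia.
- move=> j; have : cvgs (fun h => f h j) ((z' - z) * ((z + j%:~R)^-1 * (z' + j%:~R)^-1)); last by move=> H e e0; exact: H.
  have -> : (fun h => f h j) = (fun h => twopii R * ee ((z + j%:~R) / oddR h) * (oddR h * (ee ((z' - z) / oddR h) - 1)) *
     ((oddR h * (ee ((z + j%:~R) / oddR h) - 1))^-1 * (oddR h * (ee ((z' + j%:~R) / oddR h) - 1))^-1)).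
    by apply: funext => h; exact: fE.
  rewrite (_ : (z' - z) * _ = twopii R * 1 * (twopii R * (z' - z)) *
    ((twopii R * (z + j%:~R))^-1 * (twopii R * (z' + j%:~R))^-1)); last by apply: limit_frac.
  apply: cvgsM; first apply: cvgsM; first apply: cvgsM.
  + exact: cvgs_cst.
  + exact: cvgs_ee1.
  + exact: cvgs_scaled.
  + apply: cvgsM.
      by apply: cvgsV; [exact: (mulf_neq0 T0 (zj j))|exact: cvgs_scaled].
    by apply: cvgsV; [exact: (mulf_neq0 T0 (zj' j))|exact: cvgs_scaled].
- by move=> h; rewrite (cK_distr h hz) (cK_distr h hz') -sumrB /f oddRE.
- by move=> e e0; exists 0%N => N _; rewrite subrr nm0 ltW.
Qed.

End Cotangent.

(** * The Lipschitz formula *)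

Section FieldIdentities2.
Variable F : fieldType.

Lemma lipA_alg (e t g r x : F) : e * t * g != 0 -> (e * t * g)^-1 * (x * (e * (t * (r * g)))) = r * x.
Proof. by move=> h; rewrite (_ : x * _ = e * t * g * (r * x)) ?mulKf //; ring. Qed.

Lemma lipB_alg (h w : F) k : w ^- 2 * (- h / w) ^+ k = (-1) ^+ k * h ^+ k * w ^- k.+2.
Proof.
rewrite -[- h]mulN1r !exprMn -!exprVn [w^-1 ^+ k.+2]exprSr [w^-1 ^+ k.+1]exprSr; ring.
Qed.

Lemma geom_frac (h a b : F) : a != 0 -> b != 0 -> h * (a ^- 2 * (b / a)^-1) = h * (a^-1 * b^-1).
Proof. by move=> a0 b0; field; rewrite a0 b0. Qed.

End FieldIdentities2.

Section Lipschitz.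
Variable R : realType.
Local Notation C := R[i].
Local Notation T := (twopii R).

Lemma eq_summable (I : choiceType) (f g : I -> C) : f =1 g -> summable g -> summable f.
Proof. by move=> /funext ->. Qed.

Lemma le_has_sum (I : choiceType) (a : I -> R) (t : R) (F : {fset I}) :
  (forall i, 0 <= a i) -> has_sum (fun i => (a i)%:C) t%:C -> \sum_(i <- F) a i <= t.
Proof.
move=> a0 h; apply/ler_addgt0Pr => e e0; have [F0 h0] := h e e0.
have := h0 (F0 `|` F)%fset (fsubsetUl _ _).
rewrite -rmorph_sum -rmorphB nm_real ler_norml => /andP[_ h1].
apply: le_trans (ler_sum_fsub (fsubsetUr F0 F) a0) _; lra.
Qed.

Lemma exp_partial (y : R) (F : {fset nat}) : 0 <= y -> \sum_(k <- F) y ^+ k / k`!%:R <= expR y.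
Proof.
move=> y0; apply: le_has_sum => [k|]; first by rewrite divr_ge0 ?exprn_ge0.
have := tsumP (summable_cexp y%:C); rewrite -/(ev _ _) -/(cexp _) cexp_real; congr has_sum.
by apply: funext => k; rewrite /expc -rmorphXn -(rmorph_nat (real_complex R)) -fmorphV -rmorphM mulrC.
Qed.

Lemma geom_partial (y : R) (F : {fset nat}) : 0 <= y < 1 -> \sum_(k <- F) y ^+ k <= (1 - y)^-1.
Proof.
move=> /andP[y0 y1]; apply: le_has_sum => [k|]; first by rewrite exprn_ge0.
have yC : nm (y%:C : C) < 1 by rewrite nm_real ger0_norm.
have := tsumP (conv_summable (@geom_conv R) yC); rewrite -/(ev _ _) ev_geom //.
rewrite (_ : (1 - y%:C)^-1 = ((1 - y)^-1)%:C); last by rewrite fmorphV rmorphB rmorph1.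
by congr has_sum; apply: funext => k; rewrite mul1r rmorphXn.
Qed.

Lemma summable_bounded (I : choiceType) (f : I -> C) : summable f -> exists B : R, forall i, nm (f i) <= B.
Proof. by move=> [B hB]; exists B => i; have := hB [fset i]%fset; rewrite big_seq_fset1. Qed.

Lemma conv_of_summable (rho : R) (c : nat -> C) :
  (forall r : R, 0 <= r -> r < rho -> summable (fun k : nat => c k * r%:C ^+ k)) -> conv rho c.
Proof.
move=> h r r0 hr; have [B hB] := summable_bounded (h r r0 hr); exists B => k.
by apply: le_trans (hB k); rewrite nmM nmX nm_real ger0_norm.
Qed.

Definition powS (m : nat) (x : C) : C := tsum (fun r : nat => r%:R ^+ m * x ^+ r).

Section AtZ.
Variable z : C.
Hypothesis hz : 0 < complex.Im z.
Let x := ee z.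
Let x1 : nm x < 1 := nm_ee_lt1 hz.

Lemma Im_le_addint (j : int) : complex.Im z <= nm (z + j%:~R).
Proof. by rewrite -(Im_addint z j); apply: le_trans (Im_le_nm _); exact: ler_norm. Qed.

Lemma nonint_H : nonint z. Proof. by apply: nonint_Im; rewrite gt_eqF. Qed.

Lemma summable_expdouble (h : C) : nm x * expR (nm T * nm h) < 1 ->
  summable (fun p : nat * nat => x ^+ p.1 * (expc R p.2 * (T * (p.1%:R * h)) ^+ p.2)).
Proof.
move=> hh; pose y := nm x * expR (nm T * nm h).
have y0 : 0 <= y by rewrite mulr_ge0 ?nm_ge0 ?expR_ge0.
have yC : nm (y%:C : C) < 1 by rewrite nm_real ger0_norm.
apply: (@summable_rows_nm _ _ _ _ (fun r : nat => 1 * y%:C ^+ r)); last first.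
  exact: conv_summable (@geom_conv R) yC.
move=> r F /=; rewrite mul1r nmX nm_real (ger0_norm y0) /y exprMn -expRM_natl.
under eq_bigr do rewrite nmM; rewrite -mulr_sumr nmX ler_wpM2l ?exprn_ge0 ?nm_ge0 //.
apply: le_trans (exp_partial F (_ : 0 <= r%:R * (nm T * nm h))); last by rewrite !mulr_ge0 ?nm_ge0.
rewrite le_eqVlt; apply/orP; left; apply/eqP; apply: eq_bigr => k _.
by rewrite /expc nmM nmX nmV nm_nat !nmM nm_nat mulrC mulrCA.
Qed.

(** The coefficient of h^k in - cK (z + h), read off from the geometric series of the powers of ee
    (z + h) by expanding each exponential in h. *)
Definition lipA (k : nat) : C := T * (T ^+ k * expc R k * powS k x).

Lemma lipA_term (h : C) k : nm x * expR (nm T * nm h) < 1 ->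
  tsum (fun r : nat => x ^+ r * (expc R k * (T * (r%:R * h)) ^+ k)) = T ^+ k * expc R k * powS k x * h ^+ k.
Proof.
move=> hh; have [->|h0] := eqVneq h 0.
  case: k => [|k]; last first.
    by rewrite tsum0 => [|r]; rewrite ?mulr0 ?expr0n ?mulr0 ?mul0r ?mulr0.
  rewrite !expr0 !mul1r mulr1 /powS -tsumZ.
    by apply: eq_tsum => r; rewrite !expr0 mulr1 mul1r mulrC.
  apply: summable_le (conv_summable (@geom_conv R) x1) => r.
  by rewrite expr0.
have s1 := summable_col (summable_expdouble hh) k; rewrite /= in s1.
pose c := (expc R k * T ^+ k * h ^+ k).
have T0 := twopii_neq0 R.
have c0 : c != 0 by rewrite !mulf_neq0 ?expf_neq0 // /expc invr_eq0 pnatr_eq0 -lt0n fact_gt0.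
rewrite [RHS](_ : _ = c * powS k x); last by rewrite /c; ring.
rewrite /powS -tsumZ.
  by apply: eq_tsum => r; rewrite /c !exprMn; ring.
apply: summable_le (summableZ c^-1 s1) => r.
rewrite [X in _ <= nm X](_ : _ = r%:R ^+ k * x ^+ r) //.
by rewrite /c !exprMn; exact: (lipA_alg _ _ c0).
Qed.

Lemma lipA_ev (h : C) : nm x * expR (nm T * nm h) < 1 -> 0 < complex.Im (z + h) ->
  summable (fun k : nat => lipA k * h ^+ k) /\ ev lipA h = - cK (z + h).
Proof.
move=> hh hzh; have sd := summable_expdouble hh.
have s2 := summable_cols sd; rewrite /= in s2.
have E k : lipA k * h ^+ k = T * tsum (fun r : nat => x ^+ r * (expc R k * (T * (r%:R * h)) ^+ k)).
  by rewrite lipA_term // /lipA; ring.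
split; first by apply: (eq_summable E); exact: (summableZ T s2).
rewrite /ev (eq_tsum E) tsumZ // -(tsum_cols sd) (tsum_rows sd) /=.
have -> : tsum (fun i : nat => tsum (fun j : nat => x ^+ i * (expc R j * (T * (i%:R * h)) ^+ j))) =
   tsum (fun i : nat => 1 * ee (z + h) ^+ i).
  apply: eq_tsum => r; rewrite tsumZ; last exact: summable_cexp.
  rewrite -/(ev _ _) -/(cexp _) -/(ee _) mul1r eeD exprMn; congr (_ * _).
  by rewrite -eeMn mulr_natl.
rewrite -/(ev (fun _ => 1) _) ev_geom ?nm_ee_lt1 // /cK.
by rewrite -mulrN -invrN opprB.
Qed.

(** The coefficient of h^k in (cK z - cK (z + h)) / h, read off from the partial fractions by a
    geometric expansion of each 1/(z + h + n). *)
Definition lipB (k : nat) : C := (-1) ^+ k * tsum (fun n : int => (z + n%:~R) ^- k.+2).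

Lemma summable_lipB (h : C) : nm h <= complex.Im z / 2 ->
  summable (fun p : int * nat => (z + p.1%:~R) ^- 2 * (- h / (z + p.1%:~R)) ^+ p.2).
Proof.
move=> hh; have s0 := summable_inv2 nonint_H nonint_H.
apply: (summable_rows_nm _ (summableZ (2%:R : C) s0)) => n F /=.
have zn : z + n%:~R != 0 := nonint_H n.
pose y := nm h / nm (z + n%:~R).
have y2 : y <= 1/2.
  rewrite /y ler_pdivrMr ?nm_gt0 //; have := Im_le_addint n; lra.
have y0 : 0 <= y by rewrite divr_ge0 ?nm_ge0.
have E k : nm ((z + n%:~R) ^- 2 * (- h / (z + n%:~R)) ^+ k) = nm ((z + n%:~R) ^- 2) * y ^+ k.
  by rewrite nmM nmX; congr (_ * _ ^+ _); rewrite nmM nmN nmV.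
rewrite (eq_bigr _ (fun k _ => E k)); have -> : nm (2%:R * ((z + n%:~R)^-1 * (z + n%:~R)^-1)) = nm ((z + n%:~R) ^- 2) * 2.
  by rewrite nmM nm_nat -expr2 exprVn mulrC.
rewrite -mulr_sumr ler_wpM2l ?nm_ge0 //; apply: le_trans (geom_partial F (_ : 0 <= y < 1)) _; first by rewrite y0; lra.
by rewrite invf_ple ?posrE; lra.
Qed.

Lemma lipB_term (h : C) k : nm h <= complex.Im z / 2 ->
  tsum (fun n : int => (z + n%:~R) ^- 2 * (- h / (z + n%:~R)) ^+ k) = lipB k * h ^+ k.
Proof.
move=> hh; rewrite /lipB mulrAC -tsumZ; last first.
  have := summable_inv2 nonint_H nonint_H; apply: (@summable_leZ _ _ ((complex.Im z)^-1 ^+ k)) => n.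
  rewrite nmV nmX nmM nmV -exprVn !exprSr -mulrA ler_wpM2r ?mulr_ge0 ?invr_ge0 ?nm_ge0 //.
  rewrite lerXn2r ?nnegrE ?invr_ge0 ?nm_ge0 ?(ltW hz) //.
  by rewrite lef_pV2 ?posrE ?nm_gt0 ?nonint_H // Im_le_addint.
by apply: eq_tsum => n; rewrite lipB_alg.
Qed.

Lemma lipB_ev (h : C) : nm h <= complex.Im z / 2 -> nonint (z + h) ->
  summable (fun k : nat => lipB k * h ^+ k) /\ h * ev lipB h = cK z - cK (z + h).
Proof.
move=> hh nzh; have sd := summable_lipB hh.
have s2 := summable_cols sd; rewrite /= in s2.
split.
  by apply: eq_summable s2 => k; rewrite -lipB_term.
rewrite -cK_diff //; last exact: nonint_H.
rewrite /ev -(eq_tsum (fun k => lipB_term k hh)) -(tsum_cols sd) (tsum_rows sd) /= -tsumZ; last exact: summable_rows sd.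
apply: eq_tsum => n; have zn : z + n%:~R != 0 := nonint_H n.
have zhn : z + h + n%:~R != 0 := nzh n.
have y1 : nm (- h / (z + n%:~R)) < 1.
  rewrite nmM nmN nmV ltr_pdivrMr ?nm_gt0 // mul1r; move: hz hh (Im_le_addint n) (nm_ge0 h); clear; move: (complex.Im z) (nm h) (nm _) => a b c; lra.
rewrite tsumZ; last first.
  have := conv_summable (@geom_conv R) y1; apply: summable_le => k; by rewrite mul1r.
have -> : tsum (fun k : nat => (- h / (z + n%:~R)) ^+ k) = ev (fun _ => 1) (- h / (z + n%:~R)).
  by apply: eq_tsum => k; rewrite mul1r.
rewrite ev_geom //.
have -> : 1 - - h / (z + n%:~R) = (z + h + n%:~R) / (z + n%:~R).
  by rewrite mulNr opprK -{1}(mulfV zn) -mulrDl; congr (_ / _); ring.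
rewrite geom_frac //; congr (_ * _); ring.
Qed.

Lemma nm_twopii : nm T = pi *+ 2.
Proof.
rewrite twopiiE nmM nm_real [nm 'i](_ : _ = 1); last by rewrite /nm /= expr0n expr1n add0r sqrtr1.
by rewrite mulr1 ger0_norm // mulrn_wge0 // pi_ge0.
Qed.

Let rho := complex.Im z / 2.
Let rho0 : 0 < rho. Proof. by rewrite divr_gt0. Qed.

Let small_exp (r : R) : r < rho -> nm x * expR (nm T * r) < 1.
Proof.
move=> hr; rewrite /x nm_ee nm_twopii -expRD -(expR0 R) ltr_expR addrC -mulrBr.
have p2 : 0 < pi *+ 2 :> R by rewrite pmulrn_lgt0 // pi_gt0.
rewrite (pmulr_rlt0 _ p2) subr_lt0.
by apply: lt_trans hr _; rewrite /rho; move: hz; move: (complex.Im z) => a; lra.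
Qed.

Let Im_real (r : R) : complex.Im (z + r%:C) = complex.Im z.
Proof. by rewrite raddfD /= addr0. Qed.

Lemma conv_lipA : conv rho lipA.
Proof.
apply: conv_of_summable => r r0 hr.
have nr : nm (r%:C : C) = r by rewrite nm_real ger0_norm.
by apply: (proj1 (lipA_ev _ _)); rewrite ?nr ?small_exp ?Im_real.
Qed.

Lemma conv_lipB : conv rho lipB.
Proof.
apply: conv_of_summable => r r0 hr.
have nr : nm (r%:C : C) = r by rewrite nm_real ger0_norm.
apply: (proj1 (lipB_ev _ _)); first by rewrite nr ltW.
by apply: nonint_Im; rewrite Im_real gt_eqF.
Qed.

(** The second expansion of - cK (z + h): [lipB] multiplied by h, with constant term - cK z. *)
Let seqB k := if k is k'.+1 then lipB k' else - cK z.

Let conv_seqB : conv rho seqB.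
Proof.
move=> r r0 hr; have [B hB] := conv_lipB r0 hr; exists (nm (cK z) + `|r| * `|B|) => -[|k] /=.
  by rewrite expr0 mulr1 nmN lerDl mulr_ge0.
rewrite exprS mulrCA; apply: ler_wpDl; first exact: nm_ge0.
apply: ler_pM; rewrite ?mulr_ge0 ?exprn_ge0 ?nm_ge0 ?ler_norm //.
exact: le_trans (hB k) (ler_norm _).
Qed.

(** The function - cK (z + h) of h has two expansions, one from the exponential and one from the
    partial fractions. The formula is the equality of their coefficients of h^(k+1). *)
Lemma lipschitz (k : nat) : T ^+ k.+2 * expc R k.+1 * powS k.+1 x =
  (-1) ^+ k * tsum (fun n : int => (z + n%:~R) ^- k.+2).
Proof.
have : lipA k.+1 = seqB k.+1; last first.
  by rewrite /lipA /= /lipB => <-; rewrite !mulrA -exprS.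
apply: (ev_inj rho0 conv_lipA conv_seqB) => e e0.
pose r := Num.min (rho / 2) e.
have r0 : 0 < r by rewrite lt_min e0 divr_gt0.
have hr : r < rho by apply: le_lt_trans (_ : rho / 2 < _); rewrite ?ge_min ?lexx //; move: rho0; lra.
have nr : nm (r%:C : C) = r by rewrite nm_real gtr0_norm.
exists r%:C; split.
- by rewrite -nm_gt0 nr.
- by rewrite nr ge_min lexx orbT.
rewrite (ev_shift 1 conv_seqB) ?nr // big_ord1 /= expr0 mulr1 expr1.
have -> : shift 1 seqB = lipB by [].
rewrite (proj2 (lipB_ev _ _)) ?nr ?(ltW hr) //; last by apply: nonint_Im; rewrite Im_real gt_eqF.
rewrite (proj2 (lipA_ev _ _)) ?nr ?small_exp ?Im_real //.
by rewrite addKr.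
Qed.

End AtZ.

(** For m > 0 the term n = 0 is 0, since the inverse of 0 is 0; so this is 2 zeta(m) for even m >=
    2. *)
Definition Zt (m : nat) : C := tsum (fun n : int => (n%:~R : C) ^- m).

(** The Taylor coefficients of - 2 pi h cot(pi h) = h (cK (- h) - cK h). *)
Definition Zs (m : nat) : C := if (m < 2)%N then cst (-2) m else (1 + (-1) ^+ m) * Zt m.

Lemma nm_intr_ge1 (n : int) : n != 0 -> 1 <= nm (n%:~R : C).
Proof. by move=> n0; rewrite nm_int -[1]/(1%:~R) ler_int; lia. Qed.

Lemma summable_Zt (m : nat) : summable (fun n : int => (n%:~R : C) ^- m.+2).
Proof.
apply: (@summable_leZ _ _ 4 _ (@w2 R)); last exact: summable_w2.
move=> n; rewrite nm_w2 nmV nmX; have [->|n0] := eqVneq n 0.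
  by rewrite mulr0z nm0 expr0n invr0 mulr_ge0 ?invr_ge0 ?exprn_ge0 ?addr_ge0 ?ler0z.
have h1 := nm_intr_ge1 n0; rewrite nm_int in h1 *; move: (`|n|%:~R : R) h1 => a a1.
have a0 : 0 < a by lra.
apply: le_trans (_ : a ^- 2 <= _).
  by rewrite lef_pV2 ?posrE ?exprn_gt0 // ler_weXn2l.
have -> : 4 * (1 + a) ^- 2 = ((1 + a) / 2) ^- 2 by field; rewrite gt_eqF //; lra.
by rewrite lef_pV2 ?posrE ?exprn_gt0 ?lerXn2r ?nnegrE //; lra.
Qed.

Definition zfam (h : C) (p : int * nat) : C :=
  if (p.2 < 2)%N then 0 else (1 + (-1) ^+ p.2) * (h / p.1%:~R) ^+ p.2.

Lemma summable_zfam h : nm h <= 1/2 -> summable (zfam h).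
Proof.
move=> hh; apply: (summable_rows_nm _ (summableZ (4%:R : C) (summable_Zt 0))) => n F /=.
have [->|n0] := eqVneq n 0.
  rewrite mulr0z expr0n invr0 mulr0 nm0 big1 // => k _; rewrite /zfam /=.
  by case: ltnP => [|k2]; rewrite ?nm0 // invr0 mulr0 expr0n; case: k k2 => // k _; rewrite mulr0 nm0.
have n1 := nm_intr_ge1 n0.
pose y := nm h / nm (n%:~R : C).
have y0 : 0 <= y by rewrite divr_ge0 ?nm_ge0.
have y1 : y <= 1/2.
  by apply: le_trans hh; rewrite /y ler_piMr ?nm_ge0 // invf_le1 // (lt_le_trans ltr01).
have E k : nm (zfam h (n, k)) <= (2 * nm (n%:~R : C) ^- 2) * (2^-1) ^+ k * 1.
  rewrite /zfam /=; case: ltnP => k2.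
    by rewrite nm0 !mulr_ge0 ?invr_ge0 ?exprn_ge0 ?nm_ge0 ?invr_ge0.
  rewrite mulr1 nmM nmX nmM nmV -/y -mulrA; apply: ler_pM; rewrite ?nm_ge0 ?exprn_ge0 //.
    apply: le_trans (nmD _ _) _; rewrite nm1 nmX nmN nm1 expr1n; lra.
  case: k k2 => [|[|k]] // _; have -> : y ^+ k.+2 = y ^+ 2 * y ^+ k by rewrite -exprD.
  have -> : nm (n%:~R : C) ^- 2 * 2^-1 ^+ k.+2 = (2^-1 / nm (n%:~R : C)) ^+ 2 * 2^-1 ^+ k.
    rewrite (_ : 2^-1 ^+ k.+2 = 2^-1 ^+ 2 * 2^-1 ^+ k :> R); last by rewrite -exprD.
    by rewrite [in RHS]exprMn [(nm _)^-1 ^+ 2]exprVn mulrA; congr (_ * _); rewrite mulrC.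
  apply: ler_pM; rewrite ?exprn_ge0 //.
    rewrite lerXn2r ?nnegrE // ?divr_ge0 ?nm_ge0 ?invr_ge0 // ler_wpM2r ?invr_ge0 ?nm_ge0 //.
    by apply: le_trans hh _; lra.
  by rewrite lerXn2r ?nnegrE ?invr_ge0 //; move: y1; lra.
apply: le_trans (ler_sum _ (fun k _ => E k)) _.
under eq_bigr do rewrite mulr1; rewrite -mulr_sumr.
have g : \sum_(i <- F) (2^-1 : R) ^+ i <= 2.
  apply: le_trans (geom_partial F (_ : 0 <= 2^-1 < 1)) _; first by apply/andP; split; lra.
  by rewrite invf_ple ?posrE; lra.
have c0 : 0 <= 2 * nm (n%:~R : C) ^- 2 by rewrite mulr_ge0 ?invr_ge0 ?exprn_ge0 ?nm_ge0.
apply: le_trans (ler_wpM2l c0 g) _.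
rewrite nmM nm_nat nmV nmX; move: (nm _ ^- 2) => a; lra.
Qed.

End Lipschitz.

(** * Values of zeta at 2, 4 and 6 *)

Section ZetaAlgebra.
Variable F : fieldType.

Lemma zeta_geom (h n : F) : n != 0 -> n - h != 0 -> n + h != 0 ->
  (h / n) ^+ 2 * (1 - h / n)^-1 + (h / n) ^+ 2 * (1 + h / n)^-1 =
  h * (2%:R * h * ((n - h)^-1 * (n + h)^-1)).
Proof.
move=> n0 a0 b0; have -> : 1 - h / n = (n - h) / n by rewrite mulrBl mulfV.
have -> : 1 + h / n = (n + h) / n by rewrite mulrDl mulfV.
by field; rewrite n0 a0 b0.
Qed.

Lemma zero_term (h : F) : h != 0 -> - 2%:R = h * ((h - - h) * ((- h)^-1 * h^-1)).
Proof. by move=> h0; field; rewrite ?oppr_eq0 ?h0. Qed.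

Lemma even_geom (u : F) k : (1 + (-1) ^+ k.+2) * u ^+ k.+2 = u ^+ 2 * (1 * u ^+ k + 1 * (- u) ^+ k).
Proof.
have e (x : F) : x ^+ k.+2 = x ^+ 2 * x ^+ k by rewrite -exprD.
by rewrite -[- u]mulN1r exprMn !e sqrrN expr1n; ring.
Qed.

Lemma cot_alg (t x : F) : x != 0 -> x - 1 != 0 -> x^-1 - 1 != 0 ->
  (x - 1) * (t / (x^-1 - 1) - t / (x - 1)) = - t * (x + 1).
Proof.
move=> x0 x1 _; have -> : x^-1 - 1 = - (x - 1) / x by rewrite mulNr mulrBl mulfV // mul1r opprB.
by field; rewrite oppr_eq0 x0 x1.
Qed.

Lemma zeta_solve (t z2 z4 z6 : F) : t != 0 -> (forall k, (0 < k)%N -> (k%:R : F) != 0) ->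
  t * (2%:R * z2) + t ^+ 3 / 6%:R * - 2%:R = - t * (t ^+ 2 / 2%:R) ->
  t * (2%:R * z4) + t ^+ 3 / 6%:R * (2%:R * z2) + t ^+ 5 / 120%:R * - 2%:R = - t * (t ^+ 4 / 24%:R) ->
  t * (2%:R * z6) + t ^+ 3 / 6%:R * (2%:R * z4) + t ^+ 5 / 120%:R * (2%:R * z2) + t ^+ 7 / (720%:R * 7%:R) * - 2%:R = - t * (t ^+ 6 / 720%:R) ->
  [/\ z2 = - (t ^+ 2 / 12%:R), z4 = t ^+ 4 / 720%:R & z6 = - (t ^+ 6 / (720%:R * 42%:R))].
Proof.
move=> t0 nz; have c2 : (2%:R : F) != 0 by exact: nz.
have t2 : t * 2%:R != 0 by rewrite mulf_neq0.
move=> h2 h4 h6.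
have e2 : z2 = - (t ^+ 2 / 12%:R).
  apply: (mulfI t2); rewrite -mulrA (_ : t * (2%:R * z2) = - t * (t ^+ 2 / 2%:R) - t ^+ 3 / 6%:R * - 2%:R); last by rewrite -h2; ring.
  by field; rewrite ?nz.
have e4 : z4 = t ^+ 4 / 720%:R.
  apply: (mulfI t2); rewrite -mulrA (_ : t * (2%:R * z4) = - t * (t ^+ 4 / 24%:R) - t ^+ 5 / 120%:R * - 2%:R - t ^+ 3 / 6%:R * (2%:R * z2)); last by rewrite -h4; ring.
  by rewrite e2; field; rewrite ?nz.
have e6 : z6 = - (t ^+ 6 / (720%:R * 42%:R)).
  apply: (mulfI t2); rewrite -mulrA (_ : t * (2%:R * z6) = - t * (t ^+ 6 / 720%:R) - t ^+ 7 / (720%:R * 7%:R) * - 2%:R - t ^+ 5 / 120%:R * (2%:R * z2) - t ^+ 3 / 6%:R * (2%:R * z4)); last by rewrite -h6; ring.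
  (* All inverses are written through s = 1/720 and s7 = 1/7, so that the identity becomes
     polynomial modulo 720 s = 1 and 7 s7 = 1. *)
  rewrite e2 e4; set s := (720%:R : F)^-1; set s7 := (7%:R : F)^-1.
  have s1 : 720%:R * s = 1 by rewrite /s mulfV // nz.
  have s71 : 7%:R * s7 = 1 by rewrite /s7 mulfV // nz.
  have inv (m : F) a : a != 0 -> a * m * s = 1 -> a^-1 = m * s.
    by move=> a0 h; apply: (mulfI a0); rewrite mulfV // mulrA h.
  have i6 : (6%:R : F)^-1 = 120%:R * s by apply: inv; [exact: nz|rewrite -natrM].
  have i120 : (120%:R : F)^-1 = 6%:R * s by apply: inv; [exact: nz|rewrite -natrM].
  have i12 : (12%:R : F)^-1 = 60%:R * s by apply: inv; [exact: nz|rewrite -natrM].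
  have i42 : (42%:R : F)^-1 = 120%:R * s * s7.
    by rewrite -i6 /s7 -invfM -natrM.
  rewrite [(720%:R * 7%:R)^-1]invfM [(720%:R * 42%:R)^-1]invfM i6 i120 i12 i42 -/s -/s7.
  have h1 : 720%:R * s * s - s = 0 by rewrite s1 mul1r subrr.
  have h2' : 7%:R * s7 - 1 = 0 by rewrite s71 subrr.
  apply/eqP; rewrite -subr_eq0; apply/eqP.
  transitivity (t ^+ 7 * (- 2%:R * s7 * (720%:R * s * s - s) + 240%:R * s * s * (7%:R * s7 - 1)
     + (720%:R * s * s - s))); last by rewrite h1 h2' !mulr0 !addr0 mulr0.
  ring.
by split.
Qed.

End ZetaAlgebra.

Section Zeta.
Variable R : realType.
Local Notation C := R[i].
Local Notation T := (twopii R).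

Definition mulX (c : nat -> C) (k : nat) : C := if k is k'.+1 then c k' else 0.

Lemma conv_mulX rho c : conv rho c -> conv rho (mulX c).
Proof.
move=> hc r r0 hr; have [B hB] := hc r r0 hr; exists (r * `|B|) => -[|k].
  by rewrite [mulX c 0]/= nm0 mul0r mulr_ge0.
rewrite [mulX c k.+1]/= exprS mulrCA ler_wpM2l //; exact: le_trans (hB k) (ler_norm _).
Qed.

Lemma ev_mulX rho c h : conv rho c -> nm h < rho -> ev (mulX c) h = h * ev c h.
Proof.
by move=> hc hh; rewrite (ev_shift 1 (conv_mulX hc) hh) big_ord1 mul0r add0r expr1.
Qed.

Lemma nonint_small h : h != 0 -> nm h <= 1/2 -> nonint (h : C).
Proof.
move=> h0 hh n; have [->|n0] := eqVneq n 0; first by rewrite addr0.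
have := nm_intr_ge1 R n0 => n1; rewrite -nm_gt0 addrC.
have := nm_dist_le (n%:~R : C) (- h); rewrite opprK nmN; lra.
Qed.

Lemma zfam_row (h : C) (n : int) : h != 0 -> nm h <= 1/2 -> n != 0 ->
  tsum (fun k : nat => zfam h (n, k)) = h * ((h - - h) * ((- h + n%:~R)^-1 * (h + n%:~R)^-1)).
Proof.
move=> h0 hh n0; have n1 := nm_intr_ge1 R n0.
have u1 : nm (h / n%:~R : C) < 1.
  have nv : nm (n%:~R : C)^-1 <= 1 by rewrite nmV invf_le1 // (lt_le_trans ltr01).
  have := ler_wpM2l (nm_ge0 h) nv; rewrite nmM mulr1; lra.
set u := h / n%:~R in u1 *.
have uN1 : nm (- u) < 1 by rewrite nmN.
have s1 := conv_summable (@geom_conv R) u1; have s2 := conv_summable (@geom_conv R) uN1.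
have E k : zfam h (n, k) = u ^+ 2 * shift 0 (fun k => if k is k'.+2 then 1 * u ^+ k' + 1 * (- u) ^+ k' else 0) k.
  rewrite /zfam /shift add0n /= -/u; case: k => [|[|k]] /=; rewrite ?mulr0 //.
  exact: even_geom.
rewrite (eq_tsum E) -(@tsum_reindex_inj _ _ _ (fun k : nat => k.+2)).
- rewrite (eq_tsum (g := fun k => u ^+ 2 * (1 * u ^+ k) + u ^+ 2 * (1 * (- u) ^+ k))); last first.
    by move=> k; rewrite /= /shift add0n mulrDr.
  rewrite tsumD; [|exact: summableZ|exact: summableZ].
  have -> : tsum (fun k : nat => u ^+ 2 * (1 * u ^+ k)) = u ^+ 2 * (1 - u)^-1.
    by rewrite tsumZ //; congr (_ * _); exact: ev_geom.
  have -> : tsum (fun k : nat => u ^+ 2 * (1 * (- u) ^+ k)) = u ^+ 2 * (1 + u)^-1.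
    by rewrite tsumZ //; congr (_ * _); rewrite -[u in RHS]opprK; exact: ev_geom.
  have nz : (n%:~R : C) != 0 by rewrite -nm_gt0 (lt_le_trans ltr01).
  have hz := nonint_small h0 hh.
  have hmz : nonint (- h) by apply: nonint_small; rewrite ?oppr_eq0 ?nmN.
  rewrite zeta_geom //; last 2 first.
  + by rewrite addrC.
  + by rewrite addrC.
  rewrite opprK (addrC h n%:~R) (addrC (- h)) -mulr2n mulr_natl //.
- by move=> a b [].
- by move=> [|[|k]]; rewrite /shift add0n ?mulr0 ?eqxx // => _; exists k.
- apply: summableZ; apply: (@summable_inj _ _ _ (fun k : nat => k.+2)).
  + by move=> a b [].
  + by move=> [|[|k]]; rewrite /shift add0n ?eqxx // => _; exists k.
  + exact: summableD.
Qed.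

Lemma zfam_row0 (h : C) : tsum (fun k : nat => zfam h (0, k)) = 0 :> C.
Proof.
apply: tsum0 => k; rewrite /zfam /=; case: ltnP => // k2.
by rewrite invr0 mulr0 expr0n; case: k k2 => //= k _; rewrite mulr0.
Qed.

Lemma zfam_col (h : C) k : tsum (fun n : int => zfam h (n, k)) = (if (k < 2)%N then 0 else (1 + (-1) ^+ k) * Zt R k) * h ^+ k.
Proof.
rewrite /zfam /=; case: ltnP => k2; first by rewrite mul0r tsum0.
case: k k2 => [|[|k]] // _; rewrite mulrAC /Zt -tsumZ; last exact: summable_Zt.
by apply: eq_tsum => n; rewrite exprMn exprVn mulrA.
Qed.

(** The double family [zfam] is summed in two ways: the columns give zeta values, the rows give the
    partial fractions of [cK] at - h and h. The partial fraction at n = 0 supplies the constant term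
    -2. *)
Lemma Zs_ev (h : C) : h != 0 -> nm h <= 1/2 -> summable (fun k : nat => Zs R k * h ^+ k) /\
  ev (Zs R) h = h * (cK (- h) - cK h).
Proof.
move=> h0 hh; have sd := summable_zfam hh.
have s2 := summable_cols sd; rewrite /= in s2.
have sz : summable (fun k : nat => cst (-2) k * h ^+ k).
  by apply: (@summable_finite _ _ (iotaF 1)) => -[|k]; rewrite in_iotaF // mul0r.
have E k : Zs R k * h ^+ k = cst (-2) k * h ^+ k + tsum (fun n : int => zfam h (n, k)).
  rewrite zfam_col -mulrDl; congr (_ * _); rewrite /Zs; case: ltnP; rewrite ?addr0 //.
  by case: k => // k _; rewrite /cst /= add0r.
split; first by apply: eq_summable E _; exact: summableD.
rewrite /ev (eq_tsum E) tsumD // -/(ev _ _) ev_cst -(tsum_cols sd) (tsum_rows sd) /=.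
have hz := nonint_small h0 hh.
have hmz : nonint (- h) by apply: nonint_small; rewrite ?oppr_eq0 ?nmN.
rewrite -cK_diff // -tsumZ; last by apply: summableZ; exact: summable_inv2.
pose g (n : int) : C := if n == 0 then -2 else 0.
have sg : summable g by apply: (@summable_finite _ _ [fset 0]%fset) => n; rewrite inE /g => /negPf ->.
have -> : - 2 = tsum g.
  by rewrite (@tsum_finite _ _ [fset 0]%fset) ?big_seq_fset1 /g ?eqxx // => n; rewrite inE => /negPf ->.
rewrite -tsumD //; last exact: (summable_rows sd).
apply: eq_tsum => n; rewrite /g; have [->|n0] := eqVneq n 0; last by rewrite add0r zfam_row.
by rewrite zfam_row0 !addr0; exact: zero_term.
Qed.

Definition et (k : nat) : C := expc R k * T ^+ k.

Lemma conv_et rho : 0 <= rho -> conv rho et.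
Proof.
move=> rho0 r r0 hr; have lt : nm T * r < nm T * r + 1 by rewrite ltrDl.
have [B hB] := @conv_expc R (nm T * r + 1) (nm T * r) (mulr_ge0 (nm_ge0 _) r0) lt.
by exists B => i; have := hB i; rewrite /et exprMn nmM nmX mulrA.
Qed.

Lemma ev_et h : ev et h = ee h.
Proof. by apply: eq_tsum => k; rewrite /et exprMn mulrA. Qed.

Lemma conv_Zs : conv (1/2) (Zs R).
Proof.
apply: conv_of_summable => r; rewrite le_eqVlt => /orP[/eqP <- _|r0 hr].
  by apply: (@summable_finite _ _ (iotaF 1)) => -[|k]; rewrite in_iotaF // expr0n mulr0.
have nr : nm (r%:C : C) = r by rewrite nm_real gtr0_norm.
by apply: (proj1 (Zs_ev _ _)); rewrite ?nr ?(ltW hr) // -nm_gt0 nr.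
Qed.

(** With x = ee h, the cotangent satisfies (x - 1)(cK (- h) - cK h) = - T (x + 1). Multiplied by h
    this is an identity of power series; its coefficients of h^3, h^5 and h^7 form a triangular
    system for the three values. *)
Lemma zeta_values : [/\ Zt R 2 = - (T ^+ 2 / 12%:R), Zt R 4 = T ^+ 4 / 720%:R &
   Zt R 6 = - (T ^+ 6 / (720%:R * 42%:R))].
Proof.
pose e1 k := et k - cst 1 k; pose e2 k := et k + cst 1 k.
have h0 : 0 < (1/2 : R) by lra.
have ce := conv_et (ltW h0).
have c1 : conv (1/2) e1 by apply: convB => //; exact: conv_cst.
have c2 : conv (1/2) e2 by apply: convD => //; exact: conv_cst.
have key : convol e1 (Zs R) =1 (fun m => - T * mulX e2 m).
  apply: (ev_inj h0 (conv_convol c1 conv_Zs) (convZ _ (conv_mulX c2))) => e e0.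
  pose r := Num.min (1/4 : R) e.
  have r0 : 0 < r by rewrite lt_min e0 andbT; lra.
  have r4 : r <= 1/4 by rewrite ge_min lexx.
  have nr : nm (r%:C : C) = r by rewrite nm_real gtr0_norm.
  have rn : (r%:C : C) != 0 by rewrite -nm_gt0 nr.
  exists r%:C; split => //; first by rewrite nr ge_min lexx orbT.
  have hr : nm (r%:C : C) < 1/2 by rewrite nr; lra.
  have hr' : nm (r%:C : C) <= 1/2 by exact: ltW.
  rewrite (ev_convol c1 conv_Zs hr) (evZ _ (conv_mulX c2) hr) (ev_mulX c2 hr).
  rewrite (evB ce (@conv_cst R (1 / 2) 1) hr) (evD ce (@conv_cst R (1 / 2) 1) hr) ev_cst ev_et.
  rewrite (proj2 (Zs_ev rn hr')) /cK eeN mulrCA [- T * _]mulrCA; congr (_ * _).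
  have x1 : ee (r%:C : C) - 1 != 0 by rewrite subr_eq0 ee_neq1 //; exact: nonint_small.
  have x0 := ee_neq0 (r%:C : C).
  apply: cot_alg => //.
  by rewrite subr_eq0; apply: contra x1 => /eqP h; rewrite subr_eq0 -[ee _]invrK h invr1.
have et0 : e1 0%N = 0 by rewrite /e1 /et /expc fact0 invr1 mul1r expr0 subrr.
have z0 : Zs R 0 = - 2%:R by [].
have z1 : Zs R 1 = 0 by [].
have zodd k : Zs R k.*2.+3 = 0.
  by rewrite /Zs /= -signr_odd /= odd_double /= expr1 subrr mul0r.
have zev k : Zs R k.*2.+2 = 2%:R * Zt R k.*2.+2.
  by rewrite /Zs /= -signr_odd /= odd_double /= expr0.
have z3 := zodd 0%N; have z5 := zodd 1%N.
have z2 := zev 0%N; have z4 := zev 1%N; have z6 := zev 2%N.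
have eE k : e1 k.+1 = T ^+ k.+1 / k.+1`!%:R by rewrite /e1 /= subr0 /et /expc mulrC.
have eE2 k : e2 k.+1 = T ^+ k.+1 / k.+1`!%:R by rewrite /e2 /= addr0 /et /expc mulrC.
have k3 := key 3%N; have k5 := key 5%N; have k7 := key 7%N.
move: k3 k5 k7; rewrite /convol !big_ord_recl !big_ord0 /= /bump /= !add1n.
rewrite et0 !eE !eE2 z0 z1 z2 z3 z4 z5 z6.
have f7 : (7`!%:R : C) = 720%:R * 7%:R by rewrite factS mulnC natrM.
have f1 : T ^+ 1 / 1`!%:R = T by rewrite (_ : 1`! = 1%N) // divr1.
rewrite f7 f1 !mul0r !mulr0 !addr0 !add0r.
have [f2 f3 f4 f5 f6] : [/\ 2`! = 2%N, 3`! = 6%N, 4`! = 24%N, 5`! = 120%N & 6`! = 720%N] by [].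
rewrite f2 f3 f4 f5 f6.
move=> k3 k5 k7; apply: zeta_solve => [||||].
- exact: twopii_neq0.
- by move=> k k0; rewrite pnatr_eq0 -lt0n.
- by rewrite -k3.
- by rewrite -k5 !addrA.
- by rewrite -k7 !addrA.
Qed.

End Zeta.

(** * Lattice sums *)

Lemma exprS4 (F : comNzRingType) (x : F) k : x ^+ k.+4 = x ^+ k * (x * x * (x * x)).
Proof. by rewrite -addn4 exprD; congr (_ * _); ring. Qed.

Section Lattice.
Variable R : realType.
Local Notation C := R[i].
Local Notation T := (twopii R).

Definition vec (tau : C) (p : int * int) : C := p.1%:~R * tau + p.2%:~R.

Lemma nm_divi (K x : R) (b : R) : 0 < x -> x * b <= K -> b <= K / x.
Proof. by move=> x0 h; rewrite ler_pdivlMr // mulrC. Qed.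

Lemma Im_intM (m : int) (tau : C) : complex.Im (m%:~R * tau) = m%:~R * complex.Im tau.
Proof. by rewrite -(rmorph_int (real_complex R)); case: tau => a b /=; ring. Qed.

Lemma Re_intM (m : int) (tau : C) : complex.Re (m%:~R * tau) = m%:~R * complex.Re tau.
Proof. by rewrite -(rmorph_int (real_complex R)); case: tau => a b /=; ring. Qed.

Section Fix.
Variable tau : C.
Hypothesis ht : 0 < complex.Im tau.

Lemma tau_neq0 : tau != 0.
Proof. by apply/eqP => h; move: ht; rewrite h ltxx. Qed.

(** The imaginary part of a lattice vector controls its first coordinate, and the triangle
    inequality then controls the second. The added 1 costs only a factor, since a nonzero vector has
    a coordinate of modulus at least 1. *)
Lemma lat_lower : exists2 K : R, 0 < K & forall p : int * int, p != (0, 0) ->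
  1 + `|p.1|%:~R <= K * nm (vec tau p) /\ 1 + `|p.2|%:~R <= K * nm (vec tau p).
Proof.
have [y yE] : exists y, y = complex.Im tau by exists (complex.Im tau).
have ht' : 0 < y by rewrite yE.
pose K0 := y^-1 + (1 + nm tau / y).
have yi : 0 < y^-1 by rewrite invr_gt0.
have nt := nm_ge0 tau.
have nty : 0 <= nm tau / y by rewrite divr_ge0 // ltW.
exists (2 * K0); first by rewrite /K0; lra.
move=> [m n] /= p0; rewrite /vec /=; set v := m%:~R * tau + n%:~R.
have hm : `|m|%:~R * y <= nm v.
  have : complex.Im v = m%:~R * y by rewrite /v Im_addint Im_intM yE.
  by move=> e; apply: le_trans (Im_le_nm v); rewrite e normrM (gtr0_norm ht') intr_norm.
have hn : `|n|%:~R <= nm v + `|m|%:~R * nm tau.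
  rewrite -(nm_int R n) (_ : n%:~R = v - m%:~R * tau); last by rewrite /v; ring.
  by apply: le_trans (nmD _ _) _; rewrite nmN nmM nm_int.
have v0 := nm_ge0 v.
have hm' : `|m|%:~R <= y^-1 * nm v by rewrite mulrC ler_pdivlMr.
have hn' : `|n|%:~R <= (1 + nm tau / y) * nm v.
  apply: le_trans hn _; rewrite mulrDl mul1r lerD2l.
  by rewrite (_ : nm tau / y * nm v = y^-1 * nm v * nm tau); [exact: ler_wpM2r|ring].
have hmK : `|m|%:~R <= K0 * nm v.
  by apply: le_trans hm' _; rewrite ler_wpM2r // /K0; lra.
have hnK : `|n|%:~R <= K0 * nm v.
  by apply: le_trans hn' _; rewrite ler_wpM2r // /K0; lra.
have h1 : 1 <= K0 * nm v.
  have [m0|m0] := eqVneq m 0.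
    apply: le_trans hnK; rewrite -nm_int nm_intr_ge1 //.
    by apply: contra p0 => /eqP n0; rewrite m0 n0.
  by apply: le_trans hmK; rewrite -nm_int nm_intr_ge1.
by rewrite -mulrA; split; lra.
Qed.

Lemma vec_neq0 p : p != (0, 0) -> vec tau p != 0.
Proof.
move=> p0; have [K K0 /(_ p p0) [h _]] := lat_lower; rewrite -nm_gt0.
have : 0 < K * nm (vec tau p) by apply: lt_le_trans h; rewrite ltr_wpDr ?ler0z.
by rewrite pmulr_rgt0.
Qed.

Definition ww (p : int * int) : C := w2 R p.1 * w2 R p.2.

Lemma summable_ww : summable ww.
Proof. by apply: summable_prod; exact: summable_w2. Qed.

Lemma nm_ww p : nm (ww p) = (1 + `|p.1|%:~R)^-1 * (1 + `|p.1|%:~R)^-1 * ((1 + `|p.2|%:~R)^-1 * (1 + `|p.2|%:~R)^-1).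
Proof. by rewrite nmM !nm_w2 -!exprVn !expr2. Qed.

Lemma one_int_gt0 (m : int) : 0 < 1 + `|m|%:~R :> R. Proof. by rewrite ltr_wpDr ?ler0z. Qed.

Lemma inv_le_K (K a b : R) : 0 < K -> 0 < a -> a <= K * b -> b^-1 <= K * a^-1.
Proof.
move=> K0 a0 h; have b0 : 0 < b by rewrite -(pmulr_rgt0 _ K0); apply: lt_le_trans h.
by rewrite ler_pdivlMr // mulrC ler_pdivrMr.
Qed.

(** Four factors of the modulus are traded for (1 + |m|)^2 (1 + |n|)^2, whose inverses form a
    summable product. *)
Lemma summable_vec k : summable (fun p => vec tau p ^- k.+4).
Proof.
have [K K0 hK] := lat_lower.
apply: (summable_leZ _ (c := K ^+ k.+4)) summable_ww => p.
have [->|p0] := eqVneq p (0, 0).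
  by rewrite /vec mul0r add0r expr0n invr0 nm0 mulr_ge0 ?exprn_ge0 ?nm_ge0 // ltW.
have [h1 h2] := hK p p0; rewrite nm_ww.
have a1 := one_int_gt0 p.1; have a2 := one_int_gt0 p.2.
have i1 := inv_le_K K0 a1 h1; have i2 := inv_le_K K0 a2 h2.
have i3 : (nm (vec tau p))^-1 <= K.
  apply: le_trans i1 _; rewrite ler_piMr ?(ltW K0) // invf_le1 // lerDl ler0z //.
have n0 : 0 <= (nm (vec tau p))^-1 by rewrite invr_ge0 nm_ge0.
rewrite nmV nmX -exprVn !exprS4.
rewrite (_ : K ^+ k * _ * _ = K ^+ k * ((K / (1 + `|p.1|%:~R)) * (K / (1 + `|p.1|%:~R)) * ((K / (1 + `|p.2|%:~R)) * (K / (1 + `|p.2|%:~R))))); last by ring.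
apply: ler_pM; rewrite ?exprn_ge0 ?mulr_ge0 //.
  by rewrite lerXn2r ?nnegrE // ltW.
by apply: ler_pM; rewrite ?mulr_ge0 //; apply: ler_pM.
Qed.

Definition GG (k : nat) (t : C) : C := tsum (fun p => vec t p ^- k).

Definition rotp (p : int * int) : int * int := (p.2, - p.1).
Definition rotq (p : int * int) : int * int := (- p.2, p.1).
Lemma rotpK : cancel rotp rotq. Proof. by case=> a b; rewrite /rotp /rotq /= opprK. Qed.
Lemma rotqK : cancel rotq rotp. Proof. by case=> a b; rewrite /rotp /rotq /= opprK. Qed.

Lemma vec_S p : vec (- tau^-1) p = vec tau (rotp p) / tau.
Proof.
rewrite /vec /= mulrDl mulfK ?tau_neq0 // rmorphN /= mulrN mulNr addrC //.
Qed.

(** Up to the factor 1/tau, the passage to -1/tau rotates the lattice, a bijection of the index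
    set. *)
Lemma GG_S k : GG k.+4 (- tau^-1) = tau ^+ k.+4 * GG k.+4 tau.
Proof.
rewrite /GG -tsumZ; last exact: summable_vec.
have sv := summableZ (tau ^+ k.+4) (summable_vec k).
rewrite -(tsum_bij rotpK rotqK sv).
by apply: eq_tsum => p; rewrite /= vec_S exprMn invfM exprVn invrK mulrC.
Qed.

Lemma row_pos j (m : nat) : ~~ odd j -> tsum (fun n : int => vec tau (m.+1%:Z, n) ^- j.+2) =
  T ^+ j.+2 * expc R j.+1 * powS j.+1 (ee tau ^+ m.+1).
Proof.
move=> ev_j; have im : 0 < complex.Im (m.+1%:Z%:~R * tau) by rewrite Im_intM mulr_gt0 // ltr0z.
have := lipschitz im j; rewrite -signr_odd (negPf ev_j) expr0 mul1r => <-.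
by congr (_ * _ * powS _ _); rewrite -eeMn -mulr_natl.
Qed.

Lemma row_neg j (m : nat) : ~~ odd j -> tsum (fun n : int => vec tau (Negz m, n) ^- j.+2) =
  tsum (fun n : int => vec tau (m.+1%:Z, n) ^- j.+2).
Proof.
move=> ev_j; have im : 0 < complex.Im (m.+1%:Z%:~R * tau) by rewrite Im_intM mulr_gt0 // ltr0z.
have sm : summable (fun n : int => vec tau (m.+1%:Z, n) ^- j.+2).
  have nz := nonint_H im.
  apply: (@summable_leZ _ _ ((complex.Im (m.+1%:Z%:~R * tau))^-1 ^+ j) _ _ _ (summable_inv2 nz nz)) => n.
  rewrite nmV nmX nmM nmV -exprVn !exprSr -mulrA ler_wpM2r ?mulr_ge0 ?invr_ge0 ?nm_ge0 //.
  rewrite lerXn2r ?nnegrE ?invr_ge0 ?nm_ge0 ?(ltW im) //.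
  by rewrite lef_pV2 ?posrE ?nm_gt0 ?nz // /vec /= Im_le_addint.
rewrite -(@tsum_bij _ _ _ (fun n : int => - n) (fun n : int => - n) _ (@opprK _) (@opprK _) sm).
apply: eq_tsum => n.
have -> : vec tau (Negz m, n) = - vec tau (m.+1%:Z, - n) by rewrite /vec NegzE !mulrNz mulNr opprD opprK.
by rewrite exprNn -signr_odd /= negbK (negPf ev_j) expr0 mul1r.
Qed.

Lemma row_zero j : tsum (fun n : int => vec tau (0, n) ^- j) = Zt R j.
Proof. by apply: eq_tsum => n; rewrite /vec /= mul0r add0r. Qed.

Definition eisS (j : nat) (q : C) : C := tsum (fun m : nat => powS j (q ^+ m.+1)).

(** The row 0 is a zeta value, the rows m and - m agree for even exponents, and each row m > 0 is
    given by [lipschitz]. Only the row sums are assumed summable, so that weight 2 is covered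
    too. *)
Lemma tsum_rows_even j (r : int -> C) : ~~ odd j -> summable r ->
  (forall m, r m = tsum (fun n : int => vec tau (m, n) ^- j.+2)) ->
  summable (fun m : nat => powS j.+1 (ee tau ^+ m.+1)) /\
  tsum r = Zt R j.+2 + 2%:R * (T ^+ j.+2 * expc R j.+1 * eisS j.+1 (ee tau)).
Proof.
move=> ev_j sr hr; pose c := T ^+ j.+2 * expc R j.+1.
have c0 : c != 0.
  by rewrite mulf_neq0 ?expf_neq0 ?twopii_neq0 // /expc invr_eq0 pnatr_eq0 -lt0n fact_gt0.
have rN m : r (Negz m) = c * powS j.+1 (ee tau ^+ m.+1) by rewrite hr row_neg // row_pos.
have rP m : r (Posz m.+1) = c * powS j.+1 (ee tau ^+ m.+1) by rewrite hr row_pos.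
have sN : summable (r \o Negz) by apply: summable_comp sr => a b [].
have sp : summable (fun m : nat => powS j.+1 (ee tau ^+ m.+1)).
  by apply: eq_summable (summableZ c^-1 sN) => m /=; rewrite rN mulKf.
split => //; rewrite tsum_int //.
have -> : tsum (r \o Negz) = c * eisS j.+1 (ee tau).
  by rewrite /eisS -tsumZ //; apply: eq_tsum => m /=; rewrite rN.
have sP : summable (r \o Posz) by apply: summable_comp sr => a b [].
have -> : tsum (r \o Posz) = Zt R j.+2 + c * eisS j.+1 (ee tau).
  rewrite (_ : r \o Posz = fun m => (if m is 0 then r 0 else 0) + mulX (fun m => c * powS j.+1 (ee tau ^+ m.+1)) m); last first.
    by apply: funext => -[|m] /=; rewrite ?addr0 ?add0r.
  have s0 : summable (fun m : nat => if m is 0 then r 0 else 0).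
    by apply: (@summable_finite _ _ (iotaF 1)) => -[|m]; rewrite in_iotaF.
  have s1 : summable (mulX (fun m => c * powS j.+1 (ee tau ^+ m.+1))).
    apply: (@summable_inj _ _ _ succn); first by move=> a b [].
      by move=> [|m]; rewrite /= ?eqxx // => _; exists m.
    exact: summableZ.
  rewrite tsumD // (@tsum_finite _ _ (iotaF 1)) => [|[|m]]; rewrite ?in_iotaF // sum_iotaF big_ord1.
  rewrite hr row_zero; congr (_ + _).
  rewrite -(@tsum_reindex_inj _ _ _ succn) //; last 2 first.
    by move=> a b [].
    by move=> [|m]; rewrite /= ?eqxx // => _; exists m.
  by rewrite /eisS -tsumZ.
rewrite -/c mulr2n mulrDl mul1r addrA //.
Qed.

Lemma GG_eis j : ~~ odd j -> GG j.+4 tau = Zt R j.+4 + 2%:R * (T ^+ j.+4 * expc R j.+3 * eisS j.+3 (ee tau)).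
Proof.
move=> ev_j; rewrite /GG (tsum_rows (summable_vec j)).
apply: (proj2 (@tsum_rows_even j.+2 _ _ _ _)) => //; first by rewrite /= negbK.
exact: (summable_rows (summable_vec j)).
Qed.

Lemma summable_eisS j : ~~ odd j -> summable (fun m : nat => powS j.+3 (ee tau ^+ m.+1)).
Proof.
move=> ev_j; apply: (proj1 (@tsum_rows_even j.+2 (fun m => tsum (fun n : int => vec tau (m, n) ^- j.+4)) _ _ _)) => //.
  by rewrite /= negbK.
exact: (summable_rows (summable_vec j)).
Qed.

End Fix.
End Lattice.

(** * Weight 2: the regularised lattice sum and its anomaly *)

Section E2alg.
Variable F : fieldType.

Lemma e2_diff (v w : F) : v != 0 -> v - w != 0 -> v + w != 0 ->
  v ^- 2 - ((v - w)^-1 * (v + w)^-1) = - w ^+ 2 * (v ^- 2 * ((v - w)^-1 * (v + w)^-1)).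
Proof. by move=> v0 a0 b0; field; rewrite v0 a0 b0. Qed.

Lemma cK_add (t x : F) : x - 1 != 0 -> t / (x - 1) + t = t * x / (x - 1).
Proof. by move=> h; field. Qed.

Lemma e2_scale (v t h : F) : t != 0 ->
  (v / t) ^- 2 - ((v / t - h)^-1 * (v / t + h)^-1) = t ^+ 2 * (v ^- 2 - ((v - t * h)^-1 * (v + t * h)^-1)).
Proof.
move=> t0; have -> : v / t - h = (v - t * h) / t by rewrite mulrBl mulrAC mulfV // mul1r.
have -> : v / t + h = (v + t * h) / t by rewrite mulrDl mulrAC mulfV // mul1r.
have -> : (v / t) ^- 2 = v ^- 2 * t ^+ 2 by rewrite exprMn invfM exprVn invrK.
rewrite !invfM !invrK; ring.
Qed.

End E2alg.

Section E2law.
Variable R : realType.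
Local Notation C := R[i].
Local Notation T := (twopii R).

Definition hf : C := 2%:R^-1.

(** Inverse squares of lattice vectors are not absolutely summable. Subtracting 1/((v - 1/2)(v +
    1/2)) makes the term O(|v|^-4), and the subtracted terms sum to 0 along each row ([e2fam_row]),
    so the row sums are the original ones. *)
Definition e2fam (tau : C) (p : int * int) : C :=
  vec tau p ^- 2 - ((vec tau p - hf)^-1 * (vec tau p + hf)^-1).

Section Fix.
Variable tau : C.
Hypothesis ht : 0 < complex.Im tau.

Lemma two_neq0 : (2%:R : C) != 0. Proof. by rewrite pnatr_eq0. Qed.

Lemma hf2 : hf + hf = 1.
Proof. by rewrite /hf -mulr2n -[X in X *+ 2]mul1r -mulrnAl mulfV // two_neq0. Qed.

(** The shifted vector is half of the lattice vector with coordinates (2m, 2n + s), which is nonzero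
    because 2n + s is odd. *)
Lemma vec_half_lower : exists2 K : R, 0 < K & forall (s : int) p, `|s| = 1 ->
  1 + `|p.1|%:~R <= K * nm (vec tau p + s%:~R * hf) /\ 1 + `|p.2|%:~R <= K * nm (vec tau p + s%:~R * hf).
Proof.
have [K K0 hK] := lat_lower ht; exists (K * 2); first by rewrite mulr_gt0.
move=> s [m n] s1 /=.
have E : vec tau (m, n) + s%:~R * hf = vec tau (2 * m, 2 * n + s) / 2%:R.
  rewrite -/hf /vec /= intrD !intrM -[2%:~R]/(1 + 1 : C).
  transitivity ((m%:~R * tau + n%:~R) * (hf + hf) + s%:~R * hf); last by ring.
  by rewrite hf2 mulr1.
have nz : (2 * m, 2 * n + s) != (0, 0) by apply/eqP => -[_ h]; clear -h s1; lia.
have [h1 h2] := hK _ nz; rewrite E nmM nmV nm_nat -mulrA [2 * (_ / 2)]mulrC divfK ?pnatr_eq0 //.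
split; [apply: le_trans h1|apply: le_trans h2]; rewrite /= lerD2l ler_int; clear -s1; lia.
Qed.

Lemma hfE : hf = 1%:~R * hf. Proof. by rewrite mul1r. Qed.
Lemma hfNE : - hf = (-1)%:~R * hf. Proof. by rewrite mulN1r. Qed.

Lemma vec_half_neq0 p : vec tau p - hf != 0 /\ vec tau p + hf != 0.
Proof.
have [K K0 hK] := vec_half_lower.
have P (s : int) : `|s| = 1 -> vec tau p + s%:~R * hf != 0.
  move=> s1; have [h _] := hK s p s1; rewrite -nm_gt0 -(pmulr_rgt0 _ K0).
  by apply: lt_le_trans h; exact: one_int_gt0.
by rewrite hfNE {2}hfE; split; apply: P.
Qed.

Lemma summable_half : summable (fun p => (vec tau p - hf)^-1 * (vec tau p + hf)^-1 * vec tau p ^- 2).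
Proof.
have [K K0 hK] := vec_half_lower; have [L L0 hL] := lat_lower ht.
apply: (summable_leZ _ (c := K * K * (L * L))) (@summable_ww R) => p.
have [->|p0] := eqVneq p (0, 0).
  have -> : vec tau (0, 0) ^- 2 = 0 by rewrite /vec mul0r add0r expr0n invr0.
  by rewrite mulr0 nm0 !mulr_ge0 ?nm_ge0 // ltW.
have [h1 h2] := hL p p0.
have [h3 _] := hK (-1) p (normrN1 _); have [_ h4] := hK 1 p (normr1 _).
have a1 := one_int_gt0 R p.1; have a2 := one_int_gt0 R p.2.
rewrite -hfNE in h3; rewrite -hfE in h4.
have i1 := inv_le_K L0 a1 h1; have i2 := inv_le_K L0 a2 h2.
have i3 := inv_le_K K0 a1 h3; have i4 := inv_le_K K0 a2 h4.
rewrite nm_ww !nmM !nmV nmX -exprVn expr2.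
rewrite (_ : K * K * (L * L) * _ = ((K / (1 + `|p.1|%:~R)) * (K / (1 + `|p.2|%:~R))) * ((L / (1 + `|p.1|%:~R)) * (L / (1 + `|p.2|%:~R)))); last by ring.
by apply: ler_pM; rewrite ?mulr_ge0 ?invr_ge0 ?nm_ge0 //; apply: ler_pM; rewrite ?invr_ge0 ?nm_ge0.
Qed.

Lemma summable_e2fam : summable (e2fam tau).
Proof.
pose g (p : int * int) : C := if p == (0, 0) then e2fam tau (0, 0) else 0.
have sg : summable g by apply: (@summable_finite _ _ [fset (0, 0)]%fset) => p; rewrite inE /g => /negPf ->.
have s1 := summableD sg (summableZ (- hf ^+ 2) summable_half).
apply: eq_summable s1 => p; rewrite /g; have [->|p0] := eqVneq p (0, 0).
  have -> : vec tau (0, 0) ^- 2 = 0 by rewrite /vec mul0r add0r expr0n invr0.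
  by rewrite !mulr0 addr0.
have [a1 a2] := vec_half_neq0 p; have v0 := vec_neq0 ht p0.
by rewrite add0r /e2fam e2_diff // (mulrC (vec tau p ^- 2)).
Qed.

Definition E2r (m : int) : C := tsum (fun n : int => vec tau (m, n) ^- 2).

Lemma nonint_half (m : int) (s : int) : `|s| = 1 -> nonint (m%:~R * tau + s%:~R * hf).
Proof.
move=> s1 n; have [K K0 /(_ s (m, n) s1) [h _]] := vec_half_lower.
rewrite (_ : _ + _ = vec tau (m, n) + s%:~R * hf); last by rewrite /vec /=; ring.
rewrite -nm_gt0 -(pmulr_rgt0 _ K0); apply: lt_le_trans h; exact: one_int_gt0.
Qed.

Lemma summable_row2 (m : int) : summable (fun n : int => vec tau (m, n) ^- 2).
Proof.
have [m0|m0] := eqVneq m 0.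
  by apply: eq_summable (summable_Zt R 0) => n; rewrite /vec m0 mul0r add0r.
have nz : nonint (m%:~R * tau).
  by apply: nonint_Im; rewrite Im_intM mulf_neq0 ?intr_eq0 // gt_eqF.
apply: eq_summable (summable_inv2 nz nz) => n.
by rewrite /vec /= expr2 invfM.
Qed.

(** By [cK_diff] the subtracted terms of a row add up to cK (z - 1/2) - cK (z + 1/2) with z = m tau,
    which is 0 by periodicity. *)
Lemma e2fam_row (m : int) : tsum (fun n : int => e2fam tau (m, n)) = E2r m.
Proof.
have n1 := nonint_half m (normrN1 int); have n2 := nonint_half m (normr1 int).
rewrite -hfNE in n1; rewrite -hfE in n2.
have s2 := summable_inv2 n1 n2.
have s2' : summable (fun n : int => (vec tau (m, n) - hf)^-1 * (vec tau (m, n) + hf)^-1).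
  by apply: eq_summable s2 => n; rewrite /vec /=; congr (_^-1 * _^-1); ring.
rewrite /e2fam tsumB //; last exact: summable_row2.
rewrite -[RHS]subr0; congr (_ - _).
have hh := hf2.
have := cK_diff n1 n2.
have -> : m%:~R * tau + hf - (m%:~R * tau - hf) = 1 by rewrite -hh; ring.
rewrite tsumZ // mul1r => h.
have -> : tsum (fun n : int => (vec tau (m, n) - hf)^-1 * (vec tau (m, n) + hf)^-1) =
   tsum (fun j : int => (m%:~R * tau - hf + j%:~R)^-1 * (m%:~R * tau + hf + j%:~R)^-1).
  by apply: eq_tsum => n; rewrite /vec /=; congr (_^-1 * _^-1); ring.
rewrite h /cK.
have -> : m%:~R * tau + hf = m%:~R * tau - hf + 1%:~R by rewrite -[1%:~R]/(1 : C) -hh; ring.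
by rewrite eeDint subrr.
Qed.

Definition G2 : C := tsum (e2fam tau).

Lemma G2_eis : summable (fun m : nat => powS 1 (ee tau ^+ m.+1)) /\
  G2 = Zt R 2 + 2%:R * (T ^+ 2 * expc R 1 * eisS 1 (ee tau)).
Proof.
have sr := summable_rows summable_e2fam.
have E m : tsum (fun n : int => e2fam tau (m, n)) = tsum (fun n : int => vec tau (m, n) ^- 2) by exact: e2fam_row.
have [h1 h2] := @tsum_rows_even R tau ht 0 _ isT sr E.
by split => //; rewrite /G2 (tsum_rows summable_e2fam).
Qed.

(** What [e2fam] becomes under tau -> -1/tau, up to tau^2 and a rotation of the indices: the
    regularising shift is tau/2 instead of 1/2. *)
Definition e2fam' (p : int * int) : C := vec tau p ^- 2 - ((vec tau p - tau * hf)^-1 * (vec tau p + tau * hf)^-1).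

Lemma e2fam_S p : e2fam (- tau^-1) p = tau ^+ 2 * e2fam' (rotp p).
Proof. by rewrite /e2fam vec_S // e2_scale // tau_neq0. Qed.

End Fix.

Section Diff.
Variable tau : C.
Hypothesis ht : 0 < complex.Im tau.

Lemma Im_invN : 0 < complex.Im (- tau^-1).
Proof.
have := tau_neq0 ht; move: ht; case: tau => a b /= b0 t0.
rewrite opprK divr_gt0 // lt_def addr_ge0 ?sqr_ge0 // andbT.
rewrite paddr_eq0 ?sqr_ge0 // !expf_eq0 /= negb_and [b == 0]gt_eqF //= orbT //.
Qed.

Let t0 := tau_neq0 ht.

Lemma summable_e2fam' : summable (e2fam' tau).
Proof.
have s := summable_e2fam Im_invN.
have s' : summable (e2fam' tau \o rotp).
  apply: eq_summable (summableZ (tau ^- 2) s) => p.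
  by rewrite e2fam_S //= mulKf // expf_neq0.
apply: (summable_inj (can_inj rotpK) _ s') => p _; by exists (rotq p); rewrite rotqK.
Qed.

Lemma G2_S : G2 (- tau^-1) = tau ^+ 2 * tsum (e2fam' tau).
Proof.
rewrite /G2 -(tsum_bij rotpK rotqK summable_e2fam') -tsumZ; last first.
  by apply: summable_comp summable_e2fam'; exact: can_inj rotpK.
by apply: eq_tsum => p; exact: e2fam_S.
Qed.

Definition u2 (m : int) : C := cK (m%:~R * tau - tau * hf).

Lemma nonint_tauhalf (m s : int) : `|s| = 1 -> nonint (m%:~R * tau + s%:~R * (tau * hf)).
Proof.
move=> s1; apply: nonint_Im.
have -> : m%:~R * tau + s%:~R * (tau * hf) = (2 * m + s)%:~R * (tau * hf).
  have hh := hf2.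
  rewrite intrD intrM mulrDl; congr (_ + _).
  by transitivity (m%:~R * tau * (hf + hf)); [rewrite hh mulr1|rewrite (_ : 2%:~R = 1 + 1 :> C) //; ring].
rewrite Im_intM mulf_neq0 //; first by rewrite intr_eq0; clear -s1; lia.
by rewrite /hf Im_divnat mulf_neq0 ?invr_eq0 ?pnatr_eq0 // gt_eqF.
Qed.

(** In the difference the inverse squares contribute the same row sum and cancel. What is left is
    the partial fraction sum with shifts tau/2, a difference of consecutive values of [u2]. *)
Lemma diff_row (m : int) : tsum (fun n : int => e2fam tau (m, n) - e2fam' tau (m, n)) =
  tau^-1 * (u2 m - u2 (m + 1)).
Proof.
have s1 := summable_row (summable_e2fam ht) m; have s2 := summable_row summable_e2fam' m.
rewrite tsumB // e2fam_row //.
have n1 := nonint_tauhalf m (normrN1 int); have n2 := nonint_tauhalf m (normr1 int).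
rewrite mulN1r in n1; rewrite mul1r in n2.
have s3 := summable_inv2 n1 n2.
have s3' : summable (fun n : int => (vec tau (m, n) - tau * hf)^-1 * (vec tau (m, n) + tau * hf)^-1).
  by apply: eq_summable s3 => n; rewrite /vec /=; congr (_^-1 * _^-1); ring.
rewrite {1}/e2fam' tsumB //; last exact: summable_row2.
rewrite opprB addrCA -/(E2r tau m) subrr addr0.
have hh := hf2.
have := cK_diff n1 n2.
have -> : m%:~R * tau + tau * hf - (m%:~R * tau - tau * hf) = tau by rewrite -[RHS]mulr1 -hh; ring.
rewrite tsumZ // => h; apply: (mulfI t0); rewrite mulrA mulfV // mul1r.
rewrite /u2 (_ : (m + 1)%:~R * tau - tau * hf = m%:~R * tau + tau * hf); last first.
  by rewrite rmorphD /= mulrDl mul1r -{2}[tau]mulr1 -hh; ring.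
rewrite -h; congr (_ * _).
by apply: eq_tsum => n; rewrite /vec /=; congr (_^-1 * _^-1); ring.
Qed.

Lemma has_sum_sym (f : int -> C) s : has_sum f s -> cvgs (fun h => \sum_(j <- symS h) f j) s.
Proof.
move=> hs e e0; have [F0 hF] := hs e e0.
exists (\max_(j <- F0) absz j)%N => h hh; apply: hF; apply/fsubsetP => j jF.
rewrite in_symS; have : (absz j <= h)%N.
  by apply: leq_trans hh; exact: (@leq_bigmax_seq _ (enum_fset F0) xpredT absz j).
by clear; lia.
Qed.

Lemma telescope_sym (u : int -> C) h : \sum_(j <- symS h) (u j - u (j + 1)) = u (- h%:Z) - u (h%:Z + 1).
Proof.
rewrite sum_symS.
have tel n (v : int) : \sum_(i < n) (u (i%:Z + v) - u (i%:Z + v + 1)) = u v - u (n%:Z + v).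
  elim: n => [|n IH]; first by rewrite big_ord0 add0r subrr.
  rewrite big_ord_recr /= IH; have -> : n%:Z + v + 1 = n.+1%:Z + v by rewrite -addn1 PoszD; ring.
  by ring.
rewrite tel; congr (_ - u _); rewrite -addn1 -mul2n PoszD PoszM; ring.
Qed.

(** [cK] tends to - T where [ee] is small, and to 0 where [ee] is large ([nm_cK_bound2]). The two
    ends of the telescoping sum in [E2_quasi] converge to these different limits. *)
Lemma nm_cK_bound (z : C) : nm (ee z) <= 2^-1 -> nm (cK z + T) <= nm T * 2 * nm (ee z).
Proof.
move=> hx; have h2 : 2^-1 <= nm (ee z - 1).
  by have := nm_dist_le 1 (ee z); rewrite nm1 nmB; lra.
have e1 : ee z - 1 != 0 by rewrite -nm_gt0; apply: lt_le_trans h2; rewrite invr_gt0.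
rewrite /cK cK_add //.
rewrite !nmM nmV -!mulrA ler_wpM2l ?nm_ge0 // mulrC ler_wpM2r ?nm_ge0 //.
by rewrite -[leRHS]invrK lef_pV2 ?posrE ?invr_gt0 //; apply: lt_le_trans h2; rewrite invr_gt0.
Qed.

Lemma nm_cK_bound2 (z : C) : 2 <= nm (ee z) -> nm (cK z) <= nm T * 2 * (nm (ee z))^-1.
Proof.
move=> hx; have h2 : nm (ee z) / 2 <= nm (ee z - 1).
  by have := nm_dist_le (ee z) 1; rewrite nm1; lra.
have p : 0 < nm (ee z) by lra.
rewrite /cK nmM nmV -mulrA ler_wpM2l ?nm_ge0 //.
rewrite (_ : 2 * _ = (nm (ee z) / 2)^-1); last by rewrite invfM invrK mulrC.
by rewrite lef_pV2 ?posrE ?divr_gt0 //; apply: lt_le_trans h2; rewrite divr_gt0.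
Qed.

Lemma Im_u2 (m : int) : complex.Im (m%:~R * tau - tau * hf) = (m%:~R - 2^-1) * complex.Im tau.
Proof. by rewrite raddfB /= Im_intM /hf Im_divnat; ring. Qed.

Let y := complex.Im tau.
Let q0 := expR (- (pi *+ 2 * y)).
Let q0lt1 : 0 <= q0 < 1.
Proof.
rewrite expR_ge0 -(expR0 R) ltr_expR oppr_lt0 mulr_gt0 //.
by rewrite pmulrn_lgt0 // pi_gt0.
Qed.

Lemma nm_ee_u2 (h : nat) : nm (ee ((h%:Z + 1)%:~R * tau - tau * hf)) <= q0 ^+ h /\
   q0 ^- h <= nm (ee ((- h%:Z)%:~R * tau - tau * hf)).
Proof.
have p2 : 0 <= pi *+ 2 :> R by rewrite mulrn_wge0 // pi_ge0.
have y0 : 0 <= y by exact: ltW.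
have py : 0 <= pi *+ 2 * y by rewrite mulr_ge0.
rewrite !nm_ee !Im_u2 -/y /q0 -expRM_natl -expRN !ler_expR; split.
  rewrite mulrN lerN2 rmorphD /=; have -> : (h%:~R + 1 - 2^-1 : R) = h%:R + 2^-1 by rewrite -pmulrn; lra.
  rewrite mulrCA ler_wpM2l //; have : 0 <= (h%:R : R) by []; move: (h%:R : R) => a; nra.
rewrite mulrN opprK rmorphN /= -pmulrn -opprD mulNr mulrN opprK mulrCA ler_wpM2l //.
have : 0 <= (h%:R : R) by []; move: (h%:R : R) => a; nra.
Qed.

(** The difference of the two regularised sums telescopes over the rows -h, ..., h to (u2 (- h) - u2
    (h + 1))/tau. The first value tends to 0 and the second to - T, which leaves T/tau. *)
Lemma E2_quasi : G2 tau - tau ^- 2 * G2 (- tau^-1) = T / tau.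
Proof.
rewrite G2_S mulrA mulVf ?mul1r ?expf_neq0 // /G2.
have s1 := summable_e2fam ht; have s2 := summable_e2fam'.
rewrite -tsumB // (tsum_rows (summableB s1 s2)) (eq_tsum diff_row).
have sr := summable_rows (summableB s1 s2).
have sr' : summable (fun m => tau^-1 * (u2 m - u2 (m + 1))).
  by apply: eq_summable sr => m; rewrite diff_row.
have h1 := has_sum_sym (tsumP sr').
have h2 : cvgs (fun h => \sum_(j <- symS h) (tau^-1 * (u2 j - u2 (j + 1)))) (tau^-1 * (0 - - T)).
  have -> : (fun h => \sum_(j <- symS h) (tau^-1 * (u2 j - u2 (j + 1)))) =
     (fun h => tau^-1 * (u2 (- h%:Z) + -1 * u2 (h%:Z + 1))).
    by apply: funext => h; rewrite -mulr_sumr telescope_sym mulN1r.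
  apply: cvgsM; first exact: cvgs_cst.
  rewrite -[- - T]mulN1r.
  have small e : 0 < e -> exists N0, forall h, (N0 <= h)%N -> q0 ^+ h <= 2^-1 /\ nm T * 2 * q0 ^+ h <= e.
    move=> e0; have t0' : 0 < nm T * 2 by rewrite mulr_gt0 // nm_gt0 twopii_neq0.
    have i2 : 0 < 2^-1 :> R by rewrite invr_gt0.
    have [N1 H1] := expr_small q0lt1 i2; have [N2 H2] := expr_small q0lt1 (divr_gt0 e0 t0').
    exists (maxn N1 N2) => h; rewrite geq_max => /andP[/H1 a /H2 b]; split => //.
    by rewrite mulrC -ler_pdivlMr.
  apply: cvgsD.
    move=> e /small [N0 hN]; exists N0 => h /hN [a b]; have [_ c] := nm_ee_u2 h.
    have qp : 0 < q0 ^+ h by rewrite exprn_gt0 // expR_gt0.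
    rewrite subr0; apply: le_trans (nm_cK_bound2 _) _.
      by apply: le_trans c; rewrite -[leLHS]invrK lef_pV2 ?posrE ?invr_gt0.
    apply: le_trans b; rewrite ler_wpM2l ?mulr_ge0 ?nm_ge0 //.
    by rewrite -[leRHS]invrK lef_pV2 ?posrE ?invr_gt0 //; apply: lt_le_trans c; rewrite invr_gt0.
  apply: cvgsM; first exact: cvgs_cst.
  move=> e /small [N0 hN]; exists N0 => h /hN [a b]; have [c _] := nm_ee_u2 h.
  rewrite opprK; apply: le_trans (nm_cK_bound (le_trans c a)) _.
  by apply: le_trans b; rewrite ler_wpM2l ?mulr_ge0 ?nm_ge0.
by rewrite (cvgs_uniq h1 h2) sub0r opprK mulrC.
Qed.

End Diff.
End E2law.

(** * Cauchy's estimate *)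

Section Cauchy.
Variable R : realType.
Local Notation C := R[i].

Lemma tail_bound rho (c : nat -> C) (r e : R) n0 : conv rho c -> 0 <= r -> r < rho -> 0 < e ->
  exists2 K : nat, (n0 <= K)%N & forall x, nm x <= r -> nm (ev c x - \sum_(i < K) c i * x ^+ i) <= e.
Proof.
move=> hc r0 hr e0.
have nr : nm (r%:C : C) = r by rewrite nm_real ger0_norm.
have sr : summable (fun i : nat => c i * r%:C ^+ i) by apply: conv_summable hc _; rewrite nr.
have [K' hK'] := tail_small sr e0; pose K := maxn K' n0.
have hK (F : {fset nat}) : (forall i, i \in F -> (K <= i)%N) -> \sum_(i <- F) nm (c i * r%:C ^+ i) <= e.
  by move=> h; apply: hK' => i /h; apply: leq_trans; exact: leq_maxl.
exists K => [|x hx]; first exact: leq_maxr.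
have hx' : nm x < rho by apply: le_lt_trans hr.
have rho0 : 0 < rho by apply: le_lt_trans hr.
rewrite (ev_shift K hc hx') addrAC subrr add0r /ev -tsumZ; last first.
  by apply: conv_summable hx'; exact: conv_shift.
apply: nm_tsum_le => [|n].
  by apply: summableZ; apply: conv_summable hx'; exact: conv_shift.
pose F := [fset (K + i)%N | i in iotaF n]%fset.
apply: le_trans (_ : \sum_(i <- F) nm (c i * r%:C ^+ i) <= e); last first.
  by apply: hK => i /imfsetP[j _ ->]; exact: leq_addr.
rewrite sum_imfset; last by move=> a b /addnI.
rewrite sum_iotaF; apply: ler_sum => i _; rewrite /shift mulrCA -exprD !nmM !nmX nr.
by rewrite ler_wpM2l ?nm_ge0 // lerXn2r ?nnegrE ?nm_ge0.
Qed.

Lemma ee_frac (N j k : nat) : ee ((j%:R / N%:R : R)%:C) ^+ k = (ee (N%:R^-1 : C) ^+ j) ^+ k.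
Proof.
congr (_ ^+ _); rewrite -eeMn -[X in _ = ee X]mulr_natl; congr ee.
by rewrite rmorphM fmorphV !rmorph_nat.
Qed.

(** Orthogonality of the N-th roots of unity isolates the coefficient n; the exponent N - n plays
    the part of - n. *)
Lemma poly_average (K n N : nat) (c : nat -> C) (r : C) : (n < K)%N -> (K <= N)%N ->
  \sum_(j < N) (\sum_(i < K) c i * (r * ee (N%:R^-1 : C) ^+ j) ^+ i) * (ee (N%:R^-1 : C) ^+ j) ^+ (N - n) =
  N%:R * (c n * r ^+ n).
Proof.
move=> nK KN; have N0 : (0 < N)%N by apply: leq_trans KN; apply: leq_ltn_trans nK.
set z := ee (N%:R^-1 : C); have zN : z ^+ N = 1 by exact: ee_invXn.
under eq_bigr do rewrite mulr_suml; rewrite exchange_big /=.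
rewrite (bigD1 (Ordinal nK)) //= [X in _ + X]big1 ?addr0.
  rewrite (eq_bigr (fun _ => c n * r ^+ n)) ?sumr_const ?card_ord ?mulr_natl // => j _.
  by rewrite exprMn -!mulrA -exprD subnKC ?(ltnW (leq_trans nK KN)) // exprAC zN expr1n mulr1.
move=> i; rewrite -val_eqE /= => ni.
have iN : (i < N)%N := leq_trans (ltn_ord i) KN.
have nN : (n < N)%N := leq_trans nK KN.
rewrite (eq_bigr (fun j : 'I_N => c i * r ^+ i * (z ^+ j) ^+ (i + (N - n)))); last first.
  by move=> j _; rewrite exprMn exprD !mulrA.
rewrite -mulr_sumr; case: (ltngtP i n) ni => // h _.
  by rewrite root_sum ?mulr0 //; apply/andP; split; lia.
rewrite (eq_bigr (fun j : 'I_N => (z ^+ j) ^+ (i - n))); last first.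
  move=> j _; rewrite (_ : (i + (N - n) = (i - n) + N)%N); last by lia.
  by rewrite exprD [X in _ * X]exprAC zN expr1n mulr1.
by rewrite root_sum ?mulr0 //; apply/andP; split; lia.
Qed.

(** An average over N-th roots of unity replaces the contour integral. It is applied to the
    truncation of the series at degree N, which is uniformly close to the series on the disc of
    radius [r]. *)
Lemma cauchy_bound rho (c : nat -> C) (r M : R) : conv rho c -> 0 <= r -> r < rho ->
  (forall t : R, nm (ev c (r%:C * ee t%:C)) <= M) -> forall n, nm (c n) * r ^+ n <= M.
Proof.
move=> hc r0 hr hM n; apply/ler_addgt0Pr => e e0.
have [N nN hN] := tail_bound n.+1 hc r0 hr e0.
have nr : nm (r%:C : C) = r by rewrite nm_real ger0_norm.
pose z (j : nat) := ee (N%:R^-1 : C) ^+ j.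
have zE j : z j = ee ((j%:R / N%:R : R)%:C) by have := ee_frac N j 1; rewrite !expr1.
have nz j : nm (z j) = 1 by rewrite zE nm_ee /= mulr0 oppr0 expR0.
have N0 : 0 < N%:R :> R by rewrite ltr0n; apply: leq_trans nN.
have E := poly_average c r%:C nN (leqnn N).
have : nm (N%:R * (c n * r%:C ^+ n)) <= N%:R * (M + e).
  rewrite -E; apply: le_trans (nm_sum _ _ _) _.
  rewrite (_ : N%:R * (M + e) = \sum_(j < N) (M + e)); last by rewrite sumr_const card_ord mulr_natl.
  apply: ler_sum => j _; rewrite nmM nmX nz expr1n mulr1.
  have hx : nm (r%:C * z j) <= r by rewrite nmM nr nz mulr1.
  have := hN _ hx; have := hM (j%:R / N%:R); rewrite -zE => h1 h2.
  have := nm_distD (ev c (r%:C * z j)) (\sum_(i < N) c i * (r%:C * z j) ^+ i) 0.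
  by rewrite !subr0 nmB; lra.
rewrite nmM nm_nat ler_pM2l // nmM nmX nr //.
Qed.

End Cauchy.

(** * Modular functions of weight 0 *)

Section Weight0.
Variable R : realType.
Local Notation C := R[i].

Definition upper (t : C) := 0 < complex.Im t.

Lemma upper_S t : upper t -> upper (- t^-1). Proof. exact: Im_invN. Qed.
Lemma upper_T t (j : int) : upper t -> upper (t + j%:~R). Proof. by rewrite /upper Im_addint. Qed.

(** Slightly below sqrt(3)/2, the lowest height of the fundamental domain: in the strip |Re t| <=
    1/2 a height below [y0] gives |t|^2 <= 1/4 + y0^2 < 39/40. *)
Definition y0 : R := 17 / 20.

Lemma Im_S (t : C) : complex.Im (- t^-1) = complex.Im t / nm t ^+ 2.
Proof. by rewrite nm_sq; case: t => a b /=; rewrite opprK. Qed.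

(* Each inversion of a translate in the strip with small height multiplies the height by more than 40/39. *)
Lemma reduction (Q : C -> Prop) : (forall t, y0 <= complex.Im t -> Q t) ->
  (forall t (j : int), upper t -> Q (t + j%:~R) -> Q t) ->
  (forall t, upper t -> Q (- t^-1) -> Q t) -> forall t, upper t -> Q t.
Proof.
move=> hF hT hS.
suff H n : forall t, upper t -> y0 <= complex.Im t * (40/39) ^+ n -> Q t.
  move=> t ut; have [n hn] : exists n : nat, y0 <= complex.Im t * (40/39) ^+ n; last exact: H hn.
  have k0 : 0 <= (39/40 : R) < 1 by apply/andP; split; lra.
  have d0 : 0 < complex.Im t / y0 by rewrite divr_gt0 // /y0; lra.
  have [n hn] := expr_small k0 d0; exists n.
  have := hn n (leqnn n); rewrite ler_pdivlMr; last by rewrite /y0; lra.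
  rewrite (_ : 39/40 = (40/39)^-1 :> R); last by rewrite invf_div.
  by rewrite exprVn mulrC ler_pdivrMr ?exprn_gt0 //; lra.
elim: n => [|n IH] t ut; first by rewrite expr0 mulr1; exact: hF.
move=> hn; case: (lerP y0 (complex.Im t)) => [|ylt]; first exact: hF.
pose j := Num.floor (complex.Re t + 1/2).
apply: (hT t (- j)) => //; set s := t + (- j)%:~R.
have us : upper s by exact: upper_T.
have Is : complex.Im s = complex.Im t by rewrite Im_addint.
have h1 : j%:~R <= complex.Re t + 1/2 by exact: floor_le.
have h2 : complex.Re t + 1/2 < (j + 1)%:~R by exact: floorD1_gt.
have Rs : complex.Re s = complex.Re t - j%:~R by rewrite Re_addint mulrNz.
have Rb : complex.Re s ^+ 2 <= 1/4.
  move: h2; rewrite intrD Rs => h2; move: h1 h2; move: (complex.Re t) (j%:~R : R) => a b h1 h2.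
  rewrite -[1%:~R]/(1 : R) in h2; nra.
have ns : nm s ^+ 2 <= 39/40.
  rewrite nm_sq Is; have : complex.Im t ^+ 2 <= y0 ^+ 2.
    by rewrite lerXn2r ?nnegrE ?(ltW ylt) ?(ltW ut) // /y0; lra.
  by rewrite /y0; lra.
apply: hS => //; apply: IH; first exact: upper_S.
have np : 0 < nm s ^+ 2 by rewrite exprn_gt0 // nm_gt0 (tau_neq0 us).
have p40 : 0 <= (40/39 : R) ^+ n by rewrite exprn_ge0 //; lra.
rewrite Im_S Is; apply: le_trans hn _; rewrite exprS mulrA ler_wpM2r //.
rewrite ler_wpM2l ?(ltW ut) // -[leLHS]invrK lef_pV2 ?posrE ?invr_gt0 ?invf_div //; lra.
Qed.

(** The value of |q| at height 21/25, just below [y0]. At height [y0] it is [q1 * kap], and this gap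
    gives the contraction in [weight0_halve]. *)
Definition q1 : R := expR (- (pi *+ 2 * (21 / 25))).
Definition kap : R := expR (- (pi *+ 2 / 100)).

Lemma expR_partial3 (x : R) : 0 <= x -> 1 + x + x * x / 2 <= expR x.
Proof.
move=> x0; apply: le_trans (exp_partial (iotaF 3) x0).
rewrite sum_iotaF !big_ord_recl big_ord0 /= /bump /= !add1n expr0 !fact0 expr1 expr2.
by rewrite (_ : 1`! = 1%N) // (_ : 2`! = 2%N) // addr0 !divr1 addrA.
Qed.

(** Three terms of the series give exp(63/125) >= 163/100; the tenth power then exceeds 130. The
    threshold 126/25 is 6 * 21/25, a lower bound for 2 pi * 21/25. *)
Lemma exp_neg_small (x : R) : 126/25 <= x -> expR (- x) <= 1/130.
Proof.
move=> hx; have E : 130 <= expR x.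
  have h : expR (63/125) ^+ 10 <= expR x.
    by rewrite -expRM_natl ler_expR; apply: le_trans hx; lra.
  apply: le_trans h; have p0 : 0 <= (63/125 : R) by lra.
  move: (expR_partial3 p0) (@expR_ge0 R (63/125)).
  move: (expR (63/125)) => a a1 a0; have {}a1 : 163/100 <= a by lra.
  have a2 : 53/20 <= a ^+ 2 by rewrite expr2; nra.
  have a4 : 351/50 <= a ^+ 4 by rewrite (exprD a 2 2); move: (a ^+ 2) a2 => b b2; nra.
  have a8 : 246/5 <= a ^+ 8 by rewrite (exprD a 4 4); move: (a ^+ 4) a4 => b b2; nra.
  rewrite (exprD a 8 2); move: (a ^+ 2) (a ^+ 8) a2 a8 => b d b2 d2; nra.
rewrite expRN -[leRHS]invrK lef_pV2 ?posrE ?expR_gt0 ?invr_gt0 ?invf_div //; lra.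
Qed.

Lemma q1_small : 0 <= q1 /\ q1 < 1/120.
Proof.
rewrite expR_ge0; split => //; apply: le_lt_trans (exp_neg_small _) _; last by lra.
by have := pi_ge3 R; rewrite mulr2n; lra.
Qed.

Lemma kap_lt1 : 0 <= kap < 1.
Proof. by rewrite expR_ge0 -(expR0 R) ltr_expR; have := pi_ge3 R; rewrite mulr2n; lra. Qed.

Lemma nm_ee_F (t : C) : y0 <= complex.Im t -> nm (ee t) <= q1 * kap.
Proof.
move=> ht; rewrite nm_ee /q1 /kap -expRD ler_expR.
have p2 : 0 <= pi *+ 2 :> R by rewrite mulrn_wge0 // pi_ge0.
have := ler_wpM2l p2 ht; rewrite /y0; lra.
Qed.

(** A Schwarz lemma. The bound B on the circle |q| = q1 gives Cauchy bounds for the coefficients.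
    Since the expansion starts at q^p, on the smaller disc |q| <= q1 * kap the sum is at most B
    kap^p/(1 - kap), hence at most B/2. Translations and inversions carry this to the whole half
    plane. *)
Lemma weight0_halve (g : C -> C) (c : nat -> C) (p : nat) (B : R) :
  (forall t (j : int), upper t -> g (t + j%:~R) = g t) -> (forall t, upper t -> g (- t^-1) = g t) ->
  conv (1/120) c -> (forall i, (i < p)%N -> c i = 0) ->
  (forall t, upper t -> nm (ee t) < 1/120 -> g t = ev c (ee t)) ->
  kap ^+ p / (1 - kap) <= 1/2 ->
  (forall t, upper t -> nm (g t) <= B) -> forall t, upper t -> nm (g t) <= B / 2.
Proof.
move=> gT gS cc cp gq hp gB; have [q0 q120] := q1_small; have /andP[k0 k1] := kap_lt1.
have B0 : 0 <= B by apply: le_trans (gB 'i _); rewrite ?nm_ge0 // /upper /= ltr01.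
have cb : forall n, nm (c n) * q1 ^+ n <= B.
  apply: (cauchy_bound cc q0 q120) => t.
  (* The horizontal line at height 21/25 is mapped by [ee] onto the circle of radius [q1]. *)
  pose tau : C := t +i* (21/25).
  have ut : upper tau by rewrite /upper /=; lra.
  have E : q1%:C * ee t%:C = ee tau.
    rewrite (_ : tau = t%:C + 'i * (21/25)%:C); last first.
      by apply/eqP; rewrite eq_complex /=; apply/andP; split; apply/eqP; ring.
    rewrite eeD mulrC; congr (_ * _); rewrite /ee twopiiE /q1.
    rewrite (_ : (pi *+ 2)%:C * 'i * ('i * (21/25)%:C) = (- (pi *+ 2 * (21/25)))%:C); first by rewrite cexp_real.
    by apply/eqP; rewrite eq_complex /=; apply/andP; split; apply/eqP; ring.
  rewrite E -gq //; first exact: gB.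
  by rewrite -E nmM nm_real ger0_norm // nm_ee /= mulr0 oppr0 expR0 mulr1.
apply: reduction => [t ht|t j ut|t ut]; last 2 first.
- by rewrite gT.
- by rewrite gS.
have nq := nm_ee_F ht.
have ut : upper t by apply: lt_le_trans ht; rewrite /y0; lra.
have qk : q1 * kap <= q1 by rewrite ler_piMr // ltW.
have nq' : nm (ee t) < 1/120 by apply: le_lt_trans nq _; apply: le_lt_trans q120.
rewrite gq //; have sc := conv_summable cc nq'.
apply: nm_tsum_le => // n.
have k1' : 0 < 1 - kap by rewrite subr_gt0.
have term i : nm (c i * ee t ^+ i) <= (if (i < p)%N then 0 else B * kap ^+ i).
  case: ltnP => hi; first by rewrite cp // mul0r nm0.
  rewrite nmM nmX; apply: le_trans (_ : nm (c i) * (q1 * kap) ^+ i <= _).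
    by rewrite ler_wpM2l ?nm_ge0 // lerXn2r ?nnegrE ?nm_ge0 ?mulr_ge0.
  by rewrite exprMn mulrA ler_wpM2r ?exprn_ge0.
apply: le_trans (ler_sum _ (fun (i : 'I_n) _ => term i)) _.
apply: le_trans (_ : \sum_(i < n) B * kap ^+ p * kap ^+ i <= _); last first.
  have hp' : kap ^+ p / (1 - kap) <= 2^-1 by rewrite mul1r in hp.
  rewrite -mulr_sumr -mulrA ler_wpM2l //; apply: le_trans hp'.
  by rewrite ler_wpM2l ?exprn_ge0 // geom_sum_le // k0.
case: (leqP n p) => np.
  apply: ler_sum => i _; rewrite (leq_trans (ltn_ord i) np); rewrite !mulr_ge0 ?exprn_ge0 //.
rewrite -(big_mkord xpredT (fun i => if (i < p)%N then 0 else B * kap ^+ i)).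
rewrite (big_cat_nat (n := p)) //=; last exact: ltnW.
rewrite [X in X + _]big_nat_cond [X in X + _]big1 ?add0r; last first.
  by move=> i /andP[/andP[_ ->]].
rewrite -{1}[p]add0n big_addn big_mkord.
apply: le_trans (_ : \sum_(i < n - p) B * kap ^+ p * kap ^+ i <= _).
  apply: ler_sum => i _; rewrite ltnNge leq_addl /= addnC exprD mulrA //.
rewrite -!(big_mkord xpredT (fun i => B * kap ^+ p * kap ^+ i)) (big_cat_nat (n := (n - p)%N) (m := 0%N) (p := n)) //=; last exact: leq_subr.
by rewrite lerDl sumr_ge0 // => i _; rewrite !mulr_ge0 ?exprn_ge0.
Qed.

Fixpoint cpow (c : nat -> C) (p : nat) : nat -> C := if p is p'.+1 then convol c (cpow c p') else cst 1.

Lemma conv_cpow rho c p : conv rho c -> conv rho (cpow c p).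
Proof. by move=> hc; elim: p => [|p IH] /=; [exact: conv_cst|exact: conv_convol]. Qed.

Lemma ev_cpow rho c p x : conv rho c -> nm x < rho -> ev (cpow c p) x = ev c x ^+ p.
Proof.
move=> hc hx; elim: p => [|p IH] /=; first by rewrite ev_cst.
by rewrite (ev_convol hc (conv_cpow p hc) hx) IH exprS.
Qed.

Lemma cpow_low c p i : c 0%N = 0 -> (i < p)%N -> cpow c p i = 0.
Proof.
move=> c0; elim: p i => [//|p IH] i ip /=; rewrite /convol big1 // => -[[|k] hk] _ /=.
  by rewrite c0 mul0r.
by rewrite IH ?mulr0 //; lia.
Qed.

(** Such a function is bounded, by its q-expansion at height at least [y0] and [reduction]
    elsewhere. A high power of it vanishes at the cusp to an order for which [weight0_halve]
    applies, and halving the bound indefinitely forces the power to be 0. *)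
Lemma weight0_zero (h : C -> C) (c : nat -> C) :
  (forall t (j : int), upper t -> h (t + j%:~R) = h t) -> (forall t, upper t -> h (- t^-1) = h t) ->
  conv (1/120) c -> c 0%N = 0 ->
  (forall t, upper t -> nm (ee t) < 1/120 -> h t = ev c (ee t)) ->
  forall t, upper t -> h t = 0.
Proof.
move=> hT hS cc c0 hq; have [q0 q120] := q1_small; have /andP[k0 k1] := kap_lt1.
have k1' : 0 < 1 - kap by rewrite subr_gt0.
have e0 : 0 < 1/2 * (1 - kap) by rewrite mulr_gt0 //; lra.
have [p hp] := expr_small kap_lt1 e0.
have {}hp := hp p.+1 (leqnSn p).
have qk : q1 * kap <= q1 by rewrite ler_piMr // ltW.
have [K K0 hK] := ev_bound cc q0 q120.
have hb : forall t, upper t -> nm (h t) <= K.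
  apply: reduction => [t ht|t j ut|t ut]; rewrite ?hT ?hS //.
  have nq := nm_ee_F ht.
  have ut : upper t by apply: lt_le_trans ht; rewrite /y0; lra.
  rewrite hq //; first by apply: hK; exact: le_trans qk.
  by apply: le_lt_trans nq _; apply: le_lt_trans q120.
have gB n : forall t, upper t -> nm (h t ^+ p.+1) <= K ^+ p.+1 * 2^-1 ^+ n.
  elim: n => [|n IH] t ut.
    by rewrite expr0 mulr1 nmX lerXn2r ?nnegrE ?nm_ge0 // hb.
  rewrite [2^-1 ^+ _]exprSr mulrA.
  apply: (weight0_halve (c := cpow c p.+1) (p := p.+1) _ _ _ _ _ _ IH) => //.
  - by move=> s j us; rewrite hT.
  - by move=> s us; rewrite hS.
  - exact: conv_cpow.
  - by move=> i; exact: cpow_low.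
  - by move=> s us hs; rewrite hq // (ev_cpow _ cc).
  - by rewrite ler_pdivrMr.
move=> t ut; suff : h t ^+ p.+1 = 0 by move/eqP; rewrite expf_eq0 => /eqP.
apply: nm_small0 => e ee0.
have hh : 0 <= (2^-1 : R) < 1 by apply/andP; split; lra.
have K1 : 0 < K ^+ p.+1 + 1 by rewrite ltr_wpDl ?exprn_ge0.
have [n hn] := expr_small hh (divr_gt0 ee0 K1).
apply: le_trans (gB n t ut) _; have := hn n (leqnn n); rewrite ler_pdivlMr // mulrDr mulr1 mulrC.
have : 0 <= (2^-1 : R) ^+ n by rewrite exprn_ge0 //; lra.
lra.
Qed.

End Weight0.

(** * Eisenstein series as q-series and their transformation laws *)

Section EisAlg.
Variable F : fieldType.

Lemma eis_coef4 (t z e l : F) : (forall k, (0 < k)%N -> (k%:R : F) != 0) -> z = t / 720%:R ->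
  z + 2%:R * (t * 6%:R^-1 * l) = z * (1 + 240%:R * l).
Proof. move=> nz ->; by field; rewrite ?nz. Qed.

Lemma eis_coef6 (t z e l : F) : (forall k, (0 < k)%N -> (k%:R : F) != 0) -> z = - (t / (720%:R * 42%:R)) ->
  z + 2%:R * (t * 120%:R^-1 * l) = z * (1 + - 504%:R * l).
Proof.
move=> nz ->.
have h : (720%:R : F) = 120%:R * 6%:R by rewrite -natrM.
have h5 : (504%:R : F) = 2%:R * 6%:R * 42%:R by rewrite -!natrM.
have n1 := nz 120%N isT; have n2 := nz 6%N isT; have n3 := nz 42%N isT.
rewrite h h5; move: (120%:R : F) (6%:R : F) (42%:R : F) n1 n2 n3 => a b c n1 n2 n3.
by field; rewrite n1 n2 n3.
Qed.

Lemma eis_coef2 (t z e l : F) : (forall k, (0 < k)%N -> (k%:R : F) != 0) -> z = - (t / 12%:R) ->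
  z + 2%:R * (t * 1 * l) = z * (1 + - 24%:R * l).
Proof. move=> nz ->; by field; rewrite ?nz. Qed.

Lemma quasi_solve (t T A B : F) : (forall k, (0 < k)%N -> (k%:R : F) != 0) -> t != 0 -> T != 0 ->
  - (T ^+ 2 / 12%:R) * A - t ^- 2 * (- (T ^+ 2 / 12%:R) * B) = T / t -> B = t ^+ 2 * A + 12%:R * t / T.
Proof.
move=> nz t0 T0 h; have n12 : (12%:R : F) != 0 by apply: nz.
apply/eqP; rewrite -subr_eq0; apply/eqP.
have -> : B - (t ^+ 2 * A + 12%:R * t / T) = 12%:R * t ^+ 2 / T ^+ 2 *
  (- (T ^+ 2 / 12%:R) * A - t ^- 2 * (- (T ^+ 2 / 12%:R) * B) - T / t) by field; rewrite T0 t0 n12.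
by rewrite h subrr mulr0.
Qed.

End EisAlg.

Section Eisenstein.
Variable R : realType.
Local Notation C := R[i].
Local Notation T := (twopii R).

Lemma conv_natS rho (c : nat -> C) : conv rho c -> conv rho (fun n => n.+1%:R * c n).
Proof.
move=> hc r r0 hr; pose r' := (r + rho) / 2.
have r'0 : 0 < r' by rewrite /r'; lra.
have rr' : r < r' by rewrite /r'; lra.
have [|B hB] := hc r' (ltW r'0); first by rewrite /r'; lra.
have B0 : 0 <= B by have := hB 0%N; apply: le_trans; rewrite mulr_ge0 ?nm_ge0 // exprn_ge0 // ltW.
move: r0; rewrite le_eqVlt => /orP[/eqP <-|rp].
  exists (nm (c 0%N)) => -[|i]; first by rewrite expr0 mulr1 nmM nm_nat mul1r.
  by rewrite exprS mul0r mulr0 nm_ge0.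
pose x := r' / r - 1; have x0 : 0 < x by rewrite subr_gt0 ltr_pdivlMr // mul1r.
exists ((1 + x^-1) * B) => n; rewrite nmM nm_nat.
have h1 := bernoulli n (ltW x0).
have e : 1 + x = r' / r by rewrite /x; ring.
have h2 : n.+1%:R * r ^+ n <= (1 + x^-1) * r' ^+ n.
  have -> : r' ^+ n = (1 + x) ^+ n * r ^+ n by rewrite e -exprMn divfK // gt_eqF.
  rewrite mulrA ler_wpM2r ?exprn_ge0 ?(ltW rp) //.
  apply: le_trans (_ : (1 + x^-1) * (1 + n%:R * x) <= _); last first.
    by rewrite ler_wpM2l // addr_ge0 // invr_ge0 ltW.
  rewrite -natr1; have xi : 0 <= x^-1 by rewrite invr_ge0 ltW.
  have -> : (1 + x^-1) * (1 + n%:R * x) = 1 + x^-1 + n%:R * x + n%:R * (x^-1 * x) by ring.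
  rewrite mulVf ?gt_eqF // mulr1; have : 0 <= n%:R * x by rewrite mulr_ge0 // ltW.
  by move: (n%:R : R) (n%:R * x) => a b; lra.
rewrite mulrAC mulrC; apply: le_trans (ler_wpM2l (nm_ge0 _) h2) _.
by rewrite mulrCA ler_wpM2l ?hB // addr_ge0 // invr_ge0 ltW.
Qed.

Lemma conv_powS j : conv 1 (fun d : nat => (d.+1%:R : C) ^+ j).
Proof.
elim: j => [|j IH]; first by under eq_fun do rewrite expr0; exact: geom_conv.
by under eq_fun do rewrite exprS; exact: conv_natS.
Qed.

(** The family d^j q^(d s) over d, s >= 1. Its rows give the Lambert series, its columns the lattice
    form [eisS], and the fibres of (d, s) -> d s the divisor sums. *)
Definition lamf (j : nat) (q : C) (p : nat * nat) : C := p.1.+1%:R ^+ j * q ^+ (p.1.+1 * p.2.+1).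

Definition sig (j n : nat) : nat := \sum_(1 <= d < n.+1 | (d %| n)%N) d ^ j.
Definition sigc (j n : nat) : C := (sig j n)%:R.

Section AtQ.
Variables (j : nat) (q : C).
Hypothesis q1 : nm q < 1.

Lemma summable_lamf : summable (lamf j q).
Proof.
have s := summable_prod (conv_summable (@conv_powS j) q1) (conv_summable (@geom_conv R) q1).
apply: summable_le s => -[d s]; rewrite /lamf !nmM !nmX nm1 mul1r -mulrA.
rewrite ler_wpM2l ?exprn_ge0 ?nm_ge0 // -exprD ler_wiXn2l ?nm_ge0 ?(ltW q1) //.
by rewrite /=; nia.
Qed.

Lemma nm_expS_lt1 d : nm (q ^+ d.+1) < 1.
Proof. by rewrite nmX exprn_ilt1 ?nm_ge0. Qed.

Lemma lam_row d : tsum (fun s : nat => lamf j q (d, s)) = d.+1%:R ^+ j * (q ^+ d.+1 / (1 - q ^+ d.+1)).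
Proof.
have sg := conv_summable (@geom_conv R) (nm_expS_lt1 d).
rewrite -(ev_geom (nm_expS_lt1 d)) mulrA -tsumZ //.
by apply: eq_tsum => s; rewrite /lamf /= mul1r -mulrA -exprM -exprD mulnS.
Qed.

Lemma lam_lambert : tsum (lamf j q) = tsum (fun d : nat => d.+1%:R ^+ j * (q ^+ d.+1 / (1 - q ^+ d.+1))).
Proof. by rewrite (tsum_rows summable_lamf); apply: eq_tsum => d; exact: lam_row. Qed.

Lemma summable_lambert : summable (fun d : nat => d.+1%:R ^+ j * (q ^+ d.+1 / (1 - q ^+ d.+1))).
Proof. by apply: eq_summable (summable_rows summable_lamf) => d; rewrite lam_row. Qed.

Lemma lam_col s : (0 < j)%N -> tsum (fun d : nat => lamf j q (d, s)) = powS j (q ^+ s.+1).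
Proof.
move=> j0; have sc : summable (fun r : nat => (r%:R : C) ^+ j * (q ^+ s.+1) ^+ r).
  apply: (@summable_inj _ _ _ succn) => [a b []//|[|m]|]; first by rewrite expr0n eqn0Ngt j0 mul0r eqxx.
  - by move=> _; exists m.
  - by apply: eq_summable (summable_col summable_lamf s) => d; rewrite /= /lamf /= -exprM mulnC.
rewrite /powS -(@tsum_reindex_inj _ _ _ succn _ _ _ sc).
- by apply: eq_tsum => d; rewrite /= /lamf /= -exprM mulnC.
- by move=> a b [].
- by move=> [|m]; [rewrite expr0n eqn0Ngt j0 mul0r eqxx|exists m].
Qed.

Lemma lam_eis : (0 < j)%N -> tsum (lamf j q) = eisS j q.
Proof. by move=> j0; rewrite (tsum_cols summable_lamf); apply: eq_tsum => s; exact: lam_col. Qed.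

Lemma lam_fiber n : tsum (fun p : nat * nat => if (p.1.+1 * p.2.+1 == n)%N then lamf j q p else 0) = sigc j n * q ^+ n.
Proof.
pose F := [fset (d.-1, (n %/ d).-1) | d in divisors n]%fset.
have dP d : (0 < n)%N -> d \in divisors n -> [/\ (0 < d)%N, (0 < n %/ d)%N & (d * (n %/ d) = n)%N].
  move=> n0; rewrite -dvdn_divisors // => dn; have d0 := dvdn_gt0 n0 dn; split => //.
    by rewrite divn_gt0 // dvdn_leq.
  by rewrite mulnC divnK.
case: (posnP n) => [->|n0].
  by rewrite /sigc /sig big_geq // mul0r; apply: tsum0 => -[a b] /=.
rewrite (@tsum_finite _ _ F); last first.
  move=> [a b] /= hF; case: eqP => // abn; case/negP: hF.
  apply/imfsetP; exists a.+1 => /=; first by rewrite -dvdn_divisors // -abn dvdn_mulr.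
  by rewrite -abn mulKn.
rewrite /F big_imfset /=; last first.
  move=> d e dn en [h _]; have [d0 _ _] := dP d n0 dn; have [e0 _ _] := dP e n0 en.
  by rewrite -(prednK d0) h prednK.
rewrite /sigc /sig natr_sum mulr_suml -[RHS]big_filter big_seq [RHS]big_seq.
have pm : perm_eq (divisors n) [seq d <- index_iota 1 n.+1 | (d %| n)%N].
  apply: uniq_perm => [||d]; rewrite ?divisors_uniq ?filter_uniq ?iota_uniq // mem_filter mem_index_iota.
  rewrite -dvdn_divisors //; case h: (d %| n)%N => //=.
  by rewrite ltnS (dvdn_leq n0 h) (dvdn_gt0 n0 h).
rewrite -(perm_big _ pm) /= (perm_big (divisors n)) /=; last first.
  apply: uniq_perm => [||d]; rewrite ?undup_uniq ?divisors_uniq ?mem_undup //.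
apply: eq_big => [d|d]; rewrite mem_undup ?(perm_mem pm) // -(perm_mem pm) => dn; have [d0 nd0 dnE] := dP d n0 dn.
by rewrite /lamf /= !prednK // dnE eqxx natrX.
Qed.

Lemma lam_sig : tsum (lamf j q) = ev (sigc j) q.
Proof.
rewrite (tsum_fiber (fun p : nat * nat => (p.1.+1 * p.2.+1)%N) summable_lamf).
by apply: eq_tsum => n; exact: lam_fiber.
Qed.

Lemma summable_sig : summable (fun n : nat => sigc j n * q ^+ n).
Proof.
apply: eq_summable (summable_fibers (fun p : nat * nat => (p.1.+1 * p.2.+1)%N) summable_lamf) => n.
by rewrite lam_fiber.
Qed.

End AtQ.

Lemma conv_sigc j : conv 1 (sigc j).
Proof.
apply: conv_of_summable => r r0 hr; apply: summable_sig.
by rewrite nm_real ger0_norm.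
Qed.

(** The coefficients of 1 + a times the divisor sum series; the constant term is 1 because [sig j 0]
    is 0. *)
Definition ec (a : C) (j n : nat) : C := cst 1 n + a * sigc j n.

Lemma conv_ec a j : conv 1 (ec a j).
Proof. by apply: convD; [exact: conv_cst|apply: convZ; exact: conv_sigc]. Qed.

Lemma ev_ec a j q : nm q < 1 -> ev (ec a j) q = 1 + a * ev (sigc j) q.
Proof.
move=> hq; rewrite (evD (@conv_cst R 1 1) (convZ a (conv_sigc j)) hq) ev_cst.
by rewrite (evZ _ (conv_sigc j) hq).
Qed.

Definition E2 (t : C) : C := ev (ec (- 24%:R) 1) (ee t).
Definition E4 (t : C) : C := ev (ec 240%:R 3) (ee t).
Definition E6 (t : C) : C := ev (ec (- 504%:R) 5) (ee t).

Lemma E2_T t (n : int) : E2 (t + n%:~R) = E2 t. Proof. by rewrite /E2 eeDint. Qed.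
Lemma E4_T t (n : int) : E4 (t + n%:~R) = E4 t. Proof. by rewrite /E4 eeDint. Qed.
Lemma E6_T t (n : int) : E6 (t + n%:~R) = E6 t. Proof. by rewrite /E6 eeDint. Qed.

Lemma nzC k : (0 < k)%N -> (k%:R : C) != 0. Proof. by rewrite pnatr_eq0 -lt0n. Qed.

Lemma expc_val : [/\ expc R 1 = 1, expc R 3 = 6%:R^-1 & expc R 5 = 120%:R^-1].
Proof.
have f1 : 1`! = 1%N by []; have f3 : 3`! = 6%N by []; have f5 : 5`! = 120%N by [].
by split; rewrite /expc ?f1 ?f3 ?f5 ?invr1.
Qed.

(** The value Zt 4 normalises the constant term of the lattice sum to 1, and its rational ratio to
    T^4 produces the factor 240. *)
Lemma GG4E t : upper t -> GG 4 t = Zt R 4 * E4 t.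
Proof.
move=> ut; have [_ z4 _] := zeta_values R; have [_ e3 _] := expc_val.
rewrite (@GG_eis R t ut 0 isT) /E4 ev_ec ?nm_ee_lt1 // -(lam_sig _ (nm_ee_lt1 ut)).
by rewrite (lam_eis (nm_ee_lt1 ut)) // e3; apply: eis_coef4 => //; exact: nzC.
Qed.

Lemma GG6E t : upper t -> GG 6 t = Zt R 6 * E6 t.
Proof.
move=> ut; have [_ _ z6] := zeta_values R; have [_ _ e5] := expc_val.
rewrite (@GG_eis R t ut 2 isT) /E6 ev_ec ?nm_ee_lt1 // -(lam_sig _ (nm_ee_lt1 ut)).
by rewrite (lam_eis (nm_ee_lt1 ut)) // e5; apply: eis_coef6 => //; exact: nzC.
Qed.

Lemma G2E t : upper t -> G2 t = Zt R 2 * E2 t.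
Proof.
move=> ut; have [z2 _ _] := zeta_values R; have [e1 _ _] := expc_val.
rewrite (proj2 (G2_eis ut)) /E2 ev_ec ?nm_ee_lt1 // -(lam_sig _ (nm_ee_lt1 ut)).
by rewrite (lam_eis (nm_ee_lt1 ut)) // e1; apply: eis_coef2 => //; exact: nzC.
Qed.

Lemma Zt_neq0 : [/\ Zt R 2 != 0, Zt R 4 != 0 & Zt R 6 != 0].
Proof.
have [-> -> ->] := zeta_values R; have t0 := twopii_neq0 R.
by split; rewrite ?oppr_eq0 mulf_neq0 ?expf_neq0 ?invr_neq0 ?mulf_neq0 ?nzC.
Qed.

Lemma E4_S t : upper t -> E4 (- t^-1) = t ^+ 4 * E4 t.
Proof.
move=> ut; have [_ z4 _] := Zt_neq0; apply: (mulfI z4).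
by rewrite -GG4E ?GG_S // ?GG4E 1?mulrCA //; exact: upper_S.
Qed.

Lemma E6_S t : upper t -> E6 (- t^-1) = t ^+ 6 * E6 t.
Proof.
move=> ut; have [_ _ z6] := Zt_neq0; apply: (mulfI z6).
by rewrite -GG6E ?GG_S // ?GG6E 1?mulrCA //; exact: upper_S.
Qed.

Lemma E2_S t : upper t -> E2 (- t^-1) = t ^+ 2 * E2 t + 12%:R * t / T.
Proof.
move=> ut; have [z2 _ _] := Zt_neq0; have t0 := tau_neq0 ut; have T0 := twopii_neq0 R.
have := E2_quasi ut; rewrite G2E // G2E; last exact: upper_S.
have [-> _ _] := zeta_values R.
by apply: quasi_solve => //; exact: nzC.
Qed.

(** Since t minus its conjugate is 2 i Im t and T = 2 pi i, the added term is - 3/(pi Im t), as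
    [E2s_alt] records. In this form the transformation law is a rational identity in t and its
    conjugate. *)
Definition E2s (t : C) : C := E2 t + 12%:R / (T * (t - t^*)).

End Eisenstein.

(** * Weighted coefficient norms and reciprocals of power series *)

Section Majorants.
Variable R : realType.
Local Notation C := R[i].
Implicit Types c d u w : nat -> C.

(** A bound for the l1 norm of the coefficients weighted by powers of r. This norm is
    submultiplicative, so bounds propagate through products. *)
Definition mj (r : R) c (B : R) := forall N, \sum_(i < N) nm (c i) * r ^+ i <= B.

Lemma mj_ge0 r c B : mj r c B -> 0 <= B.
Proof. by move=> h; have := h 0%N; rewrite big_ord0. Qed.

Lemma mj_convol r c d B D : 0 <= r -> mj r c B -> mj r d D -> mj r (convol c d) (B * D).
Proof.
move=> r0 hc hd N; have B0 := mj_ge0 hc; have D0 := mj_ge0 hd.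
apply: le_trans (_ : \sum_(i < N) \sum_(k < N) (nm (c k) * r ^+ k) * (if (k <= i)%N then nm (d (i - k)%N) * r ^+ (i - k) else 0) <= _).
  apply: ler_sum => i _; rewrite /convol.
  apply: le_trans (ler_wpM2r (exprn_ge0 _ r0) (nm_sum _ _ _)) _.
  rewrite mulr_suml (big_ord_widen _ (fun k => nm (c k * d (i - k)%N) * r ^+ i) (ltn_ord i)) big_mkcond /=.
  apply: ler_sum => k _; rewrite ltnS; case: leqP => ki; last by rewrite mulr0.
  have -> : r ^+ i = r ^+ k * r ^+ (i - k) by rewrite -exprD subnKC.
  by rewrite nmM mulrACA.
rewrite exchange_big /=; apply: le_trans (_ : \sum_(k < N) (nm (c k) * r ^+ k) * D <= _); last first.
  by rewrite -mulr_suml ler_wpM2r.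
apply: ler_sum => k _; rewrite -mulr_sumr ler_wpM2l ?mulr_ge0 ?nm_ge0 ?exprn_ge0 //.
apply: le_trans (hd (N - k)%N).
rewrite -(big_mkord xpredT (fun i => if (k <= i)%N then nm (d (i - k)%N) * r ^+ (i - k) else 0)).
rewrite (big_cat_nat (n := k)) //=; last exact: ltnW.
rewrite [X in X + _]big_nat_cond [X in X + _]big1 ?add0r; last first.
  by move=> i /andP[/andP[_ h] _]; rewrite leqNgt h.
rewrite -{1}[nat_of_ord k]add0n big_addn big_mkord; apply: ler_sum => i _.
by rewrite leq_addl addnK.
Qed.

Lemma mjD r c d B D : 0 <= r -> mj r c B -> mj r d D -> mj r (fun i => c i + d i) (B + D).
Proof.
move=> r0 hc hd N; apply: le_trans (lerD (hc N) (hd N)); rewrite -big_split /=.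
by apply: ler_sum => i _; rewrite -mulrDl ler_wpM2r ?exprn_ge0 ?nmD.
Qed.

Lemma mjZ r a c B : mj r c B -> mj r (fun i => a * c i) (nm a * B).
Proof.
move=> hc N; apply: le_trans (ler_wpM2l (nm_ge0 a) (hc N)); rewrite mulr_sumr.
by apply: ler_sum => i _; rewrite nmM mulrA.
Qed.

Lemma mj_cst r a : mj r (cst a) (nm a).
Proof.
case=> [|N]; first by rewrite big_ord0 nm_ge0.
rewrite big_ord_recl big1 => [|i _]; last by rewrite /cst lift0 nm0 mul0r.
by rewrite /cst expr0 mulr1 addr0.
Qed.

Lemma mj_mulX r c B : 0 <= r -> mj r c B -> mj r (mulX c) (r * B).
Proof.
move=> r0 hc [|N]; first by rewrite big_ord0 mulr_ge0 // (mj_ge0 hc).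
rewrite big_ord_recl [mulX c _]/= nm0 mul0r add0r; apply: le_trans (ler_wpM2l r0 (hc N)).
by rewrite mulr_sumr; apply: ler_sum => i _; rewrite exprS mulrCA.
Qed.

Lemma mj_geom r c K g : 0 <= K -> 0 <= r -> 0 <= g -> g * r < 1 -> (forall i, nm (c i) <= K * g ^+ i) ->
  mj r c (K / (1 - g * r)).
Proof.
move=> K0 r0 g0 hg h N; apply: le_trans (_ : \sum_(i < N) K * (g * r) ^+ i <= _).
  by apply: ler_sum => i _; rewrite exprMn mulrA ler_wpM2r ?exprn_ge0.
by rewrite -mulr_sumr ler_wpM2l // geom_sum_le // mulr_ge0.
Qed.

(** The function expands on the unit disc with weighted l1 norm at most B; a bound can thus be
    assembled along the expression of the function. *)
Definition pser r (f : C -> C) B := exists c, [/\ conv 1 c, forall x, nm x < 1 -> ev c x = f x & mj r c B].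

Lemma pserD r f g B D : 0 <= r -> pser r f B -> pser r g D -> pser r (fun x => f x + g x) (B + D).
Proof.
move=> r0 [c [c1 cf cB]] [d [d1 df dB]]; exists (fun i => c i + d i); split.
- exact: convD.
- by move=> x hx; rewrite (evD c1 d1 hx) cf ?df.
- exact: mjD.
Qed.

Lemma pserM r f g B D : 0 <= r -> pser r f B -> pser r g D -> pser r (fun x => f x * g x) (B * D).
Proof.
move=> r0 [c [c1 cf cB]] [d [d1 df dB]]; exists (convol c d); split.
- exact: conv_convol.
- by move=> x hx; rewrite (ev_convol c1 d1 hx) cf ?df.
- exact: mj_convol.
Qed.

Lemma pserZ r a f B : pser r f B -> pser r (fun x => a * f x) (nm a * B).
Proof.
move=> [c [c1 cf cB]]; exists (fun i => a * c i); split.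
- exact: convZ.
- by move=> x hx; rewrite (evZ _ c1 hx) cf.
- exact: mjZ.
Qed.

Lemma pserX r f B : 0 <= r -> pser r f B -> pser r (fun x => x * f x) (r * B).
Proof.
move=> r0 [c [c1 cf cB]]; exists (mulX c); split.
- exact: conv_mulX.
- by move=> x hx; rewrite (ev_mulX c1 hx) cf.
- exact: mj_mulX.
Qed.

Lemma pser_cst r a : pser r (fun=> a) (nm a).
Proof. by exists (cst a); split; [exact: conv_cst|move=> x _; exact: ev_cst|exact: mj_cst]. Qed.

Lemma small_pt (e : R) : 0 < e -> exists x : C, [/\ x != 0, nm x <= e & nm x < 1].
Proof.
move=> e0; pose d := Num.min e (1/2); have d0 : 0 < d by rewrite lt_min e0; lra.
exists d%:C; rewrite nm_real gtr0_norm //; split.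
- by rewrite -nm_gt0 nm_real gtr0_norm.
- by rewrite ge_min lexx.
- by apply: le_lt_trans (_ : 1/2 < 1); [rewrite ge_min lexx orbT|lra].
Qed.

Lemma seq_eq c d : conv 1 c -> conv 1 d -> (forall x, nm x < 1 -> ev c x = ev d x) -> c =1 d.
Proof.
move=> hc hd h; apply: ev_inj hc hd _ => // e e0; have [x [x0 xe x1]] := small_pt e0.
by exists x; split=> //; exact: h.
Qed.

(** The list of the first n + 1 coefficients of the reciprocal of a series with constant term 1;
    each new one needs all the earlier ones. *)
Fixpoint invl u n : seq C :=
  if n is n'.+1 then rcons (invl u n') (- \sum_(i < n'.+1) u i.+1 * (invl u n')`_(n' - i)) else [:: 1].
Definition invs u n := (invl u n)`_n.

Lemma size_invl u n : size (invl u n) = n.+1.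
Proof. by elim: n => //= n IH; rewrite size_rcons IH. Qed.

Lemma invl_nth u n k : (k <= n)%N -> (invl u n)`_k = invs u k.
Proof.
elim: n => [|n IH]; first by rewrite leqn0 => /eqP ->.
rewrite leq_eqVlt => /orP[/eqP -> //|kn].
by rewrite /= nth_rcons size_invl kn IH.
Qed.

Lemma invsS u n : invs u n.+1 = - \sum_(i < n.+1) u i.+1 * invs u (n - i).
Proof.
rewrite /invs /= nth_rcons size_invl ltnn eqxx; congr (- _); apply: eq_bigr => i _.
by rewrite invl_nth // leq_subr.
Qed.

Lemma invs_convol u : u 0%N = 1 -> convol u (invs u) =1 cst 1.
Proof.
move=> u0 [|n]; rewrite /convol /cst /=; first by rewrite big_ord1 u0 mul1r.
rewrite big_ord_recl /= subn0 u0 mul1r invsS; apply/eqP; rewrite addrC subr_eq0; apply/eqP.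
by apply: eq_bigr => i _.
Qed.

(** In the recursion the weighted coefficient n + 1 is a combination of earlier weighted
    coefficients, each of modulus at most 1, with weights |u_i| r^i of total at most 1. *)
Lemma invs_bound r u : 0 <= r -> (forall N, \sum_(i < N) nm (u i.+1) * r ^+ i.+1 <= 1) ->
  forall n, nm (invs u n) * r ^+ n <= 1.
Proof.
move=> r0 h; elim/ltn_ind => -[|n] IH; first by rewrite expr0 mulr1 (_ : invs u 0 = 1) ?nm1.
rewrite invsS nmN; apply: le_trans (ler_wpM2r (exprn_ge0 _ r0) (nm_sum _ _ _)) _.
apply: le_trans (h n.+1); rewrite mulr_suml; apply: ler_sum => i _.
have -> : r ^+ n.+1 = r ^+ i.+1 * r ^+ (n - i) by rewrite -exprD addSn subnKC // -ltnS.
rewrite nmM mulrACA ler_piMr ?mulr_ge0 ?nm_ge0 ?exprn_ge0 //.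
by apply: IH; rewrite ltnS leq_subr.
Qed.

(** If u - 1 has weighted norm at most 1 at [r], the formal reciprocal converges for |x| < r, so u
    has no zero there. *)
Lemma pser_invs r u : 0 < r -> r < 1 -> conv 1 u -> pser r (fun x => ev u x - 1) 1 -> u 0%N = 1 ->
  conv r (invs u) /\ forall x, nm x < r -> ev u x * ev (invs u) x = 1.
Proof.
move=> r0 r1 hu [v [v1 vE vB]] u0.
have uE : u =1 (fun i => cst 1 i + v i).
  apply: seq_eq => // [|x hx]; first by apply: convD => //; exact: conv_cst.
  by rewrite (evD (@conv_cst R 1 1) v1 hx) ev_cst vE // addrC subrK.
have b : forall n, nm (invs u n) * r ^+ n <= 1.
  apply: invs_bound; first exact: ltW.
  move=> N; apply: le_trans (vB N.+1); rewrite big_ord_recl expr0 mulr1.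
  rewrite ler_wpDl ?nm_ge0 //; apply: ler_sum => i _.
  by rewrite uE /cst /= add0r.
have cw : conv r (invs u).
  move=> s s0 sr; exists 1 => i; apply: le_trans (b i).
  by rewrite ler_wpM2l ?nm_ge0 // lerXn2r ?nnegrE // ltW.
split=> // x hx; rewrite -(ev_convol (conv_le (ltW r1) hu) cw hx).
by rewrite -[RHS](ev_cst 1 x); apply: eq_tsum => i; rewrite invs_convol.
Qed.

End Majorants.

(** * The discriminant: integral expansion and nonvanishing *)

Section Delta.
Variable R : realType.
Local Notation C := R[i].
Local Notation T := (twopii R).

Lemma sig_le j n : (sig j n <= n ^ j.+1)%N.
Proof.
rewrite /sig expnS; apply: leq_trans (_ : \sum_(1 <= d < n.+1) n ^ j <= _)%N.
  rewrite big_mkcond /= big_nat_cond [X in (_ <= X)%N]big_nat_cond; apply: leq_sum => d /andP[/andP[_ h] _].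
  by case: ifP => // _; case: (posnP j) => [->//|j0]; rewrite leq_exp2r.
by rewrite sum_nat_const_nat subn1.
Qed.

(** Passing from i + 3 to i + 4 multiplies the base by at most 4/3, and (4/3)^k <= g by
    hypothesis. *)
Lemma pow_step k g : (4 ^ k <= g * 3 ^ k)%N -> (0 < k)%N -> forall i, ((i + 3) ^ k <= 3 ^ k * g ^ i)%N.
Proof.
move=> h k0; elim=> [|i IH]; first by rewrite add0n expn0 muln1.
rewrite -(leq_pmul2l (_ : 0 < 3 ^ k)%N) ?expn_gt0 //.
apply: leq_trans (_ : (4 * (i + 3)) ^ k <= _)%N.
  by rewrite -expnMn leq_exp2r //; lia.
rewrite expnMn; apply: leq_trans (leq_mul h IH) _.
by rewrite expnS; move: (3 ^ k)%N (g ^ i)%N => a b; apply: eq_leq; ring.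
Qed.

Definition ss (j i : nat) : C := sigc R j i.+1.

Lemma conv_ss j : conv 1 (ss j).
Proof. by apply: (conv_shift 1 ltr01); exact: conv_sigc. Qed.

Lemma sig0 j : sig j 0 = 0%N. Proof. by rewrite /sig big_geq. Qed.
Lemma sig1 j : sig j 1 = 1%N. Proof. by rewrite /sig big_mkcond big_nat1 dvd1n exp1n. Qed.
Lemma sig2 j : sig j 2 = (2 ^ j).+1%N.
Proof. by rewrite /sig big_mkcond /= big_nat_recl // big_nat1 /= exp1n add1n. Qed.

Lemma ev_sigc j x : nm x < 1 -> ev (sigc R j) x = x * ev (ss j) x.
Proof.
move=> hx; rewrite (ev_shift 1 (@conv_sigc R j) hx) big_ord1 /sigc sig0 mul0r add0r expr1.
by [].
Qed.

(** The divisor sums from the third on. The first two are kept exactly, and only this tail is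
    estimated. *)
Definition s3 j : nat -> C := shift 2 (ss j).

Lemma ev_ss j x : nm x < 1 -> ev (ss j) x = 1 + (2 ^ j).+1%:R * x + x * (x * ev (s3 j) x).
Proof.
move=> hx; rewrite (ev_shift 2 (@conv_ss j) hx) big_ord_recl big_ord1 /ss /sigc sig1 sig2.
by rewrite expr0 expr1 mulr1 /= exprS expr1 mulrA.
Qed.

Lemma pser_s3 j g (B : R) : (4 ^ j.+1 <= g * 3 ^ j.+1)%N -> g%:R * (1/120) < 1 :> R ->
  (3 ^ j.+1)%:R / (1 - g%:R * (1/120)) <= B -> pser (1/120) (ev (s3 j)) B.
Proof.
move=> h1 h2 h3; exists (s3 j); split => //; first by apply: conv_shift => //; exact: conv_ss.
move=> N; apply: le_trans h3.
apply: mj_geom => // i.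
rewrite /s3 /shift /ss /sigc nm_nat -natrX -natrM ler_nat.
apply: leq_trans (sig_le _ _) _; rewrite -addn1 -addnA addnC -addnA.
exact: pow_step.
Qed.

End Delta.

Section DeltaAlg.
Variable F : fieldType.

(** Here S and P are the divisor sum series of exponents 3 and 5 divided by q, with 240 = 12 * 20
    and 504 = 12 * 42. The only denominator left in Delta is that of k = (5 S + 7 P)/12, which has
    integral coefficients by [sig57]. *)
Lemma delta_id (x S P k : F) : (12%:R : F) != 0 -> 12%:R * k = 5%:R * S + 7%:R * P ->
  ((1 + 12%:R * 20%:R * (x * S)) ^+ 3 - (1 - 12%:R * 42%:R * (x * P)) ^+ 2) / 12%:R ^+ 3 =
  x * (k + (10%:R ^+ 2 * (x * (S * S)) + (20%:R ^+ 3 * (x * (x * (S * (S * (S * 1))))) - 3%:R * 7%:R ^+ 2 * (x * (P * P))))).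
Proof.
move=> n hk; apply: (mulIf (expf_neq0 3 n)); rewrite divfK ?expf_neq0 //.
have -> : x * (k + (10%:R ^+ 2 * (x * (S * S)) + (20%:R ^+ 3 * (x * (x * (S * (S * (S * 1))))) - 3%:R * 7%:R ^+ 2 * (x * (P * P))))) * 12%:R ^+ 3 =
  x * (12%:R * k * 12%:R ^+ 2 + (10%:R ^+ 2 * (x * (S * S)) + (20%:R ^+ 3 * (x * (x * (S * (S * (S * 1))))) - 3%:R * 7%:R ^+ 2 * (x * (P * P)))) * 12%:R ^+ 3) by ring.
rewrite hk; ring.
Qed.

(** Delta/q - 1 with the first two terms of S and P made explicit, so that the linear terms collapse
    to the single coefficient -24 before any absolute value is taken. *)
Lemma delta_tail (x a b k : F) : (12%:R : F) != 0 ->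
  let S := 1 + 9%:R * x + x * (x * a) in let P := 1 + 33%:R * x + x * (x * b) in
  let z := 9%:R * (x * 1) + x * (x * a) in let y := 33%:R * (x * 1) + x * (x * b) in
  12%:R * k = 5%:R * S + 7%:R * P ->
  k + (10%:R ^+ 2 * (x * (S * S)) + (20%:R ^+ 3 * (x * (x * (S * (S * (S * 1))))) - 3%:R * 7%:R ^+ 2 * (x * (P * P)))) - 1 =
  - 24%:R * (x * 1) + (98%:R * (x * (x * 1)) + (12%:R^-1 * (5%:R * (x * (x * a)) + 7%:R * (x * (x * b)))
   + (100%:R * (x * (2%:R * (x * (x * a)) + z * z)) + (20%:R * (20%:R * (20%:R * (x * (x * (z * (z * z) + (3%:R * (z * z) + 3%:R * z))))))
   + - 147%:R * (x * (2%:R * (x * (x * b)) + y * y)))))).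
Proof.
move=> n S P z y hk; apply: (mulfI n); rewrite !mulrDr hk !mulrA mulfV // /S /P /z /y; ring.
Qed.

End DeltaAlg.

Section Delta2.
Variable R : realType.
Local Notation C := R[i].
Local Notation T := (twopii R).

Lemma pser_le r (f : C -> C) B D : pser r f B -> B <= D -> pser r f D.
Proof. by move=> [c [c1 cf cB]] h; exists c; split=> // N; exact: le_trans (cB N) h. Qed.

Lemma pser_ext r (f g : C -> C) B : (forall x, nm x < 1 -> f x = g x) -> pser r f B -> pser r g B.
Proof. by move=> h [c [c1 cf cB]]; exists c; split=> // x hx; rewrite cf ?h. Qed.

(** A check of the residues modulo 12. *)
Lemma dvd_57 d : (12 %| 5 * d ^ 3 + 7 * d ^ 5)%N.
Proof.
have h r : (r < 12)%N -> (12 %| 5 * r ^ 3 + 7 * r ^ 5)%N.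
  move=> hr; have -> : (5 * r ^ 3 + 7 * r ^ 5 = r * (r ^ 2 * (5 + 7 * r ^ 2)))%N by ring.
  by apply: dvdn_mull; move: hr; do 12 (case: r => [//|r]).
have e c k : (c * d ^ k = c * (d %% 12) ^ k %[mod 12])%N by rewrite -modnMmr -[in RHS]modnMmr modnXm.
by have := h _ (ltn_pmod d (isT : 0 < 12)%N); rewrite /dvdn -[in X in _ -> X]modnDm !e modnDm.
Qed.

Lemma sig57 n : (12 %| 5 * sig 3 n + 7 * sig 5 n)%N.
Proof.
rewrite /sig !big_distrr /= -big_split /=.
by elim/big_ind: _ => // [a b ha hb|i _]; [exact: dvdn_add|exact: dvd_57].
Qed.

Definition s57 (i : nat) : C := ((5 * sig 3 i.+1 + 7 * sig 5 i.+1) %/ 12)%:R.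

Lemma s57E i : 12%:R * s57 i = 5%:R * ss R 3 i + 7%:R * ss R 5 i.
Proof. by rewrite /s57 /ss /sigc -!natrM -natrD mulnC divnK ?sig57. Qed.

Lemma conv_s57 : conv 1 s57.
Proof.
have n12 : (12%:R : C) != 0 by exact: nzC.
have -> : s57 = (fun i => 12%:R^-1 * (5%:R * ss R 3 i + 7%:R * ss R 5 i)).
  by apply: funext => i; rewrite -s57E mulKf.
by apply: convZ; apply: convD; apply: convZ; exact: conv_ss.
Qed.

Lemma ev_s57 x : nm x < 1 -> 12%:R * ev s57 x = 5%:R * ev (ss R 3) x + 7%:R * ev (ss R 5) x.
Proof.
move=> hx; have c3 := @conv_ss R 3; have c5 := @conv_ss R 5.
rewrite -(evZ _ conv_s57 hx) -(evZ _ c3 hx) -(evZ _ c5 hx) -(evD (convZ _ c3) (convZ _ c5) hx).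
by apply: eq_tsum => i; rewrite s57E.
Qed.

(** The coefficients of Delta/q, in the visibly integral form of [delta_id]. *)
Definition dl : nat -> C := fun i => s57 i + (10%:R ^+ 2 * mulX (convol (ss R 3) (ss R 3)) i +
  (20%:R ^+ 3 * mulX (mulX (cpow (ss R 3) 3)) i - 3%:R * 7%:R ^+ 2 * mulX (convol (ss R 5) (ss R 5)) i)).

Lemma dl_ev : conv 1 dl /\ forall x, nm x < 1 -> ev dl x = 
  ev s57 x + (10%:R ^+ 2 * (x * (ev (ss R 3) x * ev (ss R 3) x)) + (20%:R ^+ 3 * (x * (x * (ev (ss R 3) x * (ev (ss R 3) x * (ev (ss R 3) x * 1)))))
  - 3%:R * 7%:R ^+ 2 * (x * (ev (ss R 5) x * ev (ss R 5) x)))).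
Proof.
have c3 := @conv_ss R 3; have c5 := @conv_ss R 5; have c := conv_s57.
have h1 := conv_convol c3 c3; have h2 := conv_convol c5 c5; have h3 := conv_cpow 3 c3.
have k1 := convZ (10%:R ^+ 2) (conv_mulX h1).
have k2 := convZ (20%:R ^+ 3) (conv_mulX (conv_mulX h3)).
have k3 := convZ (3%:R * 7%:R ^+ 2) (conv_mulX h2).
split; first by apply: convD => //; apply: convD => //; exact: convB.
move=> x hx; rewrite (evD c (convD k1 (convB k2 k3)) hx) (evD k1 (convB k2 k3) hx) (evB k2 k3 hx).
rewrite (evZ _ (conv_mulX h1) hx) (evZ _ (conv_mulX (conv_mulX h3)) hx) (evZ _ (conv_mulX h2) hx).
rewrite (ev_mulX h1 hx) (ev_mulX (conv_mulX h3) hx) (ev_mulX h3 hx) (ev_mulX h2 hx) (ev_convol c3 c3 hx) (ev_convol c5 c5 hx).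
by rewrite (ev_cpow 3 c3 hx) (exprS (ev _ _) 2) (exprS (ev _ _) 1) expr1 mulr1.
Qed.

Lemma dl0 : dl 0 = 1.
Proof. 
have m0 (c : nat -> C) : mulX c 0 = 0 by [].
by rewrite /dl !m0 !mulr0 subrr !addr0 /s57 !sig1. Qed.

(** The norm of Delta/q - 1 at radius 1/120, summed term by term along [delta_tail]. *)
Lemma pser_dl : pser (1/120) (fun x => ev dl x - 1) 1.
Proof.
have r0 : 0 <= 1/120 :> R by lra.
(* Bounds for the tails: 3^4/(1 - 4/120) <= 84 and 3^6/(1 - 6/120) <= 768. *)
pose A : R := 84; pose B : R := 768.
have hA : pser (1/120) (ev (s3 R 3)) A.
  apply: (@pser_s3 _ 3 4) => //; first lra.
  by rewrite ler_pdivrMr /A; lra.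
have hB : pser (1/120) (ev (s3 R 5)) B.
  apply: (@pser_s3 _ 5 6) => //; first lra.
  by rewrite ler_pdivrMr /B; lra.
have o := pser_cst (1/120) (1 : C).
have x1 := pserX r0 o.
have xa := pserX r0 (pserX r0 hA).
have xb := pserX r0 (pserX r0 hB).
have z := pserD r0 (pserZ 9%:R x1) xa.
have y := pserD r0 (pserZ 33%:R x1) xb.
have zz := pserM r0 z z; have yy := pserM r0 y y.
have t1 := pserZ (- 24%:R) x1.
have t2 := pserZ 98%:R (pserX r0 x1).
have t3 := pserZ 12%:R^-1 (pserD r0 (pserZ 5%:R xa) (pserZ 7%:R xb)).
have t4 := pserZ 100%:R (pserX r0 (pserD r0 (pserZ 2%:R xa) zz)).
have t5 := pserZ 20%:R (pserZ 20%:R (pserZ 20%:R (pserX r0 (pserX r0 (pserD r0 (pserM r0 z zz) (pserD r0 (pserZ 3%:R zz) (pserZ 3%:R z))))))).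
have t6 := pserZ (- 147%:R) (pserX r0 (pserD r0 (pserZ 2%:R xb) yy)).
have t := pserD r0 t1 (pserD r0 t2 (pserD r0 t3 (pserD r0 t4 (pserD r0 t5 t6)))).
apply: (pser_ext _ (pser_le t _)); last first.
  by rewrite !nmN !nmV !nm_nat nm1 /A /B; lra.
move=> x hx; rewrite (proj2 dl_ev x hx); have := ev_s57 hx; rewrite !ev_ss // => hk.
by rewrite (delta_tail (nzC R (isT : (0 < 12)%N)) hk).
Qed.

Definition dinv := invs dl.

Lemma dinvP : conv (1/120) dinv /\ forall x, nm x < 1/120 -> ev dl x * ev dinv x = 1.
Proof.
have h0 : 0 < 1/120 :> R by lra.
have h1 : 1/120 < 1 :> R by lra.
exact: (pser_invs h0 h1 (proj1 dl_ev) pser_dl dl0).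
Qed.

Definition Delta (t : C) : C := (E4 t ^+ 3 - E6 t ^+ 2) / 12%:R ^+ 3.

Lemma Delta_q t : upper t -> Delta t = ee t * ev dl (ee t).
Proof.
move=> ut; have hq := nm_ee_lt1 ut; rewrite /Delta /E4 /E6 !ev_ec // !ev_sigc // (proj2 dl_ev _ hq).
rewrite -(delta_id _ (nzC R (isT : (0 < 12)%N)) (ev_s57 hq)) mulNr -!natrM.
by congr (((1 + _ * _) ^+ 3 - (1 - _ * _) ^+ 2) / _).
Qed.

Lemma Delta_T t (n : int) : Delta (t + n%:~R) = Delta t.
Proof. by rewrite /Delta E4_T E6_T. Qed.

Lemma Delta_S t : upper t -> Delta (- t^-1) = t ^+ 12 * Delta t.
Proof.
by move=> ut; rewrite /Delta E4_S // E6_S // (exprMn 3 (t ^+ 4)) (exprMn 2 (t ^+ 6)) -!exprM -mulrBr mulrA.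
Qed.

(** At height at least [y0] one has |q| < 1/120, where Delta/q is invertible with reciprocal [dinv].
    The transformation laws carry nonvanishing to the whole half plane. *)
Lemma Delta_neq0 t : upper t -> Delta t != 0.
Proof.
move=> ut; suff: upper t -> Delta t != 0 by apply.
move: t {ut}; suff: forall t, upper t -> (upper t -> Delta t != 0) by move=> h t ut; exact: h.
apply: reduction => [t ht ut|t j ut h _|t ut h _].
- have [q0 q120] := @q1_small R; have /andP[k0 k1] := @kap_lt1 R.
  have qk : q1 R * kap R <= q1 R by rewrite ler_piMr // ltW.
  have nq : nm (ee t) < 1/120.
    by apply: le_lt_trans (nm_ee_F ht) _; apply: le_lt_trans q120.
  rewrite (Delta_q ut); apply: mulf_neq0; [exact: ee_neq0|apply/eqP => h0].
  by have /eqP := proj2 dinvP _ nq; rewrite h0 mul0r eq_sym oner_eq0.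
- by rewrite -(Delta_T t j); apply: h; exact: upper_T.
- by have := h (upper_S ut); rewrite Delta_S // mulf_eq0 negb_or => /andP[].
Qed.

End Delta2.

(** * Algebraic integers *)

Section AlgInt.
Variable K : fieldType.

Definition aint (z : K) : Prop := integralOver (intmul 1 : int -> K) z.

Lemma aint_nat n : aint n%:R. Proof. exact: integral_nat. Qed.
Lemma aint0 : aint 0. Proof. exact: integral0. Qed.
Lemma aint1 : aint 1. Proof. exact: integral1. Qed.
Lemma aintN x : aint x -> aint (- x). Proof. exact: integral_opp. Qed.
Lemma aintD x y : aint x -> aint y -> aint (x + y). Proof. exact: integral_add. Qed.
Lemma aintB x y : aint x -> aint y -> aint (x - y). Proof. exact: integral_sub. Qed.
Lemma aintM x y : aint x -> aint y -> aint (x * y). Proof. exact: integral_mul. Qed.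
Lemma aint_int (n : int) : aint n%:~R. Proof. exact: integral_id. Qed.

Lemma aintX x n : aint x -> aint (x ^+ n).
Proof. by move=> hx; elim: n => [|n IH]; [exact: aint1|rewrite exprS; exact: aintM]. Qed.

Lemma aint_sum (I : Type) (r : seq I) (P : pred I) (F : I -> K) :
  (forall i, P i -> aint (F i)) -> aint (\sum_(i <- r | P i) F i).
Proof. by move=> h; elim/big_ind: _ => //; [exact: aint0|exact: aintD]. Qed.

Lemma aint_monic (p : {poly K}) x : p \is monic -> (forall i, aint p`_i) -> root p x -> aint x.
Proof. by move=> pm hp px; apply: (integral_root_monic pm px); apply/integral_poly. Qed.

Lemma aint_root n x : (0 < n)%N -> aint (x ^+ n) -> aint x.
Proof.
move=> n0 h; apply: (@aint_monic ('X^n - (x ^+ n)%:P)); first exact: monicXnsubC.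
  move=> i; rewrite coefB coefXn coefC; apply: aintB; first exact: aint_nat.
  by case: ifP => // _; exact: aint0.
by rewrite rootE !hornerE subrr.
Qed.

Lemma aint_horner (p : {poly K}) x : (forall i, aint p`_i) -> aint x -> aint p.[x].
Proof.
move=> hp hx; rewrite horner_coef; apply: aint_sum => i _.
by apply: aintM => //; exact: aintX.
Qed.

(* A root of a polynomial whose leading coefficient is a unit of the ring of algebraic integers. *)
Lemma aint_unit_lead (p : {poly K}) n u x : (forall i, aint p`_i) -> (size p <= n.+1)%N ->
  aint u -> u * p`_n = 1 -> root p x -> aint x.
Proof.
move=> hp sp hu up px; apply: (@aint_monic (u *: p)).
- have pn : p`_n != 0 by apply: contra_eqN up => /eqP ->; rewrite mulr0 eq_sym oner_eq0.
  have u0 : u != 0 by apply: contra_eqN up => /eqP ->; rewrite mul0r eq_sym oner_eq0.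
  have sz : size p = n.+1.
    apply/eqP; rewrite eqn_leq sp /=; rewrite ltnNge; apply: contra pn => h.
    by rewrite nth_default.
  by rewrite monicE lead_coefE size_scale // sz coefZ up.
- by move=> i; rewrite coefZ; exact: aintM.
- by rewrite rootE hornerZ (rootP px) mulr0.
Qed.

End AlgInt.

(** * Level one forms with integral expansions *)

Section LevelOne.
Variable R : realType.
Local Notation C := R[i].
Local Notation T := (twopii R).
Implicit Types c d : nat -> C.

Definition ais c := forall i, aint (c i).

Lemma ais_cst a : aint a -> ais (cst a).
Proof. by move=> h i; rewrite /cst; case: ifP => // _; exact: aint0. Qed.

Lemma ais_convol c d : ais c -> ais d -> ais (convol c d).
Proof. by move=> hc hd n; apply: aint_sum => i _; exact: aintM. Qed.

Lemma ais_cpow c n : ais c -> ais (cpow c n).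
Proof. by move=> h; elim: n => [|n IH]; [exact: ais_cst (aint1 _)|exact: ais_convol]. Qed.

Lemma ais_mulX c : ais c -> ais (mulX c).
Proof. by move=> h [|i]; [exact: aint0|exact: h]. Qed.

Lemma ais_invs c : ais c -> ais (invs c).
Proof.
move=> h; elim/ltn_ind => -[|n] IH; first exact: aint1.
rewrite invsS; apply: aintN; apply: aint_sum => i _; apply: aintM => //.
by apply: IH; rewrite ltnS leq_subr.
Qed.

Lemma ais_ec (a : C) j : aint a -> ais (ec a j).
Proof.
by move=> h i; apply: aintD; [exact: ais_cst (aint1 _) _|apply: aintM => //; exact: aint_nat].
Qed.

Lemma ais_dl : ais (dl R).
Proof.
have h j : ais (ss R j) by move=> i; exact: aint_nat.
move=> i; apply: aintD; first exact: aint_nat.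
apply: aintD; first by apply: aintM; [apply: aintX; exact: aint_nat|apply: ais_mulX; exact: ais_convol].
apply: aintB; apply: aintM.
- by apply: aintX; exact: aint_nat.
- by apply: ais_mulX; apply: ais_mulX; exact: ais_cpow.
- by apply: aintM; [exact: aint_nat|apply: aintX; exact: aint_nat].
- by apply: ais_mulX; exact: ais_convol.
Qed.

Definition jinv (t : C) : C := E4 t ^+ 3 / Delta t.

Lemma convol_low c d s i : (forall k, (k < s)%N -> c k = 0) -> (i < s)%N -> convol c d i = 0.
Proof.
by move=> h hi; rewrite /convol big1 // => k _; rewrite h ?mul0r //; apply: leq_ltn_trans hi; rewrite -ltnS.
Qed.

Lemma convol_lead c d s : (forall k, (k < s)%N -> c k = 0) -> convol c d s = c s * d 0%N.
Proof.
move=> h; rewrite /convol big_ord_recr /= subnn big1 ?add0r // => k _.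
by rewrite h ?mul0r.
Qed.

(* Peel off the leading coefficient with a power of E4^3, then divide by Delta. *)
Lemma level_one m : forall (F : C -> C) c,
  conv (1/120) c -> ais c -> (forall t (j : int), upper t -> F (t + j%:~R) = F t) ->
  (forall t, upper t -> F (- t^-1) = t ^+ (12 * m) * F t) ->
  (forall t, upper t -> nm (ee t) < 1/120 -> F t = ev c (ee t)) ->
  exists P : {poly C}, [/\ forall i, aint P`_i,
    forall s, (s <= m)%N -> (forall i, (i < s)%N -> c i = 0) -> (size P <= (m - s).+1)%N /\ P`_(m - s) = c s &
    forall t, upper t -> F t = Delta t ^+ m * P.[jinv t]].
Proof.
elim: m => [|m IH] F c cc ac FT FS Fq.
  exists (c 0%N)%:P; split=> [i|s|t ut].
  - by rewrite coefC; case: ifP => // _; exact: aint0.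
  - by rewrite leqn0 => /eqP -> _; rewrite subnn size_polyC coefC eqxx; split=> //; exact: leq_b1.
  - rewrite expr0 mul1r hornerC; apply/eqP; rewrite -subr_eq0; apply/eqP.
    apply: (weight0_zero (h := fun t => F t - c 0%N) (c := fun i => c i - cst (c 0%N) i) _ _ _ _ _ ut).
    + by move=> s j us; rewrite FT.
    + by move=> s us; rewrite FS // muln0 expr0 mul1r.
    + by apply: convB => //; exact: conv_cst.
    + by rewrite /cst subrr.
    + by move=> s us hs; rewrite (evB cc (@conv_cst R _ _) hs) ev_cst Fq.
(* E4^(3(m+1)) has weight 12(m+1), integral coefficients and constant term 1, so subtracting c_0
   times it removes the constant term of F. *)
pose e : nat -> C := cpow (ec 240%:R 3) (3 * m.+1).
have h120 : 1/120 <= 1 :> R by lra.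
have p120 : 0 < 1/120 :> R by lra.
have ce : conv (1/120) e.
  by apply: conv_cpow; apply: conv_le h120 _; exact: conv_ec.
have ae : ais e by apply: ais_cpow; apply: ais_ec; exact: aint_nat.
pose c1 i := c i - c 0%N * e i.
have cc1 : conv (1/120) c1 by apply: convB => //; exact: convZ.
have [cw hw] := dinvP R.
have cs : conv (1/120) (shift 1 c1) by exact: conv_shift.
have e0 : e 0%N = 1.
  have E : ec 240%:R 3 0%N = 1 :> C by rewrite /ec /cst /sigc sig0 mulr0 addr0.
  by rewrite /e; elim: (3 * m.+1)%N => [|n IHn]; [rewrite /= /cst|rewrite /= /convol big_ord1 E IHn mul1r].
have c10 : c1 0%N = 0 by rewrite /c1 e0 mulr1 subrr.
(* The numerator vanishes at the cusp and Delta = q + ... has an integral reciprocal up to q, so the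
   quotient is again integral, with weight lowered by 12. *)
pose G t := (F t - c 0%N * E4 t ^+ (3 * m.+1)) / Delta t.
have GE t : G t = (F t - c 0%N * E4 t ^+ (3 * m.+1)) / Delta t by [].
have [|||||P [aP lP hP]] := IH G (convol (shift 1 c1) (dinv R)).
- exact: conv_convol.
- apply: ais_convol; last by apply: ais_invs; exact: ais_dl.
  by move=> i; apply: aintB => //; exact: aintM.
- by move=> t j ut; rewrite !GE (FT _ _ ut) (E4_T t j) (Delta_T t j).
- move=> t ut; rewrite !GE (FS _ ut) (E4_S ut) (Delta_S ut) (exprMn _ (t ^+ 4)) -exprM.
  have -> : (4 * (3 * m.+1) = 12 * m.+1)%N by lia.
  have t0 : t ^+ 12 != 0 by apply: expf_neq0; exact: tau_neq0.
  rewrite mulrCA -mulrBr -mulf_div; congr (_ * _).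
  by rewrite mulnS exprD mulrAC mulfV // mul1r.
- move=> t ut hq; have hq1 : nm (ee t) < 1 by apply: lt_le_trans hq _.
  rewrite (ev_convol cs cw hq) GE (Fq _ ut hq) /E4 -(ev_cpow _ (@conv_ec R _ _) hq1).
  rewrite -/e -(evZ _ ce hq) -(evB cc (convZ _ ce) hq) -/c1 (ev_shift 1 cc1 hq) big_ord1 c10 mul0r add0r expr1.
  rewrite (Delta_q ut) invfM mulrACA mulfV ?ee_neq0 // mul1r; congr (_ * _).
  have u0 : ev (dl R) (ee t) != 0.
    by apply: contra_eqN (hw _ hq) => /eqP ->; rewrite mul0r eq_sym oner_eq0.
  by apply: (mulfI u0); rewrite mulfV // hw.
exists (c 0%N *: 'X^(m.+1) + P); split=> [i|s|t ut].
- by rewrite coefD coefZ coefXn; apply: aintD => //; apply: aintM => //; exact: aint_nat.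
(* An order of vanishing s at the cusp lowers the degree of the polynomial to m + 1 - s. If c_0 = 0,
   nothing is subtracted, and dividing by Delta lowers the order by one while keeping the first
   coefficient. *)
- case: s => [|s] sm hs.
    have [sP _] := lP 0%N isT (fun _ h => False_ind _ (notF h)).
    rewrite subn0 in sP *; split.
      apply: leq_trans (size_polyD _ _) _; rewrite geq_max; apply/andP; split; last exact: leqW.
      by apply: leq_trans (size_scale_leq _ _) _; rewrite size_polyXn.
    by rewrite coefD coefZ coefXn eqxx mulr1 [P`_ _]nth_default ?addr0.
  have c0 : c 0%N = 0 by exact: hs.
  have E : c1 =1 c by move=> i; rewrite /c1 c0 mul0r subr0.
  have lo k : (k < s)%N -> shift 1 c1 k = 0 by move=> ks; rewrite /shift E add1n hs.
  have [||sP lead] := lP s _ _; first by [].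
    by move=> i hi; exact: convol_low lo hi.
  rewrite c0 scale0r add0r subSS; split => //.
  by rewrite lead (convol_lead _ lo) /shift E add1n /dinv /invs /= mulr1.
- have D0 := Delta_neq0 ut; have := hP t ut; rewrite GE; move/(canRL (divfK D0)) => h.
  rewrite hornerD hornerZ hornerXn mulrDr mulrCA -exprMn {1}/jinv mulrCA mulfV // mulr1 -exprM.
  by rewrite exprSr [X in _ = _ + X]mulrAC -h addrC subrK.
Qed.

End LevelOne.

(** * Expansions in q^(1/n) *)

Section Puiseux.
Variable R : realType.
Local Notation C := R[i].
Implicit Types c d : nat -> C.

Definition dil n c i : C := if (n %| i)%N then c (i %/ n)%N else 0.

Lemma conv_dil n c : (0 < n)%N -> conv 1 c -> conv 1 (dil n c).
Proof.
move=> n0 hc r r0 r1.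
have [|B hB] := hc (r ^+ n) (exprn_ge0 _ r0); first by rewrite exprn_ilt1 // -lt0n.
have B0 : 0 <= B by apply: le_trans (hB 0%N); rewrite mulr_ge0 ?nm_ge0 // exprn_ge0 // exprn_ge0.
exists B => i; rewrite /dil; case: ifP => [/divnK E|_]; last by rewrite nm0 mul0r.
by rewrite -{2}E mulnC exprM.
Qed.

Lemma ev_dil n c x : (0 < n)%N -> conv 1 c -> nm x < 1 -> ev (dil n c) x = ev c (x ^+ n).
Proof.
move=> n0 hc hx; rewrite /ev -(@tsum_reindex_inj _ _ _ (fun k => n * k)%N).
- by apply: eq_tsum => i; rewrite /= /dil dvdn_mulr // mulKn // exprM.
- by move=> a b /eqP; rewrite eqn_pmul2l // => /eqP.
- move=> i; rewrite /dil; case: ifP => [/divnK E _|_]; last by rewrite mul0r eqxx.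
  by exists (i %/ n)%N; rewrite mulnC.
- by apply: conv_summable hx; exact: conv_dil.
Qed.

Lemma conv_undil n c : (0 < n)%N -> conv 1 c -> conv 1 (fun k => c (n * k)%N).
Proof.
(* By Bernoulli's inequality s^n >= r, while s < 1; the bound for c at radius s thus serves at r. *)
move=> n0 hc r r0 r1; pose s := 1 - (1 - r) / n%:R.
have n0' : (0 : R) < n%:R by rewrite ltr0n.
have d0 : 0 < (1 - r) / n%:R by rewrite divr_gt0 // subr_gt0.
have d1 : (1 - r) / n%:R <= 1.
  rewrite ler_pdivrMr // mul1r; apply: le_trans (_ : 1 <= _); first lra.
  by rewrite ler1n.
have s0 : 0 <= s by rewrite /s; lra.
have s1 : s < 1 by rewrite /s; lra.
have [B hB] := hc s s0 s1.
have rs : r <= s ^+ n.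
  have E : r = 1 - n%:R * ((1 - r) / n%:R) by rewrite mulrCA mulfV ?gt_eqF // mulr1; ring.
  rewrite {1}E /s; move: ((1 - r) / n%:R) d0 d1 => e d0 d1.
  clear -d0 d1; elim: n e d0 d1 => [|m IH] f f0 f1; first by rewrite expr0 mul0r subr0.
  have := IH f f0 f1; rewrite exprS -natr1 => h.
  have := ler_wpM2l (_ : 0 <= 1 - f) h; rewrite subr_ge0 => /(_ f1).
  have : 0 <= m%:R * (f * f) by rewrite mulr_ge0 // mulr_ge0 // ltW.
  by move: (m%:R : R) ((1 - f) ^+ m) => a b; lra.
exists B => k; apply: le_trans (hB (n * k)%N).
by rewrite exprM ler_wpM2l ?nm_ge0 // lerXn2r ?nnegrE // exprn_ge0 // /s; lra.
Qed.

Lemma ev_undil n c x : (0 < n)%N -> conv 1 c -> (forall i, ~~ (n %| i)%N -> c i = 0) -> nm x < 1 ->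
  ev c x = ev (fun k => c (n * k)%N) (x ^+ n).
Proof.
move=> n0 hc h hx; rewrite -ev_dil //; last exact: conv_undil.
apply: eq_tsum => i; rewrite /dil; case: ifP => [/divnK E|/negbT/h ->] //.
by rewrite mulnC E.
Qed.

Definition tw (z : C) c i := z ^+ i * c i.

Lemma conv_tw z c : nm z = 1 -> conv 1 c -> conv 1 (tw z c).
Proof.
move=> hz hc r r0 r1; have [B hB] := hc r r0 r1; exists B => i.
by rewrite nmM nmX hz expr1n mul1r.
Qed.

Lemma ev_tw z c x : ev (tw z c) x = ev c (z * x).
Proof. by apply: eq_tsum => i; rewrite /tw exprMn mulrAC mulrC. Qed.

Section Level.
Variable n : nat.
Hypothesis n0 : (0 < n)%N.

(** The local parameter q^(1/n). *)
Definition xn (t : C) : C := ee (t / n%:R).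

Lemma nm_xn t : upper t -> nm (xn t) < 1.
Proof. by move=> ut; apply: nm_ee_lt1; rewrite Im_divnat divr_gt0 // ltr0n. Qed.

Lemma xnX t : xn t ^+ n = ee t.
Proof. by rewrite /xn -eeMn -[_ *+ n]mulr_natr divfK // nzC. Qed.

Definition zn : C := ee (1 / n%:R).

Lemma nm_root (z : C) m : (0 < m)%N -> z ^+ m = 1 -> nm z = 1.
Proof.
move=> m0 h; have : nm z ^+ m = 1 by rewrite -nmX h nm1.
by move/eqP; rewrite pexpr_eq1 ?nm_ge0 // => /eqP.
Qed.

Lemma zn_root : zn ^+ n = 1.
Proof. by rewrite /zn -eeMn -[_ *+ n]mulr_natr divfK ?ee1 // nzC. Qed.

Lemma xn_small (e : R) : 0 < e -> exists t, upper t /\ nm (xn t) <= e.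
Proof.
move=> e0; have hi : 0 <= nm (ee 'i : C) < 1 by rewrite nm_ge0 /= nm_ee_lt1 //= ltr01.
have [k hk] := expr_small hi e0; exists ('i *+ k.+1 * n%:R); split.
  rewrite mulr_natr -mulrnA /upper raddfMn /= pmulrn_lgt0 ?ltr01 //.
  by rewrite muln_gt0 n0.
by rewrite /xn mulfK ?nzC // eeMn nmX; exact: hk.
Qed.

Lemma xn_inj c d : conv 1 c -> conv 1 d -> (forall t, upper t -> ev c (xn t) = ev d (xn t)) -> c =1 d.
Proof.
move=> hc hd h; apply: ev_inj hc hd _ => // e e0.
have [t [ut tx]] := xn_small e0; exists (xn t); split=> //; [exact: ee_neq0|exact: h].
Qed.

(* Invariance under t -> t + 1 forces integral powers of q. *)
Lemma T_descent (F : C -> C) c : conv 1 c -> (forall t, upper t -> F t = ev c (xn t)) ->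
  (forall t, upper t -> F (t + 1) = F t) ->
  (forall i, ~~ (n %| i)%N -> c i = 0) /\
  forall t, upper t -> F t = ev (fun k => c (n * k)%N) (ee t).
Proof.
move=> hc hF hT.
have z1 := nm_root n0 zn_root.
(* The translation multiplies the parameter by the root of unity [zn], so invariance says c_i = zn^i
   c_i. *)
have E : c =1 tw zn c.
  apply: xn_inj => // [|t ut]; first exact: conv_tw.
  have E : xn (t + 1) = zn * xn t by rewrite /xn mulrDl eeD [LHS]mulrC.
  have ut1 : upper (t + 1) := upper_T 1 ut.
  rewrite ev_tw; exact: (etrans (esym (hF _ ut)) (etrans (esym (hT _ ut)) (etrans (hF _ ut1) (congr1 (ev c) E)))).
have low i : ~~ (n %| i)%N -> c i = 0.
  move=> hi; apply/eqP/negP => /negP ci; case/negP: hi.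
  have : zn ^+ i = 1 by have := E i; rewrite /tw -{1}[c i]mul1r => /(mulIf ci).
  rewrite /zn -eeMn => /ee_eq1_int [j hj].
  have : (i%:R : C) = (j * n)%:~R.
    rewrite intrM -hj -[1 / _ *+ i]mulr_natl mul1r -pmulrn divfK // nzC //.
  rewrite -[i%:R]/(i%:~R) => /eqP; rewrite eqr_int => /eqP h.
  by have : (n%:Z %| i%:Z)%Z by apply/dvdzP; exists j.
split=> [//|t ut]; rewrite (hF _ ut) -xnX; exact: (ev_undil n0 hc low (nm_xn ut)).
Qed.

(** Holomorphic at the cusp in the parameter q^(1/n), with algebraic-integer coefficients. *)
Definition pui (F : C -> C) := exists c, [/\ conv 1 c, ais c & forall t, upper t -> F t = ev c (xn t)].

Lemma pui_cst a : aint a -> pui (fun=> a).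
Proof. by move=> h; exists (cst a); split; [exact: conv_cst|exact: ais_cst|move=> t _; rewrite ev_cst]. Qed.

Lemma puiD F G : pui F -> pui G -> pui (fun t => F t + G t).
Proof.
move=> [c [c1 ac hc]] [d [d1 ad hd]]; exists (fun i => c i + d i); split.
- exact: convD.
- by move=> i; exact: aintD.
- by move=> t ut; rewrite (evD c1 d1 (nm_xn ut)) hc ?hd.
Qed.

Lemma puiM F G : pui F -> pui G -> pui (fun t => F t * G t).
Proof.
move=> [c [c1 ac hc]] [d [d1 ad hd]]; exists (convol c d); split.
- exact: conv_convol.
- exact: ais_convol.
- by move=> t ut; rewrite (ev_convol c1 d1 (nm_xn ut)) hc ?hd.
Qed.

Lemma pui_ext F G : (forall t, upper t -> G t = F t) -> pui F -> pui G.
Proof. by move=> h [c [c1 ac hc]]; exists c; split=> // t ut; rewrite h ?hc. Qed.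

Lemma puiZ a F : aint a -> pui F -> pui (fun t => a * F t).
Proof. by move=> ha; apply: puiM; exact: pui_cst. Qed.

Lemma puiN F : pui F -> pui (fun t => - F t).
Proof. by move=> /(puiZ (aintN (aint1 _))); apply: pui_ext => t _; rewrite mulN1r. Qed.

Lemma puiX F k : pui F -> pui (fun t => F t ^+ k).
Proof.
move=> h; elim: k => [|k IH]; first by apply: pui_ext (pui_cst (aint1 _)).
by apply: pui_ext (puiM h IH) => t _; rewrite exprS.
Qed.

(* Up to a nonzero constant, the first nonzero Puiseux coefficient is a unit at the exponent s. *)
Definition puil (s : nat) (F : C -> C) := exists c, [/\ conv 1 c, ais c, forall i, (i < s)%N -> c i = 0 &
  (exists2 v, aint v & v * c s = 1) /\ exists2 k : C, k != 0 & forall t, upper t -> F t = k * ev c (xn t)].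

Lemma puilM s1 s2 F G : puil s1 F -> puil s2 G -> puil (s1 + s2) (fun t => F t * G t).
Proof.
move=> [c [c1 ac lc [[v av vc] [k k0 hk]]]] [d [d1 ad ld [[w aw wd] [l l0 hl]]]].
exists (convol c d); split.
- exact: conv_convol.
- exact: ais_convol.
- move=> i hi; rewrite /convol big1 // => a _; case: (ltnP a s1) => [/lc ->|h]; first by rewrite mul0r.
  by rewrite ld ?mulr0 //; have := ltn_ord a; lia.
split; last first.
  exists (k * l); first by rewrite mulf_neq0.
  by move=> t ut; rewrite (ev_convol c1 d1 (nm_xn ut)) hk // hl // mulrACA.
exists (v * w); first exact: aintM.
have h : (s1 < (s1 + s2).+1)%N by rewrite ltnS leq_addr.
rewrite /convol (bigD1 (Ordinal h)) //= addKn big1 ?addr0; first by rewrite mulrACA vc wd mulr1.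
move=> i /eqP hi; case: (ltngtP i s1) => hs; first by rewrite lc ?mul0r.
  by rewrite ld ?mulr0 //; have := ltn_ord i; lia.
by case: hi; exact: val_inj.
Qed.

Lemma puil1 : puil 0 (fun=> 1).
Proof.
exists (cst 1); split=> //; [exact: conv_cst|exact: ais_cst (aint1 _)|].
split; first by exists 1; [exact: aint1|rewrite mul1r].
by exists 1; [exact: oner_neq0|move=> t _; rewrite ev_cst mulr1].
Qed.

Lemma puil_ext s F G : (forall t, upper t -> G t = F t) -> puil s F -> puil s G.
Proof.
move=> h [c [c1 ac lc [hv [k k0 hk]]]]; exists c; split=> //; split=> //.
by exists k => // t ut; rewrite h ?hk.
Qed.

(* A substitution q -> z x^m in an integral power series whose first coefficient is 1. *)
Definition puie (s : nat) (z : C) (F : C -> C) := exists c, [/\ conv 1 c, ais c, forall i, (i < s)%N -> c i = 0 &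
  c s = z /\ forall t, upper t -> F t = ev c (xn t)].

(** The new coefficients are z^i c_i at the exponents m i. As z is a root of unity, it has modulus
    1, which keeps the radius of convergence, and is an algebraic integer. *)
Lemma puie_subst (u : C -> C) (z : C) m l s c : (0 < m)%N -> (0 < l)%N -> z ^+ l = 1 -> conv 1 c -> ais c ->
  (forall i, (i < s)%N -> c i = 0) -> c s = 1 -> (forall t, upper t -> u t = z * xn t ^+ m) ->
  puie (m * s) (z ^+ s) (fun t => ev c (u t)).
Proof.
move=> m0 l0 zl c1 ac lc cs hu; have z1 := nm_root l0 zl.
exists (dil m (tw z c)); split.
- by apply: conv_dil => //; exact: conv_tw.
- move=> i; rewrite /dil; case: ifP => _; last exact: aint0.
  by apply: aintM => //; apply: aintX; apply: (aint_root l0); rewrite zl; exact: aint1.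
- move=> i hi; rewrite /dil /tw; case: ifP => // /divnK E.
  by rewrite lc ?mulr0 // ltn_divLR // mulnC.
split; first by rewrite /dil dvdn_mulr // mulKn // /tw cs mulr1.
by move=> t ut; rewrite (ev_dil m0 (conv_tw z1 c1) (nm_xn ut)) ev_tw (hu _ ut).
Qed.

Lemma puie_pui s z F : puie s z F -> pui F.
Proof. by move=> [c [c1 ac _ [_ h]]]; exists c. Qed.

End Level.

End Puiseux.

(** * Integer matrices of determinant n and the functions attached to them *)

Section Matrices.
Variable R : realType.
Local Notation C := R[i].

Definition m2 := ((int * int) * (int * int))%type.
Definition M2 (a b c d : int) : m2 := ((a, b), (c, d)).
Definition ma (M : m2) : int := M.1.1.
Definition mb (M : m2) : int := M.1.2.
Definition mc (M : m2) : int := M.2.1.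
Definition md (M : m2) : int := M.2.2.

Definition mdet M := ma M * md M - mb M * mc M.
(** Multiplication on the left and on the right by the generators of SL2(Z), the inversion t -> -1/t
    and the translations. *)
Definition lS M : m2 := M2 (- mc M) (- md M) (ma M) (mb M).
Definition lT (k : int) M : m2 := M2 (ma M + k * mc M) (mb M + k * md M) (mc M) (md M).
Definition rS M : m2 := M2 (mb M) (- ma M) (md M) (- mc M).
Definition rT M : m2 := M2 (ma M) (ma M + mb M) (mc M) (mc M + md M).

Lemma det_lS M : mdet (lS M) = mdet M. Proof. by case: M => [[a b] [c d]]; rewrite /mdet /ma /mb /mc /md /=; ring. Qed.
Lemma det_lT k M : mdet (lT k M) = mdet M. Proof. by case: M => [[a b] [c d]]; rewrite /mdet /ma /mb /mc /md /=; ring. Qed.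
Lemma det_rS M : mdet (rS M) = mdet M. Proof. by case: M => [[a b] [c d]]; rewrite /mdet /ma /mb /mc /md /=; ring. Qed.
Lemma det_rT M : mdet (rT M) = mdet M. Proof. by case: M => [[a b] [c d]]; rewrite /mdet /ma /mb /mc /md /=; ring. Qed.

(** Hermite normal forms: upper triangular, a d = n, 0 <= b < d. *)
Definition reps n : seq m2 := [seq M2 (n %/ d)%N%:Z b%:Z 0 d%:Z | d <- [seq d <- iota 1 n | (d %| n)%N], b <- iota 0 d].

Lemma in_reps (n : nat) (a d b : int) : 0 < a -> 0 < d -> a * d = n%:Z -> M2 a (b %% d)%Z 0 d \in reps n.
Proof.
case: a => // a; case: d => // d a0 d0 adn.
have {}adn : (a * d = n)%N by move/eqP: adn; rewrite -PoszM eqz_nat => /eqP.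
have {}d0 : (0 < d)%N by [].
have {}a0 : (0 < a)%N by [].
apply/allpairsPdep; exists d, `|(b %% d%:Z)%Z|%N; split.
- by rewrite mem_filter -adn dvdn_mull //= mem_iota d0 add1n ltnS leq_pmull.
- rewrite mem_iota add0n /=; have := ltz_pmod b (d0 : (0 < d%:Z)); have := modz_ge0 b (lt0r_neq0 (d0 : (0 < d%:Z))).
  by case: (b %% d%:Z)%Z.
- rewrite gez0_abs ?modz_ge0 ?lt0r_neq0 // -adn mulnK //.
Qed.

Lemma repsP n M : M \in reps n -> exists a d b : nat, [/\ (0 < a)%N, (0 < d)%N, (a * d = n)%N & M = M2 a%:Z b%:Z 0 d%:Z].
Proof.
move/allpairsPdep => [d [b [hd _ ->]]]; move: hd; rewrite mem_filter mem_iota add1n ltnS => /and3P[dn d0 dl].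
by exists (n %/ d)%N, d, b; split=> //; [rewrite divn_gt0|exact: divnK].
Qed.

(** Euclid's algorithm on the first column, by induction on |c|: a translation reduces a modulo c
    and the inversion exchanges them. When c = 0, a translation reduces b modulo d. *)
Lemma reduce_mat n (Q : m2 -> Prop) : (0 < n)%N ->
  (forall M, mdet M = n%:Z -> Q (lS M) -> Q M) -> (forall k M, mdet M = n%:Z -> Q (lT k M) -> Q M) ->
  (forall M, M \in reps n -> Q M) -> forall M, mdet M = n%:Z -> Q M.
Proof.
move=> n0 hS hT hR M; have [k] := ubnP `|mc M|%N; elim: k M => // k IH [[a b] [c d]].
rewrite /mdet /ma /mb /mc /md /= ltnS => ck dM.
have [c0|c0] := eqVneq c 0.
  rewrite c0 mulr0 subr0 in dM *.
  have base (a' d' b' : int) : 0 < a' -> 0 < d' -> a' * d' = n%:Z -> Q (M2 a' b' 0 d').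
    move=> a0 d0 h; apply: (hT (- (b' %/ d')%Z)).
      by rewrite /mdet /ma /mb /mc /md /= mulr0 subr0.
    rewrite /lT /ma /mb /mc /md /= mulr0 addr0 (_ : b' + _ = (b' %% d')%Z); last first.
      by rewrite {1}(divz_eq b' d'); ring.
    by apply: hR; exact: in_reps.
  have n0' : 0 < a * d by rewrite dM.
  have [a0|a0|a0] := ltrgt0P a; last by move: n0'; rewrite a0 mul0r ltxx.
    by apply: base => //; rewrite -(pmulr_rgt0 _ a0).
  have d0 : d < 0 by rewrite -(nmulr_rgt0 _ a0).
  (* Two inversions multiply the matrix by -1 and make both diagonal entries positive. *)
  apply: (hS); first by rewrite /mdet /ma /mb /mc /md /= mulr0 subr0.
  apply: hS; first by rewrite /mdet /lS /ma /mb /mc /md /= -dM; ring.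
  rewrite /lS /ma /mb /mc /md /= oppr0; apply: base; rewrite ?oppr_gt0 //.
  by rewrite mulrNN.
apply: (hT (- (a %/ c)%Z)) => //; apply: hS.
  by rewrite /mdet /lT /ma /mb /mc /md /= -dM; ring.
apply: IH.
  rewrite /lS /lT /mc /ma /= (_ : a + _ = (a %% c)%Z); last by rewrite {1}(divz_eq a c); ring.
  apply: leq_trans ck; have := ltz_mod a c0; have := modz_ge0 a c0.
  by case: (a %% c)%Z => // m _; rewrite -abszE ltz_nat.
by rewrite det_lS det_lT.
Qed.

Section Family.
Variables (n k : nat) (f : m2 -> C -> C).
Hypothesis n0 : (0 < n)%N.
Hypothesis k2 : ~~ odd k.
Hypothesis fLS : forall M t, mdet M = n%:Z -> upper t -> f (lS M) t = f M t.
Hypothesis fLT : forall j M t, mdet M = n%:Z -> upper t -> f (lT j M) t = f M t.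
Hypothesis fRS : forall M t, mdet M = n%:Z -> upper t -> f M (- t^-1) = t ^+ k * f (rS M) t.
Hypothesis fRT : forall M t, mdet M = n%:Z -> upper t -> f M (t + 1) = f (rT M) t.

(** Functions are made 0 off the upper half plane, so that agreement on it is equality; duplicates
    in the family can then be removed. *)
Definition cut (g : C -> C) : C -> C := fun t => if upper t then g t else 0.
Definition fam : seq (C -> C) := undup [seq cut (f M) | M <- reps n].

Lemma det_reps M : M \in reps n -> mdet M = n%:Z.
Proof.
move/allpairsPdep => [d [b [hd hb ->]]]; move: hd; rewrite mem_filter => /andP[dn _].
by rewrite /mdet /ma /mb /mc /md /= mulr0 subr0 -PoszM divnK.
Qed.

Lemma fam_mem M : mdet M = n%:Z -> cut (f M) \in fam.
Proof.
apply: (reduce_mat (Q := fun M => cut (f M) \in fam) n0) => [{}M dM|j {}M dM|{}M hM].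
- rewrite (_ : cut (f M) = cut (f (lS M))) //; apply: funext => t.
  by rewrite /cut; case: ifP => // ut; rewrite fLS.
- rewrite (_ : cut (f M) = cut (f (lT j M))) //; apply: funext => t.
  by rewrite /cut; case: ifP => // ut; rewrite fLT.
- by rewrite mem_undup; apply/mapP; exists M.
Qed.

Lemma famP g : g \in fam -> exists2 M, M \in reps n & g = cut (f M).
Proof. by rewrite mem_undup => /mapP. Qed.

Definition aS (g : C -> C) : C -> C := cut (fun t => t ^- k * g (- t^-1)).
Definition aT (g : C -> C) : C -> C := cut (fun t => g (t + 1)).

(** An injective self-map of a finite list without repetition is a permutation of it. *)
Lemma perm_stable (A B : (C -> C) -> C -> C) : {in fam, forall g, A g \in fam} -> {in fam, cancel A B} ->
  perm_eq [seq A g | g <- fam] fam.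
Proof.
move=> h hc; have u : uniq [seq A g | g <- fam].
  by rewrite map_inj_in_uniq ?undup_uniq // => x y hx hy e; rewrite -(hc x hx) e hc.
have sub : {subset [seq A g | g <- fam] <= fam} by move=> y /mapP[x hx ->]; exact: h.
have [_ e] := uniq_min_size u sub (eq_leq (esym (size_map _ _))).
by apply: uniq_perm => //; exact: undup_uniq.
Qed.

(** The weight k action of the inversion sends the function of M to that of M times the inversion,
    again a member by [fam_mem]. It is an involution since k is even. *)
Lemma fam_aS : perm_eq [seq aS g | g <- fam] fam.
Proof.
apply: (@perm_stable aS aS) => g /famP[M hM ->].
  have dM := det_reps hM; rewrite (_ : aS _ = cut (f (rS M))); first by apply: fam_mem; rewrite det_rS.
  apply: funext => t; rewrite /aS /cut; case: ifP => // ut.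
  by rewrite upper_S // fRS // mulKf // expf_neq0 // tau_neq0.
apply: funext => t; rewrite /aS /cut; case: ifP => // ut; have us := upper_S ut.
have t0 : t ^+ k != 0 by apply: expf_neq0; exact: tau_neq0.
have e : (- t^-1) ^- k = t ^+ k.
  by rewrite exprNn -signr_odd (negPf k2) expr0 mul1r exprVn invrK.
by rewrite us upper_S // e invrN invrK opprK mulrA mulVf // mul1r.
Qed.

Lemma fam_aT : perm_eq [seq aT g | g <- fam] fam.
Proof.
have u1 (t : C) (j : int) : upper (t + j%:~R) = upper t by rewrite /upper Im_addint.
apply: (@perm_stable aT (fun g => cut (fun t => g (t - 1)))) => g /famP[M hM ->].
  have dM := det_reps hM; rewrite (_ : aT _ = cut (f (rT M))); first by apply: fam_mem; rewrite det_rT.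
  apply: funext => t; rewrite /aT /cut; case: ifP => // ut.
  by rewrite (u1 t 1) ut fRT.
apply: funext => t; rewrite /aT /cut; case: ifP => // ut.
by rewrite (u1 t (-1)) ut subrK ut.
Qed.

Section Products.
Variables (S : comPzRingType) (phi : C -> S).

(** The values are first sent into a ring S by [phi], so that the same statement serves the product
    of the family and its characteristic polynomial. *)
Lemma prod_fam_T t : upper t -> \prod_(g <- fam) phi (g (t + 1)) = \prod_(g <- fam) phi (g t).
Proof.
move=> ut; rewrite -[RHS](perm_big _ fam_aT) big_map /=; apply: eq_bigr => g _.
by rewrite /aT /cut ut.
Qed.

Lemma prod_fam_S t : upper t -> \prod_(g <- fam) phi (g (- t^-1)) = \prod_(g <- fam) phi (t ^+ k * g t).
Proof.
move=> ut; rewrite -[RHS](perm_big _ fam_aS) big_map /=; apply: eq_bigr => g _.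
by rewrite /aS /cut ut mulVKf // expf_neq0 // tau_neq0.
Qed.

End Products.

Definition fpol (t : C) : {poly C} := \prod_(g <- fam) ('X - (g t)%:P).

Lemma coef_mulXsubC (p : {poly C}) a i : (('X - a%:P) * p)`_i = (if i is i'.+1 then p`_i' else 0) - a * p`_i.
Proof. by rewrite mulrBl coefB coefXM mul_polyC coefZ; case: i. Qed.

(** Coefficient i of the polynomial is homogeneous of degree (number of roots) - i in the roots.
    Hence it is a form of weight k times that degree. *)
Lemma scale_roots (r : seq (C -> C)) t z i : (i <= size r)%N ->
  (\prod_(g <- r) ('X - (z * g t)%:P))`_i = z ^+ (size r - i) * (\prod_(g <- r) ('X - (g t)%:P))`_i.
Proof.
have sz (h : (C -> C) -> C) (s : seq (C -> C)) : size (\prod_(g <- s) ('X - (h g)%:P)) = (size s).+1.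
  by rewrite size_prod_XsubC.
elim: r i => [|g r IH] i; first by rewrite !big_nil leqn0 => /eqP ->; rewrite subnn mul1r.
rewrite !big_cons !coef_mulXsubC /= => hi.
rewrite mulrBr; congr (_ - _).
  by case: i hi => [|i] hi; [rewrite mulr0|rewrite IH // subSS].
case: (ltngtP i (size r).+1) hi => // [hi _|-> _]; last by rewrite !nth_default ?sz ?mulr0.
by rewrite IH // subSn // exprS; ring.
Qed.

Lemma fpol_T t : upper t -> fpol (t + 1) = fpol t.
Proof. exact: (prod_fam_T (fun a => 'X - a%:P)). Qed.

Lemma fpol_S t i : upper t -> (i <= size fam)%N -> (fpol (- t^-1))`_i = t ^+ (k * (size fam - i)) * (fpol t)`_i.
Proof. by move=> ut hi; rewrite /fpol (prod_fam_S (fun a => 'X - a%:P) ut) scale_roots // exprM. Qed.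

Lemma fpol_root M t : mdet M = n%:Z -> upper t -> root (fpol t) (f M t).
Proof.
move=> dM ut; have h := fam_mem dM; rewrite rootE /fpol horner_prod.
by rewrite (perm_big _ (perm_to_rem h)) /= big_cons {1}/cut ut hornerXsubC subrr mul0r.
Qed.

Lemma prod_root M t : mdet M = n%:Z -> upper t -> f M t = 0 -> \prod_(g <- fam) g t = 0.
Proof.
by move=> dM ut h0; rewrite (perm_big _ (perm_to_rem (fam_mem dM))) /= big_cons {1}/cut ut h0 mul0r.
Qed.

Lemma pui_fpol : (forall M, M \in reps n -> pui n (f M)) -> forall i, pui n (fun t => (fpol t)`_i).
Proof.
move=> h; rewrite /fpol; have {h} : forall g, g \in fam -> pui n g.
  move=> g /famP[M hM ->]; apply: pui_ext (h M hM) => t ut; by rewrite /cut ut.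
elim: fam => [|g r IH] h i.
  apply: pui_ext (pui_cst n (aint_nat _ (i == 0%N))) => t _; rewrite big_nil coef1 //.
have hg := h g (mem_head _ _); have {}IH := IH (fun g' h' => h g' (mem_behead (s := g :: r) h')).
apply: (@pui_ext _ _ (fun t => (if i is i'.+1 then (\prod_(g' <- r) ('X - (g' t)%:P))`_i' else 0) + - (g t * (\prod_(g' <- r) ('X - (g' t)%:P))`_i))).
  by move=> t _; rewrite big_cons coef_mulXsubC.
apply: (puiD n0 _ (puiN n0 (puiM n0 hg (IH i)))).
by case: i => [|i]; [exact: pui_cst (aint0 _)|exact: IH].
Qed.

Lemma puil_prod (s : m2 -> nat) : (forall M, M \in reps n -> puil n (s M) (f M)) ->
  exists s', puil n s' (fun t => \prod_(g <- fam) g t).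
Proof.
move=> h; have {h} : forall g, g \in fam -> exists s, puil n s g.
  move=> g /famP[M hM ->]; exists (s M); apply: puil_ext (h M hM) => t ut; by rewrite /cut ut.
elim: fam => [|g r IH] h; first by exists 0%N; apply: puil_ext (puil1 R n) => t _; rewrite big_nil.
have [s1 h1] := h g (mem_head _ _); have [|s2 h2] := IH _.
  by move=> g' h'; apply: h; rewrite inE h' orbT.
by exists (s1 + s2)%N; apply: puil_ext (puilM n0 h1 h2) => t _; rewrite big_cons.
Qed.

End Family.

End Matrices.

(** * The slash operator and the completed E2 *)

Section SlashAlg.
Variable F : fieldType.

Lemma e2s_alg (T t s e : F) : T != 0 -> t != 0 -> s != 0 -> t - s != 0 ->
  (t ^+ 2 * e + 12%:R * t / T) + 12%:R / (T * (- t^-1 - - s^-1)) = t ^+ 2 * (e + 12%:R / (T * (t - s))).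
Proof.
move=> T0 t0 s0 ts; have -> : - t^-1 - - s^-1 = (t - s) / (t * s) by field; rewrite t0 s0.
by field; rewrite T0 t0 s0 ts.
Qed.

Lemma slash_denS (a b c d t : F) : t != 0 -> (c * - t^-1 + d) = t^-1 * (d * t - c).
Proof. by move=> t0; field. Qed.

Lemma slash_ratS (a b c d t : F) : t != 0 -> d * t - c != 0 ->
  (a * - t^-1 + b) / (c * - t^-1 + d) = (b * t - a) / (d * t - c).
Proof. by move=> t0 h; rewrite !slash_denS // invfM invrK mulrACA mulVf // mul1r. Qed.

(** With w = t minus its conjugate, and v = (a/d) w the same difference at the image (a t + b)/d,
    the two nonholomorphic terms coincide because n = a d, and cancel. *)
Lemma phi_alg (n a d T e e' w v : F) : T != 0 -> a != 0 -> d != 0 -> w != 0 -> n = a * d -> v = a / d * w ->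
  n * (e + 12%:R / (T * w)) - n ^+ 2 * (d ^- 2 * (e' + 12%:R / (T * v))) = n * e - a ^+ 2 * e'.
Proof. by move=> T0 a0 d0 w0 -> ->; field; rewrite T0 a0 d0 w0. Qed.

End SlashAlg.

Section Slash.
Variable R : realType.
Local Notation C := R[i].
Local Notation T := (twopii R).

Definition mden (M : m2) (t : C) : C := (mc M)%:~R * t + (md M)%:~R.
Definition mnum (M : m2) (t : C) : C := (ma M)%:~R * t + (mb M)%:~R.
Definition mob M t := mnum M t / mden M t.
(** No power of the determinant is included. *)
Definition sl (k : nat) (F : C -> C) (M : m2) (t : C) : C := mden M t ^- k * F (mob M t).

Lemma lin_neq0 (c d : int) (t : C) : upper t -> (c != 0) || (d != 0) -> c%:~R * t + d%:~R != 0.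
Proof.
move=> ut; have [->|c0 _] := eqVneq c 0 => /=; first by rewrite mul0r add0r intr_eq0.
apply/eqP => h; have := congr1 (@complex.Im R) h; rewrite Im_addint Im_intM /= => /eqP.
by rewrite mulf_eq0 intr_eq0 (negPf c0) /= => /eqP e; move: ut; rewrite /upper e ltxx.
Qed.

Lemma mden_neq0 M t : 0 < mdet M -> upper t -> mden M t != 0.
Proof.
move=> dM ut; apply: lin_neq0 => //; apply: contraTT dM; rewrite negb_or !negbK => /andP[/eqP c0 /eqP d0].
by rewrite /mdet c0 d0 !mulr0 subrr ltxx.
Qed.

Lemma mnum_neq0 M t : 0 < mdet M -> upper t -> mnum M t != 0.
Proof.
move=> dM ut; apply: lin_neq0 => //; apply: contraTT dM; rewrite negb_or !negbK => /andP[/eqP c0 /eqP d0].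
by rewrite /mdet c0 d0 !mul0r subrr ltxx.
Qed.

Lemma Im_div (z w : C) : complex.Im (z / w) = (complex.Im z * complex.Re w - complex.Re z * complex.Im w) / nm w ^+ 2.
Proof. by rewrite nm_sq; case: z w => a b [c d] /=; ring. Qed.

Lemma upper_mob M t : 0 < mdet M -> upper t -> upper (mob M t).
Proof.
move=> dM ut; have h := mden_neq0 dM ut; rewrite /upper /mob Im_div divr_gt0 ?exprn_gt0 ?nm_gt0 //.
rewrite /mnum /mden !Im_addint !Re_addint !Im_intM.
have ReM (z : int) : complex.Re (z%:~R * t) = z%:~R * complex.Re t.
  by rewrite -(rmorph_int (real_complex R)); case: (t) => p q /=; ring.
rewrite !ReM (_ : _ - _ = (mdet M)%:~R * complex.Im t) ?mulr_gt0 ?ltr0z //.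
by rewrite /mdet rmorphB !rmorphM /=; ring.
Qed.

Lemma tconj_neq0 (t : C) : upper t -> t - t^* != 0.
Proof.
case: t => x y; rewrite /upper /= => y0; rewrite eq_complex /= negb_and; apply/orP; right.
by rewrite opprK gt_eqF // addr_gt0.
Qed.

(** Under the inversion the nonholomorphic term contributes - 12 t/T besides the factor t^2, which
    cancels the anomaly of [E2_S]. *)
Lemma E2s_S (t : C) : upper t -> E2s (- t^-1) = t ^+ 2 * E2s t.
Proof.
move=> ut; rewrite /E2s E2_S // rmorphN fmorphV; apply: e2s_alg.
- exact: twopii_neq0.
- exact: tau_neq0.
- by rewrite fmorph_eq0; exact: tau_neq0.
- exact: tconj_neq0.
Qed.

Lemma E2s_T (t : C) (j : int) : E2s (t + j%:~R) = E2s t.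
Proof.
by rewrite /E2s E2_T rmorphD rmorph_int opprD addrACA subrr addr0.
Qed.

Section Laws.
Variables (k : nat) (F : C -> C).
Hypothesis FT : forall t (j : int), upper t -> F (t + j%:~R) = F t.
Hypothesis FS : forall t, upper t -> F (- t^-1) = t ^+ k * F t.

Lemma sl_rS M t : 0 < mdet M -> upper t -> sl k F M (- t^-1) = t ^+ k * sl k F (rS M) t.
Proof.
move=> dM ut; have t0 := tau_neq0 ut; have := mden_neq0 (M := rS M); rewrite det_rS => /(_ t dM ut).
rewrite /sl /mob /mden /mnum; case: M dM => [[a b] [c d]] dM; rewrite /rS /ma /mb /mc /md /= !rmorphN /= => h.
rewrite (slash_ratS _ _ t0 h) slash_denS // exprMn exprVn invfM invrK -mulrA //.
Qed.

Lemma sl_rT M t : 0 < mdet M -> upper t -> sl k F M (t + 1) = sl k F (rT M) t.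
Proof.
move=> dM ut; rewrite /sl /mob /mden /mnum /rT; case: M dM => [[a b] [c d]] dM; rewrite /ma /mb /mc /md /=.
by rewrite !mulrDr !mulr1 -!addrA !rmorphD.
Qed.

Lemma sl_lS M t : 0 < mdet M -> upper t -> sl k F (lS M) t = sl k F M t.
Proof.
move=> dM ut; have d0 := mden_neq0 dM ut; have n0 := mnum_neq0 dM ut.
have E : mob (lS M) t = - (mob M t)^-1.
  rewrite /mob invf_div -mulNr; congr (_ / _); rewrite /mnum /mden /lS /ma /mb /mc /md /=.
  by rewrite !rmorphN mulNr opprD.
rewrite /sl E (FS (upper_mob dM ut)) mulrA; congr (_ * _).
rewrite (_ : mden (lS M) t = mnum M t) // /mob expr_div_n mulrA mulVf ?mul1r //.
exact: expf_neq0.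
Qed.

Lemma sl_lT j M t : 0 < mdet M -> upper t -> sl k F (lT j M) t = sl k F M t.
Proof.
move=> dM ut; have d0 := mden_neq0 dM ut.
have E : mob (lT j M) t = mob M t + j%:~R.
  rewrite /mob -[j%:~R](mulfK d0) -mulrDl; congr (_ / _).
  by rewrite /mnum /mden /lT /ma /mb /mc /md /= !rmorphD !rmorphM /=; ring.
by rewrite /sl E (FT _ (upper_mob dM ut)).
Qed.

End Laws.

End Slash.

(** * Expansions at the triangular representatives *)

Lemma rep_alg (F : fieldType) (x y t : F) : x != 0 -> y != 0 -> x / y * t = t / (x * y) * (x * x).
Proof. by move=> x0 y0; field; rewrite x0 y0. Qed.

Section Reps.
Variable R : realType.
Local Notation C := R[i].
Variable n : nat.
Hypothesis n0 : (0 < n)%N.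

(** Invariance under translation leaves only integral powers of q, after which [level_one] applies;
    the order s in q is the order n s in q^(1/n). *)
Lemma level_one_pui m (F : C -> C) c : conv 1 c -> ais c -> (forall t, upper t -> F t = ev c (xn n t)) ->
  (forall t, upper t -> F (t + 1) = F t) -> (forall t, upper t -> F (- t^-1) = t ^+ (12 * m) * F t) ->
  (forall i, ~~ (n %| i)%N -> c i = 0) /\
  exists P : {poly C}, [/\ forall i, aint P`_i,
    forall s, (s <= m)%N -> (forall i, (i < n * s)%N -> c i = 0) -> (size P <= (m - s).+1)%N /\ P`_(m - s) = c (n * s)%N &
    forall t, upper t -> F t = Delta t ^+ m * P.[jinv t]].
Proof.
move=> c1 ac hF hT hS; have [low hq] := T_descent n0 c1 hF hT; split=> //.
have h120 : 1/120 <= 1 :> R by lra.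
have [||||| P [aP lP hP]] := @level_one R m F (fun k => c (n * k)%N).
- by apply: conv_le h120 _; exact: conv_undil.
- by move=> i; exact: ac.
- by move=> t j ut; rewrite !hq ?eeDint //; exact: upper_T.
- exact: hS.
- by move=> t ut _; exact: hq.
exists P; split=> // s sm hs; apply: lP => // i hi; apply: hs.
by rewrite ltn_pmul2l.
Qed.

Lemma puieM s1 z1 s2 z2 (F G : C -> C) : puie n s1 z1 F -> puie n s2 z2 G ->
  puie n (s1 + s2) (z1 * z2) (fun t => F t * G t).
Proof.
move=> [c [c1 ac lc [vc hk]]] [d [d1 ad ld [wd hl]]]; exists (convol c d); split.
- exact: conv_convol.
- exact: ais_convol.
- move=> i hi; rewrite /convol big1 // => a _; case: (ltnP a s1) => [/lc ->|h]; first by rewrite mul0r.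
  by rewrite ld ?mulr0 //; have := ltn_ord a; lia.
split; last by move=> t ut; rewrite (ev_convol c1 d1 (nm_xn n0 ut)) hk // hl.
have h : (s1 < (s1 + s2).+1)%N by rewrite ltnS leq_addr.
rewrite /convol (bigD1 (Ordinal h)) //= addKn big1 ?addr0 ?vc ?wd //.
move=> i /eqP hi; case: (ltngtP i s1) => hs; first by rewrite lc ?mul0r.
  by rewrite ld ?mulr0 //; have := ltn_ord i; lia.
by case: hi; exact: val_inj.
Qed.

Lemma puieB s1 z1 s2 z2 (F G : C -> C) : (s1 < s2)%N -> puie n s1 z1 F -> puie n s2 z2 G ->
  puie n s1 z1 (fun t => F t - G t).
Proof.
move=> s12 [c [c1 ac lc [vc hk]]] [d [d1 ad ld [wd hl]]]; exists (fun i => c i - d i); split.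
- exact: convB.
- by move=> i; exact: aintB.
- by move=> i hi; rewrite lc // ld ?subr0 //; exact: ltn_trans s12.
split; first by rewrite vc ld ?subr0.
by move=> t ut; rewrite (evB c1 d1 (nm_xn n0 ut)) hk ?hl.
Qed.

Lemma puie_puil s z v k (F G : C -> C) : aint v -> v * z = 1 -> k != 0 ->
  (forall t, upper t -> G t = k * F t) -> puie n s z F -> puil n s G.
Proof.
move=> av vz k0 h [c [c1 ac lc [vc hk]]]; exists c; split=> //; split; first by exists v; rewrite ?vc.
by exists k => // t ut; rewrite h ?hk.
Qed.

Lemma cpow0 (c : nat -> C) m : c 0%N = 1 -> cpow c m 0 = 1.
Proof. by move=> h; elim: m => [//|m IH]; rewrite /= /convol big_ord1 h IH mul1r. Qed.

Lemma ec0 (a : C) j : ec a j 0 = 1. Proof. by rewrite /ec /cst /sigc sig0 mulr0 addr0. Qed.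

Section Rep.
Variables a d b : nat.
Hypotheses (a0 : (0 < a)%N) (d0 : (0 < d)%N) (adn : (a * d = n)%N).
Let M := M2 a%:Z b%:Z 0 d%:Z.
Definition zeta : C := ee (b%:R / d%:R).

Lemma zetaX : zeta ^+ d = 1.
Proof. by rewrite /zeta -eeMn -[_ *+ d]mulr_natr divfK ?ee_nat // nzC. Qed.

Lemma mden_rep (t : C) : mden M t = d%:R.
Proof. by rewrite /mden /M /mc /md /= mul0r add0r. Qed.

Lemma mob_rep (t : C) : mob M t = a%:R / d%:R * t + b%:R / d%:R :> C.
Proof. by rewrite /mob mden_rep /mnum /M /ma /mb /= mulrDl mulrAC. Qed.

(** At (a t + b)/d the parameter q becomes zeta q^(a/d), and a/d = a^2/n. *)
Lemma ee_mob (t : C) : upper t -> ee (mob M t) = zeta * xn n t ^+ (a * a).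
Proof.
move=> ut; rewrite mob_rep eeD [LHS]mulrC /xn -eeMn; congr (_ * ee _).
rewrite -[_ *+ (a * a)]mulr_natr -adn !natrM.
exact: rep_alg (nzC R a0) (nzC R d0).
Qed.

Lemma puie_mob s (c : nat -> C) : conv 1 c -> ais c -> (forall i, (i < s)%N -> c i = 0) -> c s = 1 ->
  puie n (a * a * s) (zeta ^+ s) (fun t => ev c (ee (mob M t))).
Proof.
move=> c1 ac lc cs; apply: (@puie_subst _ n n0 (fun t => ee (mob M t)) zeta (a * a) d) => //.
- by rewrite muln_gt0 a0.
- exact: zetaX.
- exact: ee_mob.
Qed.

Lemma puie_q s (c : nat -> C) : conv 1 c -> ais c -> (forall i, (i < s)%N -> c i = 0) -> c s = 1 ->
  puie n (n * s) 1 (fun t => ev c (ee t)).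
Proof.
move=> c1 ac lc cs; rewrite -(expr1n C s).
apply: (@puie_subst _ n n0 (fun t => ee t) 1 n 1) => // t ut.
by rewrite mul1r xnX.
Qed.

End Rep.
End Reps.

(** * Integrality of j at fixed points *)

Lemma slash_pair (F : fieldType) (u e s s' d : F) :
  u * e * (u * s) - u * s' * (u * d) = u * u * (e * s - s' * d).
Proof. by ring. Qed.

Section Singular.
Variable R : realType.
Local Notation C := R[i].
Local Notation T := (twopii R).

Definition E43 (t : C) : C := E4 t ^+ 3.

Lemma E43_T t (j : int) : E43 (t + j%:~R) = E43 t. Proof. by rewrite /E43 E4_T. Qed.

Lemma E43_S t : upper t -> E43 (- t^-1) = t ^+ 12 * E43 t.
Proof. by move=> ut; rewrite /E43 E4_S // (exprMn 3 (t ^+ 4)) -exprM. Qed.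

Definition e43 : nat -> C := cpow (ec 240%:R 3) 3.

Lemma E43_q t : upper t -> E43 t = ev e43 (ee t).
Proof. by move=> ut; rewrite /E43 /e43 (ev_cpow 3 (@conv_ec R _ _) (nm_ee_lt1 ut)). Qed.

Lemma conv_e43 : conv 1 e43. Proof. by apply: conv_cpow; exact: conv_ec. Qed.
Lemma ais_e43 : ais e43. Proof. by apply: ais_cpow; apply: ais_ec; exact: aint_nat. Qed.
Lemma e430 : e43 0 = 1. Proof. by apply: cpow0; exact: ec0. Qed.

Definition dq : nat -> C := mulX (dl R).

Lemma Delta_dq t : upper t -> Delta t = ev dq (ee t).
Proof. by move=> ut; rewrite (Delta_q ut) (ev_mulX (proj1 (dl_ev R)) (nm_ee_lt1 ut)). Qed.

Lemma conv_dq : conv 1 dq. Proof. by apply: conv_mulX; exact: (proj1 (dl_ev R)). Qed.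
Lemma ais_dq : ais dq. Proof. by apply: ais_mulX; exact: ais_dl. Qed.
Lemma dq0 i : (i < 1)%N -> dq i = 0. Proof. by case: i. Qed.
Lemma dq1 : dq 1 = 1. Proof. exact: dl0. Qed.

Section Level.
Variable n : nat.
Hypothesis n0 : (0 < n)%N.

Lemma det_gt0 M : mdet M = n%:Z -> 0 < mdet M. Proof. by move=> ->; rewrite ltz_nat. Qed.

(** Equal to Delta(t) (Delta|M)(t) (j(t) - j(M t)), cleared of denominators: a form of weight 24
    that vanishes where M fixes t. *)
Definition fG (M : m2) (t : C) : C := E43 t * sl 12 (@Delta R) M t - sl 12 E43 M t * Delta t.

Lemma fG_lS M t : mdet M = n%:Z -> upper t -> fG (lS M) t = fG M t.
Proof. by move=> dM ut; rewrite /fG (sl_lS (@Delta_S R) (det_gt0 dM) ut) (sl_lS E43_S (det_gt0 dM) ut). Qed.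

Lemma fG_lT j M t : mdet M = n%:Z -> upper t -> fG (lT j M) t = fG M t.
Proof.
move=> dM ut; rewrite /fG (sl_lT 12 (fun t j _ => Delta_T t j) _ (det_gt0 dM) ut).
by rewrite (sl_lT 12 (fun t j _ => E43_T t j) _ (det_gt0 dM) ut).
Qed.

Lemma fG_rS M t : mdet M = n%:Z -> upper t -> fG M (- t^-1) = t ^+ 24 * fG (rS M) t.
Proof.
move=> dM ut; rewrite /fG (sl_rS 12 _ (det_gt0 dM) ut) (sl_rS 12 _ (det_gt0 dM) ut) (E43_S ut) (Delta_S ut).
rewrite (exprD t 12 12); exact: slash_pair.
Qed.

Lemma fG_rT M t : mdet M = n%:Z -> upper t -> fG M (t + 1) = fG (rT M) t.
Proof.
move=> dM ut; rewrite /fG (sl_rT 12 _ (det_gt0 dM) ut) (sl_rT 12 _ (det_gt0 dM) ut).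
by rewrite (E43_T t 1) (Delta_T t 1).
Qed.

Hypothesis nsq : forall a, (a * a != n)%N.

(** Up to the factor d^-12, the first product starts at exponent a^2 of q^(1/n) with the root of
    unity zeta, the second at exponent n with 1. Since n is not a square, the exponents differ, so
    the lower one survives the subtraction with a unit coefficient. *)
Lemma puil_fG M : M \in reps n -> exists s, puil n s (fG M).
Proof.
move/repsP => [a [d [b [a0 d0 adn ->]]]].
have dM : mdet (M2 a%:Z b%:Z 0 d%:Z) = n%:Z by rewrite /mdet /ma /mb /mc /md /= mulr0 subr0 -PoszM adn.
have h1 := puie_q n0 conv_e43 ais_e43 (fun i (h : (i < 0)%N) => False_ind _ (notF h)) e430.
have h4 := puie_q n0 conv_dq ais_dq dq0 dq1.
have h2 := puie_mob n0 b a0 d0 adn conv_dq ais_dq dq0 dq1.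
have h3 := puie_mob n0 b a0 d0 adn conv_e43 ais_e43 (fun i (h : (i < 0)%N) => False_ind _ (notF h)) e430.
have g1 := puieM n0 h1 h2; have g2 := puieM n0 h3 h4.
have z1 := zetaX R b d0; have zi : zeta R d b ^- 1 * zeta R d b ^+ 1 = 1.
  by rewrite expr1 mulVf // /zeta ee_neq0.
have av : aint (zeta R d b ^- 1).
  by apply: (aint_root d0); rewrite expr1 exprVn z1 invr1; exact: aint1.
have d0' : (d%:R : C) ^- 12 != 0 by rewrite invr_neq0 // expf_neq0 // nzC.
have E t : upper t -> fG (M2 a%:Z b%:Z 0 d%:Z) t = d%:R ^- 12 *
  (ev e43 (ee t) * ev dq (ee (mob (M2 a%:Z b%:Z 0 d%:Z) t)) - ev e43 (ee (mob (M2 a%:Z b%:Z 0 d%:Z) t)) * ev dq (ee t)).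
  move=> ut; have um := upper_mob (det_gt0 dM) ut.
  rewrite /fG /sl mden_rep (E43_q ut) (E43_q um) (Delta_dq ut) (Delta_dq um).
  by rewrite mulrBr; congr (_ - _); [exact: mulrCA|rewrite mulrA].
rewrite !muln0 !muln1 add0n mul1r in g1; rewrite !muln0 !muln1 add0n expr0 mulr1 in g2.
case: (ltngtP (a * a) n) => h.
- exists (a * a)%N; exact: (puie_puil av zi d0' E (puieB n0 h g1 g2)).
- exists n; apply: (puie_puil (aint1 _) (mulr1 1) (_ : - d%:R ^- 12 != 0) _ (puieB n0 h g2 g1)); first by rewrite oppr_eq0.
  by move=> t ut; rewrite (E _ ut) mulNr -mulrN opprB.
- by case/eqP: (nsq a).
Qed.

Lemma fG_fix (tau : C) M : mob M tau = tau -> fG M tau = 0.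
Proof. by move=> h; rewrite /fG /sl h mulrCA mulrA subrr. Qed.

(** The product over the family is a level one form of weight 24 N that vanishes at tau, and after
    scaling its expansion is integral with a unit as first coefficient. Its polynomial in j
    therefore has a unit leading coefficient and the root j(tau). *)
Lemma j_integral (tau : C) M : upper tau -> mdet M = n%:Z -> mob M tau = tau -> aint (jinv tau).
Proof.
move=> ut dM fixM.
pose L := fam n fG; pose N := size L; pose F t := \prod_(g <- L) g t.
have [s hs] : exists s, puil n s F.
  have [s hs] : exists s : m2 -> nat, forall M, M \in reps n -> puil n (s M) (fG M).
    suff /choice[s hs] : forall M, exists s, M \in reps n -> puil n s (fG M) by exists s.
    move=> M'; case hM: (M' \in reps n); last by exists 0%N.
    by have [s hs] := puil_fG hM; exists s.
  exact: (puil_prod n0 hs).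
have [c [c1 ac lc [[v av vc] [k k0 hk]]]] := hs.
(* Dividing by the constant k restores the integral expansion c. *)
have kF t : upper t -> k^-1 * F t = ev c (xn n t) by move=> ut'; rewrite hk // mulKf.
have FT t : upper t -> F (t + 1) = F t.
  move=> ut'; exact: (prod_fam_T n0 fG_lS fG_lT fG_rT id ut').
have FS t : upper t -> F (- t^-1) = t ^+ (12 * (2 * N)) * F t.
  move=> ut'; rewrite /F (prod_fam_S n0 (isT : ~~ odd 24) fG_lS fG_lT fG_rS id ut') big_split /=.
  by rewrite big_const_seq count_predT iter_mulr_1 -exprM mulnA.
have [||low [P [aP lP hP]]] := @level_one_pui R n n0 (2 * N) (fun t => k^-1 * F t) c c1 ac kF.
- by move=> t ut'; rewrite (FT _ ut').
- by move=> t ut'; rewrite (FS _ ut') mulrCA.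
have cs0 : c s != 0 by apply: contra_eqN vc => /eqP ->; rewrite mulr0 eq_sym oner_eq0.
have sE : (s = n * (s %/ n))%N.
  by rewrite mulnC divnK //; apply: contraR cs0 => /low ->.
have F0 : k^-1 * F tau = 0.
  by rewrite /F (prod_root n0 fG_lS fG_lT dM ut (fG_fix fixM)) mulr0.
case: (leqP (s %/ n) (2 * N)) => hsm.
  have [|sP lead] := lP _ hsm; first by rewrite -sE.
  apply: (aint_unit_lead aP sP av); first by rewrite lead -sE.
  apply/rootP; have := hP _ ut; rewrite F0 => /esym/eqP.
  by rewrite mulf_eq0 expf_eq0 (negPf (Delta_neq0 ut)) andbF /= => /eqP.
(* A higher order of vanishing would make P zero, hence the whole expansion zero, although c_s is a
   unit. *)
have [|sP lead] := lP (2 * N)%N (leqnn _).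
  by move=> i hi; apply: lc; rewrite sE; apply: leq_trans hi _; rewrite leq_pmul2l // ltnW.
have P0 : P = 0.
  rewrite subnn in sP lead; rewrite (size1_polyC sP) lead lc ?polyC0 //.
  by rewrite [X in (_ < X)%N]sE ltn_pmul2l.
have h : c s = cst 0 s.
  apply: (xn_inj n0 c1 (@conv_cst R 1 0)) => t ut'.
  by rewrite ev_cst -(kF _ ut') (hP _ ut') P0 horner0 mulr0.
by case/eqP: cs0; rewrite h /cst; case: ifP.
Qed.

End Level.
End Singular.

(** * Integrality of the weight 2 combinations *)

Lemma phi_slash (F : fieldType) (n u e s : F) : (n * (u ^+ 2 * e) - n ^+ 2 * (u ^+ 2 * s)) ^+ 6 = u ^+ 12 * (n * e - n ^+ 2 * s) ^+ 6.
Proof. by ring. Qed.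

Lemma clear_den (F : fieldType) (x y c f : F) : x != 0 -> y != 0 -> x * y * (c / x * (f / y)) = c * f.
Proof. by move=> x0 y0; field; rewrite x0 y0. Qed.

Section Quasi.
Variable R : realType.
Local Notation C := R[i].
Local Notation T := (twopii R).
Variable n : nat.
Hypothesis n0 : (0 < n)%N.

Definition phi (M : m2) (t : C) : C := n%:R * E2s t - n%:R ^+ 2 * sl 2 (@E2s R) M t.
(** The sixth power brings the weight from 2 to 12, the weight of Delta. *)
Definition fP (M : m2) (t : C) : C := phi M t ^+ 6.

Lemma fP_lS M t : mdet M = n%:Z -> upper t -> fP (lS M) t = fP M t.
Proof. by move=> dM ut; rewrite /fP /phi (sl_lS (@E2s_S R) (det_gt0 n0 dM) ut). Qed.

Lemma fP_lT j M t : mdet M = n%:Z -> upper t -> fP (lT j M) t = fP M t.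
Proof. by move=> dM ut; rewrite /fP /phi (sl_lT 2 (fun t j _ => E2s_T t j) _ (det_gt0 n0 dM) ut). Qed.

Lemma fP_rS M t : mdet M = n%:Z -> upper t -> fP M (- t^-1) = t ^+ 12 * fP (rS M) t.
Proof.
move=> dM ut; rewrite /fP /phi (sl_rS 2 _ (det_gt0 n0 dM) ut) (E2s_S ut).
exact: phi_slash.
Qed.

Lemma fP_rT M t : mdet M = n%:Z -> upper t -> fP M (t + 1) = fP (rT M) t.
Proof. by move=> dM ut; rewrite /fP /phi (sl_rT 2 _ (det_gt0 n0 dM) ut) (E2s_T t 1). Qed.

Lemma conj_lin (u v t : C) : Num.conj u = u -> Num.conj v = v -> (u * t + v) - (u * t + v)^* = u * (t - t^*).
Proof.
have eD : Num.conj (u * t + v) = Num.conj u * Num.conj t + Num.conj v by rewrite rmorphD rmorphM.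
by move=> hu hv; rewrite eD hu hv opprD addrACA subrr addr0 mulrBr.
Qed.

(** By [phi_alg] the function is holomorphic here: phi = n E2(t) - a^2 E2((a t + b)/d), and both
    terms have integral expansions in q^(1/n). *)
Lemma pui_fP M : M \in reps n -> pui n (fP M).
Proof.
move/repsP => [a [d [b [a0 d0 adn ->]]]].
have dM : mdet (M2 a%:Z b%:Z 0 d%:Z) = n%:Z by rewrite /mdet /ma /mb /mc /md /= mulr0 subr0 -PoszM adn.
have ae : ais (ec (- 24%:R : C) 1) by apply: ais_ec; apply: aintN; exact: aint_nat.
have ce := conv_le (lexx 1) (@conv_ec R (- 24%:R) 1).
have l0 i : (i < 0)%N -> ec (- 24%:R : C) 1 i = 0 by [].
have h1 := puie_pui (puie_q n0 ce ae l0 (ec0 _ _)).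
have h2 := puie_pui (puie_mob n0 b a0 d0 adn ce ae l0 (ec0 _ _)).
apply: (puiX n0 6); apply: (pui_ext _ (puiD n0 (puiZ n0 (aint_nat _ n) h1) (puiN n0 (puiZ n0 (aintX 2 (aint_nat _ a)) h2)))).
move=> t ut /=; rewrite /phi /sl mden_rep; apply: phi_alg.
- exact: twopii_neq0.
- exact: nzC.
- exact: nzC.
- exact: (tconj_neq0 ut).
- by rewrite -natrM adn.
- rewrite mob_rep; apply: conj_lin.
  + by rewrite fmorph_div !rmorph_nat.
  + by rewrite fmorph_div !rmorph_nat.
Qed.

(** The value of [fP] is a root of the monic [fpol], whose coefficient i has weight 12 (N - i) and
    so equals Delta^(N-i) P_i(j). Dividing the root by Delta leaves a monic equation with
    coefficients P_i(j(tau)), integral because j(tau) is. *)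
Lemma phi_integral tau M : upper tau -> mdet M = n%:Z -> aint (jinv tau) -> aint (fP M tau / Delta tau).
Proof.
move=> ut dM aj; have D0 := Delta_neq0 ut.
pose N := size (fam n fP); pose b i := (fpol n fP tau)`_i / Delta tau ^+ (N - i).
have ab i : (i <= N)%N -> aint (b i).
  move=> hi; have [c [c1 ac hc]] := pui_fpol n0 pui_fP i.
  have [||low [P [aP lP hP]]] := @level_one_pui R n n0 (N - i) _ c c1 ac hc.
  - by move=> t ut'; rewrite (fpol_T n0 fP_lS fP_lT fP_rT ut').
  - by move=> t ut'; rewrite (fpol_S n0 (isT : ~~ odd 12) fP_lS fP_lT fP_rS ut' hi).
  rewrite /b (hP _ ut) mulrAC mulfV ?expf_neq0 // mul1r.
  exact: aint_horner.
have sz : size (fpol n fP tau) = N.+1 by rewrite /fpol size_prod_XsubC.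
have bN : b N = 1.
  rewrite /b subnn expr0 divr1; have := monic_prod_XsubC (fam n fP) xpredT (fun g => g tau).
  by rewrite monicE lead_coefE -/(fpol n fP tau) sz => /eqP.
have sp : size (\poly_(i < N.+1) b i) = N.+1.
  by apply: size_poly_eq; rewrite bN oner_neq0.
apply: (@aint_monic _ (\poly_(i < N.+1) b i)).
- by rewrite monicE lead_coefE sp coef_poly ltnSn bN.
- by move=> i; rewrite coef_poly; case: ltnP => hi; [exact: ab|exact: aint0].
apply/rootP/eqP; rewrite -(mulrI_eq0 _ (mulfI (expf_neq0 N D0))).
have := fpol_root n0 fP_lS fP_lT dM ut; rewrite rootE horner_coef sz => /eqP <-.
rewrite horner_poly mulr_sumr; apply/eqP; apply: eq_bigr => i _.
have hi : (i <= N)%N by rewrite -ltnS.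
have -> : Delta tau ^+ N = Delta tau ^+ (N - i) * Delta tau ^+ i by rewrite -exprD subnK.
rewrite /b (expr_div_n (fP M tau)).
by apply: clear_den; exact: expf_neq0.
Qed.

End Quasi.

(** * The values at a quadratic point *)

(** The right side is (a c)^2 (e/h) (c t - a/t), and the quadratic equation gives - a/t = b + c
    t. *)
Lemma sqrtD_alg (F : fieldType) (a b c t e h : F) : c != 0 -> t != 0 -> h != 0 -> a = - (b * t + c * t ^+ 2) ->
  (2%:R * c * t + b) * (e / h) * (a * c) ^+ 2 =
  a * c * (c * t) * ((a * c * e - (a * c) ^+ 2 * ((c * t) ^- 2 * e)) / h).
Proof. by move=> c0 t0 h0 ->; field; rewrite c0 t0 h0. Qed.

Section Main.
Variable R : realType.
Local Notation C := R[i].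
Variables (tau : C) (a b c : int).
Hypothesis ut : upper tau.
Hypothesis quad : a%:~R + (b%:~R * tau + c%:~R * (tau * tau)) = 0.
Hypothesis c0 : 0 < c.

Lemma disc_gt0 : 0 < 4 * (a * c) - b * b.
Proof.
have := congr1 (@complex.Im R) quad; have := congr1 (@complex.Re R) quad.
rewrite -!(rmorph_int (real_complex R)); move: ut; rewrite /upper; case: (tau) => x y /= y0 h1 h2.
have c0' : (0 : R) < c%:~R by rewrite ltr0z.
have B : (b%:~R : R) = - (2 * c%:~R * x).
  apply: (mulIf (lt0r_neq0 y0)); apply/eqP; rewrite -subr_eq0; apply/eqP.
  by rewrite -[RHS]h2; ring.
have A : (a%:~R : R) = c%:~R * (x * x + y * y).
  apply/eqP; rewrite -subr_eq0; apply/eqP; rewrite -[RHS]h1 B; ring.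
rewrite -(ltr0z R) rmorphB !rmorphM /= A B.
have -> : 4%:~R * (c%:~R * (x * x + y * y) * c%:~R) - - (2 * c%:~R * x) * - (2 * c%:~R * x) = 4 * (c%:~R * y) ^+ 2 :> R by ring.
by rewrite mulr_gt0 // exprn_gt0 // mulr_gt0.
Qed.

Lemma ac_gt0 : 0 < a * c.
Proof. by have := disc_gt0; nia. Qed.

(** The matrix with rows (x - b, - a) and (c, x) fixes tau for every x, and its determinant N
    satisfies 4 N = (2x - b)^2 + D with D = 4 a c - b^2 > 0. The choice x = D + |b| gives 2x - b >=
    D, so 4 N lies strictly between two consecutive squares and N is not a square. *)
Lemma tau_j_integral : aint (jinv tau).
Proof.
have D0 := disc_gt0; pose D := 4 * (a * c) - b * b; pose x := D + `|b|.
pose N := x * x - b * x + a * c.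
have E : 4 * N = (2 * x - b) ^+ 2 + D by rewrite /N /D; ring.
have N0 : 0 < N.
  suff : 0 < 4 * N by rewrite pmulr_rgt0.
  by rewrite E ltr_wpDl // sqr_ge0.
have hn : `|N|%N%:Z = N by rewrite gez0_abs // ltW.
have n0 : (0 < `|N|)%N by rewrite -ltz_nat hn.
have yD : D <= 2 * x - b by rewrite /x; move: D0; rewrite -/D => D0'; have := ler_norm b; have := normr_ge0 b; lia.
apply: (@j_integral R `|N|%N n0 _ tau (M2 (x - b) (- a) c x)) => //.
- move=> k; apply/eqP => hk.
  have hk' : (2 * k%:Z) ^+ 2 = (2 * x - b) ^+ 2 + D by rewrite -E -hn -hk PoszM; ring.
  move: yD hk' D0; rewrite -/D; move: (2 * x - b) (D) => y d yd hk' d0.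
  have h1 : y < 2 * k%:Z by rewrite -(ltr_pXn2r (n := 2)) ?nnegrE //; lia.
  have h2 : (y + 1) ^+ 2 <= (2 * k%:Z) ^+ 2 by rewrite lerXn2r ?nnegrE //; lia.
  have h3 : (y + 1) ^+ 2 = y ^+ 2 + 2 * y + 1 by ring.
  by rewrite hk' h3 in h2; move: (y ^+ 2) h2 => z h2; lia.
- by rewrite hn /mdet /ma /mb /mc /md /= /N; ring.
- rewrite /mob; have dn : mden (M2 (x - b) (- a) c x) tau != 0.
    by apply: lin_neq0 => //; rewrite /mc /M2 /= (gt_eqF c0).
  apply: (mulIf dn); rewrite divfK // /mnum /mden /M2 /ma /mb /mc /md /= rmorphB rmorphN /=.
  apply/eqP; rewrite -subr_eq0; apply/eqP; rewrite -[RHS]oppr0 -[X in _ = - X]quad; ring.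
Qed.

Variable eta : C.
Hypothesis heta : 12%:R ^+ 3 * eta ^+ 24 = E4 tau ^+ 3 - E6 tau ^+ 2.

Lemma eta_Delta : eta ^+ 24 = Delta tau.
Proof. by rewrite /Delta -heta mulrAC mulfV ?mul1r // expf_neq0 // nzC. Qed.

Lemma eta_neq0 k : eta ^+ k != 0.
Proof.
apply: expf_neq0; apply: contra (Delta_neq0 ut) => /eqP e.
by rewrite -eta_Delta e expr0n.
Qed.

Lemma E4_integral : aint (E4 tau / eta ^+ 8).
Proof.
apply: (@aint_root _ 3) => //; rewrite expr_div_n -exprM eta_Delta; exact: tau_j_integral.
Qed.

(** The square is j(tau) - 1728. *)
Lemma E6_integral : aint (E6 tau / eta ^+ 12).
Proof.
apply: (@aint_root _ 2) => //; rewrite expr_div_n -exprM eta_Delta.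
have -> : E6 tau ^+ 2 = E4 tau ^+ 3 - 12%:R ^+ 3 * Delta tau by rewrite -eta_Delta heta opprB addrC subrK.
rewrite mulrBl mulfK ?Delta_neq0 //; apply: aintB; first exact: tau_j_integral.
by apply: aintX; exact: aint_nat.
Qed.

(** C tau is a root of X^2 + b X + a c. *)
Lemma ctau_integral : aint (c%:~R * tau).
Proof.
pose s : seq C := [:: (a * c)%:~R; b%:~R; 1].
apply: (@aint_unit_lead _ (Poly s) 2 1) => [i||||].
- rewrite coef_Poly /s; case: i => [|[|[|i]]] /=; [exact: aint_int|exact: aint_int|exact: aint1|].
  by rewrite nth_nil; exact: aint0.
- exact: size_Poly.
- exact: aint1.
- by rewrite coef_Poly mul1r.
- apply/rootP; rewrite horner_Poly /s /= rmorphM /= mul0r add0r mul1r.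
  by rewrite -[RHS](mulr0 c%:~R) -[X in _ = _ * X]quad; ring.
Qed.

(** The matrix with rows (- b, - a) and (c, 0) fixes tau, with denominator c tau and determinant a c
    > 0. Then phi/eta^4 is integral, its sixth power being phi^6/Delta, and [sqrtD_alg] writes the
    number as a c times c tau times phi/eta^4. *)
Lemma E2_integral : aint ((2%:R * c%:~R * tau + b%:~R) * (E2s tau / eta ^+ 4) * (a%:~R * c%:~R) ^+ 2).
Proof.
have t0 := tau_neq0 ut; have cn : (c%:~R : C) != 0 by rewrite intr_eq0 gt_eqF.
have ac0 := ac_gt0; pose n := absz (a * c).
have hn : n%:Z = a * c by rewrite /n gez0_abs // ltW.
have n0 : (0 < n)%N by rewrite -ltz_nat hn.
pose M := M2 (- b) (- a) c 0.
have dM : mdet M = n%:Z by rewrite hn /M /mdet /ma /mb /mc /md /=; ring.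
have dE : mden M tau = c%:~R * tau by rewrite /mden /M /mc /md /= addr0.
have mE : mob M tau = tau.
  rewrite /mob dE; apply: (mulIf (mulf_neq0 cn t0)); rewrite divfK ?mulf_neq0 //.
  rewrite /mnum /M /ma /mb /= !rmorphN /=.
  by apply/eqP; rewrite -subr_eq0; apply/eqP; rewrite -[RHS]oppr0 -[X in _ = - X]quad; ring.
have h := phi_integral n0 ut dM tau_j_integral.
have nE : (n%:R : C) = a%:~R * c%:~R by rewrite -intrM -hn.
have aE : (a%:~R : C) = - (b%:~R * tau + c%:~R * tau ^+ 2) by apply/eqP; rewrite -addr_eq0; apply/eqP.
have hp : aint (phi n M tau / eta ^+ 4).
  by apply: (@aint_root _ 6) => //; rewrite expr_div_n -exprM eta_Delta.
move: hp; rewrite /phi /sl mE dE nE => hp.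
rewrite (sqrtD_alg _ cn t0 (eta_neq0 4) aE).
apply: aintM hp; apply: aintM; last exact: ctau_integral.
by rewrite -intrM; exact: aint_int.
Qed.

End Main.

(** * Transfer to the standard library reals and the given definitions *)

Lemma ee_arg (R : realType) (x y : R) : twopii R * (x +i* y) = (- (pi *+ 2 * y)) +i* (pi *+ 2 * x).
Proof. by rewrite twopiiE; apply/eqP; rewrite eq_complex /= !(mul0r, mulr0, mulr1, subr0, addr0, add0r, sub0r, oppr0) !eqxx. Qed.

Lemma e2star_alg (F : fieldType) (p i y e : F) : (forall k, (0 < k)%N -> (k%:R : F) != 0) -> p != 0 -> y != 0 -> i * i = -1 ->
  e - 3%:R / (p * y) = e + 12%:R / (2%:R * p * i * (2%:R * (i * y))).
Proof.
move=> nz p0 y0 ii; have n2 := nz 2%N isT.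
have -> : 2%:R * p * i * (2%:R * (i * y)) = - (2%:R * 2%:R * (p * y)).
  have -> : 2%:R * p * i * (2%:R * (i * y)) = 2%:R * 2%:R * (p * y) * (i * i) by ring.
  by rewrite ii mulrN1.
have -> : 12%:R = 3%:R * (2%:R * 2%:R) :> F by rewrite -!natrM.
rewrite invrN mulrN; congr (_ - _).
have Q0 : 2%:R * 2%:R != 0 :> F by exact: mulf_neq0.
by move: (2%:R * 2%:R) Q0 => Q Q0; field; rewrite ?Q0 ?p0 ?y0.
Qed.

Lemma E2s_alt (R : realType) (t : R[i]) : upper t -> E2s t = E2 t - 3%:R / (pi%:C * (complex.Im t)%:C).
Proof.
move=> ut; rewrite /E2s (@e2star_alg _ pi%:C 'i (complex.Im t)%:C).
- congr (_ + _ / (_ * _)); first by rewrite twopiiE rmorphMn /= -mulr_natl.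
  case: t ut => x y ut; apply/eqP; rewrite eq_complex /=; apply/andP; split; apply/eqP; ring.
- exact: nzC.
- by rewrite -nm_gt0 nm_real normr_gt0 gt_eqF // pi_gt0.
- by rewrite -nm_gt0 nm_real normr_gt0 gt_eqF.
- by rewrite -expr2 sqr_i.
Qed.

Import Stdlib.Reals.Reals Rstruct Rstruct_topology.
Local Open Scope ring_scope.
Local Open Scope complex_scope.

Section Trig.
Local Open Scope classical_set_scope.
Local Open Scope ring_scope.
Local Notation R := Rdefinitions.R.

Lemma infinite_sum_near (f g : nat -> R) (l m : R) : f =1 g -> infinite_sum f l ->
  series g @ \oo --> m -> l = m.
Proof.
move=> fg hf hg; apply/eqP; rewrite -subr_eq0 -normr_le0; apply/ler_addgt0Pr => e e0; rewrite add0r.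
have e2 : 0 < e / 2 by rewrite divr_gt0.
have [N _ hN] := proj1 (@cvgrPdist_le R R^o _ _ _ (series g : nat -> R^o) m) hg _ e2.
have [M hM] := hf (e / 2) (elimT (@RltP _ _) e2).
have h1 := hN (maxn N M).+1 (leq_trans (leq_maxl _ _) (leqnSn _)).
have /RltP h2 := hM (maxn N M) (elimT (@ssrnat.leP _ _) (leq_maxr _ _)).
move: h1 h2; rewrite RdistE sum_f_R0E /series /= (eq_bigr g (fun i _ => fg i)).
set s := \sum_(0 <= _ < _) _ => h1 h2.
apply: le_trans (ler_distD s l m) _; rewrite [e]splitr.
by apply: lerD; rewrite distrC // ltW.
Qed.

Lemma RcosE (x : R) : Rtrigo_def.cos x = trigo.cos x.
Proof.
rewrite /Rtrigo_def.cos; case: exist_cos => l hl.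
refine (@infinite_sum_near _ _ _ _ _ hl (@cvg_cos_coeff' _ x)) => n.
rewrite /cos_n /cos_coeff' /Rdiv !RmultE RinvE !RpowE INRE factE /Rsqr RmultE -exprnP.
have -> : (2 * n)%coq_nat = n.*2 by rewrite multE mul2n.
have m1 : (IZR (-1) : R) = -1 by [].
by rewrite m1 -expr2 -exprM mul2n mulrAC.
Qed.

(** Half of either number is a zero of the cosine in [0, 2], and there is only one. *)
Lemma RpiE : Rtrigo1.PI = pi.
Proof.
have [h0 hc] := @pihalf_02_cos_pihalf R.
have two : (IZR 2 : R) = 2%:R by rewrite -INRE.
have four : (IZR 4 : R) = 2%:R * 2%:R by rewrite -natrM -INRE /=; ring.
suff : Rtrigo1.PI / 2%:R = pi / 2%:R by move/(mulIf (invr_neq0 (_ : 2%:R != 0 :> R))) => -> //; rewrite pnatr_eq0.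
apply: cos_02_uniq => //.
- have /RltP := PI_RGT_0; have /RleP := PI_4; rewrite four => h4 hp.
  by rewrite divr_ge0 ?(ltW hp) //= ler_pdivrMr.
- by have := cos_PI2; rewrite RcosE RdivE two.
Qed.

Lemma RsinE (x : R) : Rtrigo_def.sin x = trigo.sin x.
Proof.
have two : (IZR 2 : R) = 2%:R by rewrite -INRE.
by rewrite -cos_shift RcosE RminusE RdivE two RpiE -cosN opprB cosBpihalf.
Qed.

End Trig.

Import Defs.
Local Open Scope ring_scope.
Local Open Scope complex_scope.

Section Bridge.
Local Notation R := Rdefinitions.R.
Local Notation C := R[i].

Definition toC (z : Cx) : C := Defs.Re z +i* Defs.Im z.

Lemma toC_inj z w : toC z = toC w -> z = w.
Proof. by case: z => a b; case: w => c d [/= -> ->]. Qed.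

Lemma toC_R (r : R) : toC (RtoC r) = r%:C. Proof. by []. Qed.
Lemma toC0 : toC C0 = 0. Proof. by []. Qed.
Lemma toC1 : toC Defs.C1 = 1. Proof. by []. Qed.
Lemma toC_add z w : toC (Cadd z w) = toC z + toC w. Proof. by case: z; case: w. Qed.
Lemma toC_opp z : toC (Copp z) = - toC z. Proof. by case: z. Qed.
Lemma toC_sub z w : toC (Csub z w) = toC z - toC w. Proof. by rewrite /Csub toC_add toC_opp. Qed.
Lemma toC_mul z w : toC (Cmul z w) = toC z * toC w. Proof. by case: z; case: w. Qed.

Lemma toC_inv z : toC (Cinv z) = (toC z)^-1.
Proof.
case: z => a b; rewrite /toC /Cinv /=; apply/eqP; rewrite eq_complex /=; apply/andP; split; apply/eqP.
  by rewrite /Rdiv RinvE !RmultE RplusE -!expr2.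
by rewrite /Rdiv RinvE RoppE !RmultE RplusE -!expr2 mulNr.
Qed.

Lemma toC_div z w : toC (Cdiv z w) = toC z / toC w.
Proof. by rewrite /Cdiv toC_mul toC_inv. Qed.

Lemma toC_pow z n : toC (Cpow z n) = toC z ^+ n.
Proof. by elim: n => [|n IH]; rewrite ?expr0 //= toC_mul IH exprS. Qed.

Lemma toC_sum f n : toC (Csum f n) = \sum_(i < n) toC (f i).
Proof. by elim: n => [|n IH]; rewrite ?big_ord0 //= toC_add IH big_ord_recr. Qed.

Lemma toC_nat n : toC (RtoC (INR n)) = n%:R.
Proof. by rewrite toC_R INRE rmorph_nat. Qed.

Definition Zint (m : int) : Z := match m with Posz n => Z.of_nat n | Negz n => Z.opp (Z.of_nat n.+1) end.

Lemma IZR_Zint m : IZR (Zint m) = m%:~R.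
Proof.
case: m => n; rewrite /Zint; first by rewrite -INR_IZR_INZ INRE.
by rewrite opp_IZR -INR_IZR_INZ INRE NegzE mulrNz.
Qed.

Lemma toC_Zint m : toC (ZtoC (Zint m)) = m%:~R.
Proof. by rewrite /ZtoC toC_R IZR_Zint rmorph_int. Qed.

Lemma Zint_surj A : exists m, Zint m = A.
Proof.
case: A => [|p|p].
- by exists 0.
- by exists (Pos.to_nat p)%:Z; exact: Znat.positive_nat_Z.
- have [k hk] := Pnat.Pos2Nat.is_succ p.
  by exists (Negz k); rewrite /Zint -hk Znat.positive_nat_Z.
Qed.

(** The monic polynomial over the integers supplies the degree and the lower coefficients; its
    leading term is the separate power in [is_alg_int]. *)
Lemma aint_alg z : aint (toC z) -> is_alg_int z.
Proof.
case=> p pm pz; have [m sp] : exists m, size p = m.+1.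
  by exists (size p).-1; rewrite prednK // size_poly_gt0 monic_neq0.
exists m, (fun i => Zint p`_i); apply: toC_inj.
rewrite toC_add toC_pow toC_sum toC0.
move: pz; rewrite rootE horner_coef size_map_inj_poly ?rmorph0 //; last exact: intr_inj.
rewrite sp big_ord_recr /= coef_map /= => /eqP E.
apply: etrans E; rewrite addrC; congr (_ + _).
  by move: pm; rewrite monicE lead_coefE sp /= => /eqP ->; rewrite mul1r.
by apply: eq_bigr => i _; rewrite toC_mul toC_pow toC_Zint coef_map.
Qed.

Lemma series_tsum f (l : Cx) : summable (fun n : nat => toC (f n)) -> Cseries_cv f l -> toC l = tsum (fun n => toC (f n)).
Proof.
move=> sf [hr hi]; apply/eqP; rewrite -subr_eq0; apply/eqP; apply: nm_small0 => e e0.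
have e3 : 0 < e / 3 by rewrite divr_gt0.
have [N1 h1] := hr (e / 3) (elimT (@RltP _ _) e3); have [N2 h2] := hi (e / 3) (elimT (@RltP _ _) e3).
have [N3 h3] := has_sum_partial (tsumP sf) e3.
pose N := maxn N1 (maxn N2 N3).
have /RltP := h1 N (elimT (@ssrnat.leP _ _) (leq_maxl _ _)).
have /RltP := h2 N (elimT (@ssrnat.leP _ _) (leq_trans (leq_maxl _ _) (leq_maxr _ _))).
have := h3 N (leq_trans (leq_maxr _ _) (leq_maxr _ _)).
rewrite !RdistE -toC_sum => k3 k2 k1.
apply: le_trans (nm_distD (toC (Csum f N)) _ _) _.
rewrite -nmN opprB.
have := nm_le_ReIm (toC (Csum f N) - toC l).
move: k1 k2; case: (Csum f N) k3 => a b k3; case: (l) => c d /= k1 k2 k4; lra.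
Qed.

Lemma qparE t : toC (qpar t) = ee (toC t).
Proof.
case: t => x y; rewrite /qpar /Cexp /toC /= /ee twopiiE.
have two : (IZR 2 : R) = 2%:R by rewrite -INRE.
rewrite -twopiiE ee_arg.
rewrite cexpE RexpE RcosE RsinE !RmultE RpiE.
have e1 : (IZR (-2) : R) * pi * y = - (pi *+ 2 * y) by rewrite (_ : IZR (-2) = - IZR 2 :> R) // two !mulNr -[pi *+ 2]mulr_natl.
have e2 : (IZR 2 : R) * pi * x = pi *+ 2 * x by rewrite two -[pi *+ 2]mulr_natl.
by rewrite e2 e1.
Qed.

Lemma lambertE k t m : toC (lambert_term k t m) = m.+1%:R ^+ k * (ee (toC t) ^+ m.+1 / (1 - ee (toC t) ^+ m.+1)).
Proof.
rewrite /lambert_term toC_mul toC_div toC_sub !toC_pow qparE toC1.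
by congr (_ * _); rewrite toC_R RpowE INRE rmorphXn rmorph_nat.
Qed.

(** The ordered Lambert series agrees with the unordered sum, by absolute summability; regrouping by
    divisors then gives the q-series. *)
Lemma EisensteinE k (c : R) t E : upper (toC t) -> is_Eisenstein k c t E ->
  toC E = 1 + c%:C * ev (sigc _ k) (ee (toC t)).
Proof.
move=> ut [S [hS ->]]; have q1 := nm_ee_lt1 ut.
rewrite toC_add toC1 toC_mul toC_R -(lam_sig k q1) (lam_lambert k q1).
rewrite (series_tsum _ hS).
  by congr (_ + _ * _); apply: eq_tsum => n; exact: lambertE.
by apply: eq_summable (summable_lambert k q1) => n; rewrite lambertE.
Qed.

End Bridge.

Section Final.
Local Notation R := Rdefinitions.R.

Lemma toC_E2star t E : toC (E2star_of t E) = toC E - 3%:R / (pi%:C * (Defs.Im t)%:C).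
Proof.
rewrite /E2star_of toC_sub toC_R RdivE RmultE RpiE fmorph_div rmorphM.
by rewrite (_ : IZR 3 = 3%:R :> R) ?rmorph_nat // -INRE.
Qed.

Lemma main_bridge (tau : Cx) (A B C : Z) (eta e2 e4 e6 : Cx) :
  Rlt (IZR 0) (Defs.Im tau) ->
  Cadd (ZtoC A) (Cadd (Cmul (ZtoC B) tau) (Cmul (ZtoC C) (Cmul tau tau))) = C0 ->
  Z.lt Z0 C ->
  is_E2 tau e2 -> is_E4 tau e4 -> is_E6 tau e6 ->
  Cmul (RtoC (IZR 1728)) (Cpow eta 24) = Csub (Cpow e4 3) (Cpow e6 2) ->
  [/\ is_alg_int (Cmul (Cadd (Cmul (ZtoC (Z.mul 2 C)) tau) (ZtoC B)) (Cmul (Cdiv (E2star_of tau e2) (Cpow eta 4)) (ZtoC (Z.pow (Z.mul A C) 2)))),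
      is_alg_int (Cdiv e4 (Cpow eta 8)) & is_alg_int (Cdiv e6 (Cpow eta 12))].
Proof.
move=> /RltP ut quad hC h2 h4 h6 heta.
have [a hA] := Zint_surj A; have [b hB] := Zint_surj B; have [c hc] := Zint_surj C.
have ut' : upper (toC tau) by [].
have quad' : a%:~R + (b%:~R * toC tau + c%:~R * (toC tau * toC tau)) = 0.
  by have := congr1 toC quad; rewrite -hA -hB -hc !toC_add !toC_mul !toC_Zint.
have c0 : 0 < c.
  have := IZR_lt _ _ hC; rewrite -hc => /RltP; rewrite IZR_Zint ltr0z //.
have n24 : ((IZR (-24))%:C : R[i]) = - 24%:R.
  by rewrite (_ : IZR (-24) = - 24%:R :> R) ?rmorphN ?rmorph_nat // -INRE INR_IZR_INZ.
have n240 : ((IZR 240)%:C : R[i]) = 240%:R.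
  by rewrite (_ : IZR 240 = 240%:R :> R) ?rmorph_nat // -INRE INR_IZR_INZ.
have n504 : ((IZR (-504))%:C : R[i]) = - 504%:R.
  by rewrite (_ : IZR (-504) = - 504%:R :> R) ?rmorphN ?rmorph_nat // -INRE INR_IZR_INZ.
have q1 := nm_ee_lt1 ut'.
have e2E : toC e2 = E2 (toC tau) by rewrite (EisensteinE ut' h2) /E2 ev_ec // n24.
have e4E : toC e4 = E4 (toC tau) by rewrite (EisensteinE ut' h4) /E4 ev_ec // n240.
have e6E : toC e6 = E6 (toC tau) by rewrite (EisensteinE ut' h6) /E6 ev_ec // n504.
have heta' : 12%:R ^+ 3 * toC eta ^+ 24 = E4 (toC tau) ^+ 3 - E6 (toC tau) ^+ 2.
  rewrite -e4E -e6E -!toC_pow -toC_sub -heta toC_mul; congr (_ * _).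
  rewrite toC_R (_ : IZR 1728 = 12%:R ^+ 3 :> R) ?rmorphXn ?rmorph_nat //.
  by rewrite -[12%:R]INRE INR_IZR_INZ -RpowE pow_IZR.
split; apply: aint_alg.
- rewrite toC_mul toC_add toC_mul toC_mul toC_div toC_pow toC_E2star e2E -E2s_alt //.
  have -> : toC (ZtoC (Z.pow (Z.mul A C) 2)) = (a%:~R * c%:~R) ^+ 2.
    by rewrite Z.pow_2_r /ZtoC !mult_IZR -hA -hc !IZR_Zint toC_R !rmorphM /= !rmorph_int expr2.
  have -> : toC (ZtoC (Z.mul 2 C)) = 2%:R * c%:~R.
    rewrite /ZtoC mult_IZR -hc IZR_Zint toC_R rmorphM /= rmorph_int; congr (_ * _).
    by rewrite (_ : IZR 2 = 2%:R :> R) ?rmorph_nat // -INRE.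
  rewrite -hB toC_Zint mulrA; exact: (E2_integral ut' quad' c0 heta').
- rewrite toC_div toC_pow e4E; exact: (E4_integral ut' quad' c0 heta').
- rewrite toC_div toC_pow e6E; exact: (E6_integral ut' quad' c0 heta').
Qed.

End Final.

Require Import Defs.
From Stdlib Require Import Reals ZArith.
Open Scope R_scope.

Theorem mainTheorem19 (tau : Cx) (A B C : Z) (eta E2 E4 E6 : Cx) :
  0 < Im tau ->
  Cadd (ZtoC A) (Cadd (Cmul (ZtoC B) tau) (Cmul (ZtoC C) (Cmul tau tau))) = C0 ->
  Z.gcd (Z.gcd A B) C = 1%Z ->
  (0 < C)%Z ->
  is_E2 tau E2 -> is_E4 tau E4 -> is_E6 tau E6 ->
  Cmul (RtoC 1728) (Cpow eta 24) = Csub (Cpow E4 3) (Cpow E6 2) ->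
  let sqrtD := Cadd (Cmul (ZtoC (2 * C)) tau) (ZtoC B) in
  is_alg_int (Cmul sqrtD (Cmul (Cdiv (E2star_of tau E2) (Cpow eta 4))
                               (ZtoC ((A * C) ^ 2)))) /\
  is_alg_int (Cdiv E4 (Cpow eta 8)) /\
  is_alg_int (Cdiv E6 (Cpow eta 12)).
Proof.
move=> ut quad _ hC h2 h4 h6 heta.
by have [g2 g4 g6] := main_bridge ut quad hC h2 h4 h6 heta; split; [|split].
Qed.
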